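(* Let $\{w_m\}_{m\in\mathbb{N}_0}$ be the sequence of functions $[0,T]\times\mathbb{R}^{d_{\mathbf{x}}}\to\mathbb{R}^{d_{\mathbf{y}}}$ defined recursively as solutions of the following linear PDEs: $w_0$ solves $$\frac{\partial}{\partial s}w_0(s,\mathbf{x})+\left\langle b(s,\mathbf{x})-\int_{\mathbb{R}_0^{d_{\mathbf{z}}}}h(s,\mathbf{x},\mathbf{z})\lambda(s,\mathbf{x})\nu(d\mathbf{z}),\nabla w_0(s,\mathbf{x})\right\rangle+\frac12\mathrm{tr}\left[(\sigma(s,\mathbf{x}))^{\otimes2}\mathrm{Hess}(w_0(s,\mathbf{x}))\right]=0$$ for $(s,\mathbf{x})\in[0,T)\times\mathbb{R}^{d_{\mathbf{x}}}$ with $w_0(T,\mathbf{x})=\Phi(\mathbf{x})$, and, for $m\in\mathbb{N}$, $w_m$ solves $$\frac{\partial}{\partial s}w_m(s,\mathbf{x})+\left\langle b(s,\mathbf{x})-\int_{\mathbb{R}_0^{d_{\mathbf{z}}}}h(s,\mathbf{x},\mathbf{z})\lambda(s,\mathbf{x})\nu(d\mathbf{z}),\nabla w_m(s,\mathbf{x})\right\rangle+\frac12\mathrm{tr}\left[(\sigma(s,\mathbf{x}))^{\otimes2}\mathrm{Hess}(w_m(s,\mathbf{x}))\right]$$ $$+f(s,\mathbf{x},w_{m-1}(s,\mathbf{x}),(\nabla w_{m-1}\sigma)(s,\mathbf{x}),\gamma(s,\mathbf{x};w_{m-1}))+\gamma(s,\mathbf{x};w_{m-1})=0$$ for $(s,\mathbf{x})\in[0,T)\times\mathbb{R}^{d_{\mathbf{x}}}$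 with $w_m(T,\mathbf{x})=\Phi(\mathbf{x})$. For $(t,\mathbf{x})\in[0,T]\times\mathbb{R}^{d_{\mathbf{x}}}$ let $\{\widetilde X_s^{t,\mathbf{x}}\}_{s\in[t,T]}$ be the solution to $$d\widetilde X_s^{t,\mathbf{x}}=b(s,\widetilde X_s^{t,\mathbf{x}})ds+\sigma(s,\widetilde X_s^{t,\mathbf{x}})dB_s-\int_{\mathbb{R}_0^{d_{\mathbf{z}}}}h(s,\widetilde X_s^{t,\mathbf{x}},\mathbf{z})\lambda(s,\widetilde X_s^{t,\mathbf{x}})\nu(d\mathbf{z})ds,\qquad \widetilde X_t^{t,\mathbf{x}}=\mathbf{x}.$$ If $w_m\in\mathcal{C}^{1,2}([0,T]\times\mathbb{R}^{d_{\mathbf{x}}};\mathbb{R}^{d_{\mathbf{y}}})$, $\sup_{(t,\mathbf{x})\in[0,T]\times\mathbb{R}^{d_{\mathbf{x}}}}|w_m(t,\mathbf{x})|\le C$ and $\sup_{(t,\mathbf{x})\in[0,T]\times\mathbb{R}^{d_{\mathbf{x}}}}|\nabla w_m(t,\mathbf{x})|\le C$ for some universal constant $C>0$ and all $m\in\mathbb{N}_0$, then for every $(t,\mathbf{x})\in[0,T]\times\mathbb{R}^{d_{\mathbf{x}}}$, $$w_0(t,\mathbf{x})=\mathbb{E}\left[\Phi(\widetilde X_T^{t,\mathbf{x}})\right],$$ and, for all $m\in\mathbb{N}$, $$w_m(t,\mathbf{x})=\mathbb{E}\left[\Phi(\widetilde X_T^{t,\mathbf{x}})+\int_t^Tf(s,\widetilde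 X_s^{t,\mathbf{x}},w_{m-1}(s,\widetilde X_s^{t,\mathbf{x}}),(\nabla w_{m-1}\sigma)(s,\widetilde X_s^{t,\mathbf{x}}),\gamma(s,\widetilde X_s^{t,\mathbf{x}};w_{m-1}))ds+\int_t^T\gamma(s,\widetilde X_s^{t,\mathbf{x}};w_{m-1})ds\right].$$
   Context: Notation. $T>0$ is a fixed terminal time; $d_{\mathbf{x}},d_{\mathbf{y}},d_{\mathbf{z}},d_0\in\mathbb{N}$; $\mathbb{N}_0=\mathbb{N}\cup\{0\}$; $\mathbb{R}_0^{d}:=\mathbb{R}^d\setminus\{0\}$. $(\Omega,\mathcal{F},(\mathcal{F}_s)_{s\in[0,T]},\mathbb{P})$ is a filtered probability space with right-continuous filtration and $\mathcal{F}_0$ containing the null sets, and $\{B_s\}_{s\in[0,T]}$ is an $(\mathcal{F}_s)$-adapted standard Brownian motion in $\mathbb{R}^{d_0}$. Gradient $\nabla$ and Hessian are taken in the state variable $\mathbf{x}$; when $d_{\mathbf{y}}>1$ the differential expressions are understood componentwise. $A^{\otimes 2}:=AA^{\top}$. For $v=(v_1,\dots,v_{d_{\mathbf{y}}})^\top$, $(\nabla v\,\sigma)(s,\mathbf{x}):=(\nabla v_1(s,\mathbf{x}),\dots,\nabla v_{d_{\mathbf{y}}}(s,\mathbf{x}))^{\top}\sigma(s,\mathbf{x})\in\mathbb{R}^{d_{\mathbf{y}}\times d_0}$. For a function $\phi$ on $[0,T]\times\mathbb{R}^{d_{\mathbf{x}}}$ (componentwise if vector-valued), $$\gamma(s,\mathbf{x};\phi):=\int_{\mathbb{R}_0^{d_{\mathbf{z}}}}(\phi(s,\mathbf{x}+h(s,\mathbf{x},\mathbf{z}))-\phi(s,\mathbf{x}))\lambda(s,\mathbf{x})\nu(d\mathbf{z}).$$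 Data: $b:[0,T]\times\mathbb{R}^{d_{\mathbf{x}}}\to\mathbb{R}^{d_{\mathbf{x}}}$, $\sigma:[0,T]\times\mathbb{R}^{d_{\mathbf{x}}}\to\mathbb{R}^{d_{\mathbf{x}}\times d_0}$, $h:[0,T]\times\mathbb{R}^{d_{\mathbf{x}}}\times\mathbb{R}_0^{d_{\mathbf{z}}}\to\mathbb{R}^{d_{\mathbf{x}}}$, $f:[0,T]\times\mathbb{R}^{d_{\mathbf{x}}}\times\mathbb{R}^{d_{\mathbf{y}}}\times\mathbb{R}^{d_{\mathbf{y}}\times d_0}\times\mathbb{R}^{d_{\mathbf{y}}}\to\mathbb{R}^{d_{\mathbf{y}}}$ (arguments $(t,\mathbf{x},\mathbf{y},\mathbf{z},u)$), $\Phi:\mathbb{R}^{d_{\mathbf{x}}}\to\mathbb{R}^{d_{\mathbf{y}}}$, $\lambda:[0,T]\times\mathbb{R}^{d_{\mathbf{x}}}\to[0,+\infty)$, and $\nu$ a measure on $\mathbb{R}_0^{d_{\mathbf{z}}}$. Standing assumptions: - $b$ and $\sigma$ are continuously differentiable in $\mathbf{x}$ with bounded zeroth- and first-order partial derivatives in $\mathbf{x}$. - $f$ and $\Phi$ are uniformly Lipschitz continuous in $(\mathbf{x},\mathbf{y},\mathbf{z},u)$, and continuously differentiable in $(\mathbf{x},\mathbf{y},\mathbf{z})$ with bounded zeroth- and first-order partial derivatives in $(\mathbf{x},\mathbf{y},\mathbf{z})$ (for $\Phi$, in its only variable $\mathbf{x}$). - $b,\sigma,f$ are uniformly $(1/2)$-Hölder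 continuous in $t$. - $\lambda$ is non-negative and continuous in all its arguments, with $\sup_{(s,\mathbf{x})\in[0,T]\times\mathbb{R}^{d_{\mathbf{x}}}}\lambda(s,\mathbf{x})=\eta$ for some non-negative $\eta$. - $\nu$ is a Lévy measure on $\mathbb{R}_0^{d_{\mathbf{z}}}$ with $\nu(\mathbb{R}_0^{d_{\mathbf{z}}})=1$. - For some $C>0$, $|h(t,\mathbf{x},\mathbf{z})|\le C\min\{1,|\mathbf{z}|\}$ and $|h(t,\mathbf{x},\mathbf{z})-h(t,\mathbf{x}',\mathbf{z})|\le C|\mathbf{x}-\mathbf{x}'|\min\{1,|\mathbf{z}|\}$ for all $(t,\mathbf{x},\mathbf{x}',\mathbf{z})\in[0,T]\times\mathbb{R}^{d_{\mathbf{x}}}\times\mathbb{R}^{d_{\mathbf{x}}}\times\mathbb{R}_0^{d_{\mathbf{z}}}$. - $\sigma$ is uniformly elliptic on $[0,T]\times\mathbb{R}^{d_{\mathbf{x}}}$. *)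

(* Defs.v *)
From HB Require Import structures.
From mathcomp Require Import all_boot all_order all_algebra.
From mathcomp Require Import all_classical all_reals all_analysis.
Set Implicit Arguments.
Unset Strict Implicit.
Unset Printing Implicit Defensive.
Import Order.TTheory GRing.Theory Num.Theory.
Import numFieldNormedType.Exports.
Local Open Scope classical_set_scope.
Local Open Scope ring_scope.

(* The library norm on matrices is the sup norm; this is the Euclidean
   (Frobenius) norm. *)
Definition enorm {R : realType} {m n : nat} (A : 'M[R]_(m, n)) : R :=
  Num.sqrt (\sum_i \sum_j A i j ^+ 2).

Definition borel (T : ptopologicalType) := g_sigma_algebraType (@open T).

(* R_0^d *)
Definition punctured {R : realType} {d : nat} : set 'cV[R]_d := [set z | z != 0].

Section calculus.
Context {R : realType}.

Definition evec {n : nat} (i : 'I_n) : 'cV[R]_n := delta_mx i 0.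

Definition grad {n : nat} (u : 'cV[R]_n -> R) (x : 'cV[R]_n) : 'cV[R]_n :=
  \col_i 'D_(evec i) u x.

Definition hess {n : nat} (u : 'cV[R]_n -> R) (x : 'cV[R]_n) : 'M[R]_n :=
  \matrix_(i, j) 'D_(evec i) (fun y => 'D_(evec j) u y) x.

Definition jac {n p : nat} (v : 'cV[R]_n -> 'cV[R]_p) (x : 'cV[R]_n) : 'M[R]_(p, n) :=
  \matrix_(k, i) grad (fun y => v y k 0) x i 0.

(* Difference quotients are restricted to [0, T], so that the time derivative
   is one-sided at both endpoints. *)
Definition tquot {U : Type} {V : normedModType R} (v : R -> U -> V) (s : R) (x : U)
    (r : R) : V := (r - s)^-1 *: (v r x - v s x).

Definition dtime (T : R) {U : Type} {V : normedModType R} (v : R -> U -> V)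
    (s : R) (x : U) : V :=
  lim (tquot v s x r @[r --> within `[0, T] s^']).

Definition strip (T : R) {n : nat} : set (R * 'cV[R]_n) := [set p | 0 <= p.1 <= T].

Definition C12 (T : R) {n p : nat} (v : R -> 'cV[R]_n -> 'cV[R]_p) : Prop :=
  [/\ forall (s : R) x, 0 <= s <= T -> cvg (tquot v s x r @[r --> within `[0, T] s^']),
      forall (s : R) x k i, 0 <= s <= T -> derivable (fun y => v s y k 0) x (evec i),
      forall (s : R) x k i j, 0 <= s <= T ->
        derivable (fun y => 'D_(evec j) (fun y' => v s y' k 0) y) x (evec i) &
      [/\ {within strip T, continuous (fun q => v q.1 q.2)},
          {within strip T, continuous (fun q => dtime T v q.1 q.2)},
          {within strip T, continuous (fun q => jac (v q.1) q.2)} &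
          forall k, {within strip T,
            continuous (fun q => hess (fun y => v q.1 y k 0) q.2)}]].

(* Since C is always existentially quantified, which norm is used is immaterial;
   the first-order partial derivatives are the cases where v is a basis vector. *)
Definition C1_bounded (C : R) {U V : normedModType R} (g : U -> V) : Prop :=
  [/\ forall p, differentiable g p,
      forall v, continuous (fun p => 'D_v g p),
      forall p, `|g p| <= C &
      forall p v, `|'D_v g p| <= C * `|v|].

End calculus.

Section coefficients.
Context {R : realType} (T : R).

Definition C1_bounded_coef {U V : normedModType R} (g : R -> U -> V) : Prop :=
  exists C : R, forall t : R, 0 <= t <= T -> C1_bounded C (g t).

Definition half_holder {U : Type} {m n : nat} (g : R -> U -> 'M[R]_(m, n)) : Prop :=
  exists K : R, forall (t t' : R) x, 0 <= t <= T -> 0 <= t' <= T ->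
    enorm (g t x - g t' x) <= K * Num.sqrt `|t - t'|.

Definition lipschitz_driver {dx dy d0 : nat}
    (f : R -> 'cV[R]_dx -> 'cV[R]_dy -> 'M[R]_(dy, d0) -> 'cV[R]_dy -> 'cV[R]_dy) : Prop :=
  exists L : R, forall (t : R) x x' y y' z z' u u', 0 <= t <= T ->
    enorm (f t x y z u - f t x' y' z' u') <=
      L * (enorm (x - x') + enorm (y - y') + enorm (z - z') + enorm (u - u')).

Definition C1_bounded_driver {dx dy d0 : nat}
    (f : R -> 'cV[R]_dx -> 'cV[R]_dy -> 'M[R]_(dy, d0) -> 'cV[R]_dy -> 'cV[R]_dy) : Prop :=
  exists C : R, forall (t : R) u, 0 <= t <= T ->
    C1_bounded C (fun p : 'cV[R]_dx * 'cV[R]_dy * 'M[R]_(dy, d0) =>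
                    f t p.1.1 p.1.2 p.2 u).

Definition half_holder_driver {dx dy d0 : nat}
    (f : R -> 'cV[R]_dx -> 'cV[R]_dy -> 'M[R]_(dy, d0) -> 'cV[R]_dy -> 'cV[R]_dy) : Prop :=
  half_holder (fun t (p : 'cV[R]_dx * 'cV[R]_dy * 'M[R]_(dy, d0) * 'cV[R]_dy) =>
                 f t p.1.1.1 p.1.1.2 p.1.2 p.2).

Definition lipschitz_terminal {dx dy : nat} (Phi : 'cV[R]_dx -> 'cV[R]_dy) : Prop :=
  exists L : R, forall x x', enorm (Phi x - Phi x') <= L * enorm (x - x').

Definition intensity {dx : nat} (lam : R -> 'cV[R]_dx -> R) (eta : R) : Prop :=
  [/\ 0 <= eta,
      forall (s : R) x, 0 <= s <= T -> 0 <= lam s x,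
      {within strip T, continuous (fun q => lam q.1 q.2)} &
      ereal_sup [set (lam q.1 q.2)%:E | q in strip T] = eta%:E].

(* The values h(t, x, 0) are never used. *)
Definition jump_bounds {dx dz : nat} (h : R -> 'cV[R]_dx -> 'cV[R]_dz -> 'cV[R]_dx) : Prop :=
  exists2 C : R, 0 < C &
    forall (t : R) x x' z, 0 <= t <= T -> punctured z ->
      enorm (h t x z) <= C * Num.min 1 (enorm z) /\
      enorm (h t x z - h t x' z) <= C * enorm (x - x') * Num.min 1 (enorm z).

Definition jump_measurable {dx dz : nat}
    (h : R -> 'cV[R]_dx -> 'cV[R]_dz -> 'cV[R]_dx) : Prop :=
  forall i, measurable_fun
    [set p : measurableTypeR R * borel 'cV[R]_dx * borel 'cV[R]_dz |
       0 <= p.1.1 <= T /\ punctured p.2]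
    (fun p => h p.1.1 p.1.2 p.2 i 0).

Definition uniformly_elliptic {dx d0 : nat}
    (sigma : R -> 'cV[R]_dx -> 'M[R]_(dx, d0)) : Prop :=
  exists2 c : R, 0 < c & forall (s : R) x (xi : 'cV[R]_dx), 0 <= s <= T ->
    c * enorm xi ^+ 2 <= (xi^T *m (sigma s x *m (sigma s x)^T) *m xi) 0 0.

End coefficients.

Section jumps.
Context {R : realType} {dx dz : nat}.
Variable nu : {measure set (borel 'cV[R]_dz) -> \bar R}.

(* nu is used only through its restriction to R_0^dz. *)
Definition levy_measure : Prop :=
  (\int[nu]_(z in @punctured R dz) (Num.min 1 (enorm z ^+ 2))%:E < +oo)%E.

Variables (h : R -> 'cV[R]_dx -> 'cV[R]_dz -> 'cV[R]_dx) (lam : R -> 'cV[R]_dx -> R).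

Definition compensator (s : R) (x : 'cV[R]_dx) : 'cV[R]_dx :=
  \col_i \int[nu]_(z in @punctured R dz) (h s x z i 0 * lam s x).

Definition gamma {dy : nat} (phi : R -> 'cV[R]_dx -> 'cV[R]_dy)
    (s : R) (x : 'cV[R]_dx) : 'cV[R]_dy :=
  \col_k \int[nu]_(z in @punctured R dz)
    ((phi s (x + h s x z) k 0 - phi s x k 0) * lam s x).

Definition pde_linear_part (T : R) {d0 dy : nat} (b : R -> 'cV[R]_dx -> 'cV[R]_dx)
    (sigma : R -> 'cV[R]_dx -> 'M[R]_(dx, d0)) (v : R -> 'cV[R]_dx -> 'cV[R]_dy)
    (s : R) (x : 'cV[R]_dx) : 'cV[R]_dy :=
  \col_k (dtime T v s x k 0
    + ((b s x - compensator s x)^T *m grad (fun y => v s y k 0) x) 0 0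
    + 2^-1 * \tr ((sigma s x *m (sigma s x)^T) *m hess (fun y => v s y k 0) x)).

End jumps.

Section stochastic.
Context {d : measure_display} {Omega : measurableType d} {R : realType}.
Variable P : probability Omega R.

Definition filtration (T : R) (F : R -> set (set Omega)) : Prop :=
  [/\ forall s : R, 0 <= s <= T -> sigma_algebra setT (F s) /\ F s `<=` measurable,
      forall s r : R, 0 <= s -> s <= r -> r <= T -> F s `<=` F r,
      forall s : R, 0 <= s -> s < T ->
        F s = \bigcap_(r in [set r | s < r <= T]) F r &
      forall N, measurable N -> P N = 0%E -> F 0 N].

Definition measurable_wrt (G : set (set Omega)) {m n : nat}
    (Y : Omega -> 'M[R]_(m, n)) : Prop :=
  forall i j (U : set R), measurable U -> G [set w | U (Y w i j)].

Definition adapted (F : R -> set (set Omega)) (a b : R) {m n : nat}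
    (Y : R -> Omega -> 'M[R]_(m, n)) : Prop :=
  forall s : R, a <= s <= b -> measurable_wrt (F s) (Y s).

Definition continuous_paths (a b : R) {m n : nat} (Y : R -> Omega -> 'M[R]_(m, n)) : Prop :=
  {ae P, forall w, {within `[a, b], continuous (fun s => Y s w)}}.

(* Brownian motion relative to the filtration. The second parameter of
   normal_prob is the standard deviation. *)
Definition brownian_motion (T : R) (F : R -> set (set Omega)) {d0 : nat}
    (B : R -> Omega -> 'cV[R]_d0) : Prop :=
  [/\ adapted F 0 T B,
      {ae P, forall w, B 0 w = 0},
      continuous_paths 0 T B,
      forall (s r : R) (A : set Omega) (U : set (borel 'cV[R]_d0)),
        0 <= s -> s < r -> r <= T -> F s A -> measurable U ->
        P (A `&` [set w | U (B r w - B s w)%R]) =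
          (P A * P [set w | U (B r w - B s w)%R])%E &
      forall (s r : R) (U : 'I_d0 -> set R),
        0 <= s -> s < r -> r <= T -> (forall i, measurable (U i)) ->
        P [set w | forall i, U i (B r w i 0 - B s w i 0)] =
          (\prod_(i < d0) normal_prob 0 (Num.sqrt (r - s)) (U i))%E].

Record simple_process (m n : nat) := SimpleProcess {
  sp_size : nat;
  sp_time : nat -> R;
  sp_val : nat -> Omega -> 'M[R]_(m, n) }.

Definition simple_on (F : R -> set (set Omega)) (a b : R) {m n : nat}
    (S : simple_process m n) : Prop :=
  [/\ sp_time S 0 = a,
      sp_time S (sp_size S) = b,
      forall k, (k < sp_size S)%N -> sp_time S k <= sp_time S k.+1 &
      forall k, (k < sp_size S)%N -> measurable_wrt (F (sp_time S k)) (sp_val S k) /\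
        exists C : R, forall w, enorm (sp_val S k w) <= C].

Definition sp_eval {m n : nat} (S : simple_process m n) (s : R) (w : Omega) : 'M[R]_(m, n) :=
  \sum_(k < sp_size S)
    (if sp_time S k < s <= sp_time S k.+1 then sp_val S k w else 0).

Definition sp_integral {m n : nat} (S : simple_process m n) (B : R -> Omega -> 'cV[R]_n)
    (w : Omega) : 'cV[R]_m :=
  \sum_(k < sp_size S)
    sp_val S k w *m (B (sp_time S k.+1) w - B (sp_time S k) w).

(* E int_a^b |H_s|^2 ds *)
Definition sq_norm (a b : R) {m n : nat} (H : R -> Omega -> 'M[R]_(m, n)) : \bar R :=
  (\int[P]_w \int[lebesgue_measure]_(s in `[a, b]) (enorm (H s w) ^+ 2)%:E)%E.

Definition ito_integrand (F : R -> set (set Omega)) (a b : R) {m n : nat}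
    (H : R -> Omega -> 'M[R]_(m, n)) : Prop :=
  [/\ forall i j, measurable_fun (`[a, b] `*` setT)
        (fun p : measurableTypeR R * Omega => H p.1 p.2 i j),
      adapted F a b H &
      (sq_norm a b H < +oo)%E].

(* I is (a version of) int_a^b H_s dB_s, the L^2 limit of the integrals of simple
   processes approximating H in L^2. *)
Definition ito_integral (F : R -> set (set Omega)) {n : nat} (B : R -> Omega -> 'cV[R]_n)
    (a b : R) {m : nat} (H : R -> Omega -> 'M[R]_(m, n)) (I : Omega -> 'cV[R]_m) : Prop :=
  [/\ ito_integrand F a b H,
      measurable_wrt measurable I &
      exists S : nat -> simple_process m n,
        [/\ forall k, simple_on F a b (S k),
            sq_norm a b (fun s w => H s w - sp_eval (S k) s w) @[k --> \oo] --> 0%E &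
            (\int[P]_w (enorm (I w - sp_integral (S k) B w) ^+ 2)%:E)%E
              @[k --> \oo] --> 0%E]].

Definition solves_sde (T : R) (F : R -> set (set Omega)) {dx dz d0 : nat}
    (B : R -> Omega -> 'cV[R]_d0) (b : R -> 'cV[R]_dx -> 'cV[R]_dx)
    (sigma : R -> 'cV[R]_dx -> 'M[R]_(dx, d0))
    (h : R -> 'cV[R]_dx -> 'cV[R]_dz -> 'cV[R]_dx) (lam : R -> 'cV[R]_dx -> R)
    (nu : {measure set (borel 'cV[R]_dz) -> \bar R})
    (t : R) (x : 'cV[R]_dx) (X : R -> Omega -> 'cV[R]_dx) : Prop :=
  [/\ adapted F t T X,
      continuous_paths t T X,
      {ae P, forall w, X t w = x} &
      forall r : R, t <= r <= T ->
        exists2 I : Omega -> 'cV[R]_dx,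
          ito_integral F B t r (fun s w => sigma s (X s w)) I &
          {ae P, forall w, X r w =
            x + \col_i (\int[lebesgue_measure]_(s in `[t, r]) b s (X s w) i 0)
              + I w
              - \col_i (\int[lebesgue_measure]_(s in `[t, r])
                          compensator nu h lam s (X s w) i 0)}].

End stochastic.

(* Main.v *)
(* Ito's formula is avoided. Along a partition of [t, T], v(s, X_s) is Taylor expanded to first
   order in time and second order in space. Given F_s, the frozen noise increment
   sigma(s, X_s) dB has mean zero and the covariance that makes the quadratic term match the
   second-order term of the PDE, so the PDE cancels the drift against the source G up to
   o(mesh). What remains is controlled by second and fourth moments of the increments, on the
   event that the discretised path has not yet left a large box. Letting the mesh go to 0 and
   then the box grow gives E v(T, X_T) - v(t, x) + E (int_t^T G(s, X_s) ds) = 0; each component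
   of w_m is such a v. *)

Require Import Defs.
From HB Require Import structures.
From mathcomp Require Import all_boot all_order all_algebra.
From mathcomp Require Import all_classical all_reals all_analysis.
From mathcomp Require Import measurable_realfun ring lra.
Set Implicit Arguments.
Unset Strict Implicit.
Unset Printing Implicit Defensive.
Import Order.TTheory GRing.Theory Num.Theory.
Import numFieldNormedType.Exports.
Local Open Scope classical_set_scope.
Local Open Scope ring_scope.

(** The obstacle is integrability. For each time separately the equation offers some version of an
    $L^2$ limit, so the isometry yields second moments of path increments and nothing higher, while
    a second-order Taylor remainder asks for more. The way out is to split an increment into the
    Gaussian vector with diffusion coefficient frozen at the left endpoint, whose fourth moment is
    of order mesh^2, and a remainder whose mean square is of order mesh^2 as well: a bounded drift
    gives this at once, and the regularity of [sigma] bounds the squared freezing error by mesh plus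
    the squared path increment, which integrates in time to mesh^2. An increment longer than a fixed
    [r] then has its square bounded by a constant times (fourth power of the Gaussian part + square
    of the remainder), so long increments are negligible in mean. The second obstacle is that the
    time derivative and the Hessian are controlled only on bounded sets, which forces the
    localisation; stopping at grid times instead of a true exit time keeps every quantity a finite
    sum over deterministic intervals. *)

Section null_set.
Context d (T : measurableType d) (R : realType) (mu : {measure set T -> \bar R}).
Import HBNNSimple.

(** A nonnegative integral is a supremum over simple functions below the integrand. Cutting such a
    function to the complement of [N] keeps its integral and puts it below [g]. No measurability is
    asked, so random variables built from paths that are bad on a null set can be compared. *)
Lemma ge0_le_integral_off_null (N : set T) (f g : T -> \bar R) :
  measurable N -> mu N = 0%E -> (forall x, 0 <= f x)%E -> (forall x, 0 <= g x)%E ->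
  (forall x, ~ N x -> f x = g x) -> (\int[mu]_x f x <= \int[mu]_x g x)%E.
Proof.
move=> mN N0 f0 g0 fg; rewrite !ge0_integralTE//.
apply: ge_ereal_sup => _ [h hf <-].
have mNC : measurable (~` N) by exact: measurableC.
have -> : sintegral mu h = sintegral mu (proj_nnsfun h mNC).
  rewrite -mrestrict -integral_nnsfun// -integralT_nnsfun.
  rewrite (@ge0_negligible_integral _ _ _ mu setT N)//=.
  - by rewrite setTD.
  - by apply/measurable_EFinP.
  - by move=> x _; rewrite lee_fin.

apply: ereal_sup_ubound; exists (proj_nnsfun h mNC) => // x.
rewrite /proj_nnsfun /= mindicE.
have [Nx|Nx] := pselect (N x); first by rewrite memNset ?mulr0//= => /(_ Nx).
by rewrite mem_set// mulr1 -fg.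
Qed.

Lemma integral_off_null (N D : set T) (f g : T -> \bar R) :
  measurable N -> mu N = 0%E ->
  (forall x, D x -> ~ N x -> f x = g x) ->
  (\int[mu]_(x in D) f x = \int[mu]_(x in D) g x)%E.
Proof.
move=> mN N0 fg; rewrite [LHS]integral_mkcond [RHS]integral_mkcond.
have eqr : forall x, ~ N x -> (f \_ D) x = (g \_ D) x.
  by move=> x Nx; rewrite !patchE; case: ifPn => // /set_mem xD; rewrite fg.
rewrite [LHS]integralE [RHS]integralE; congr (_ - _)%E; apply/eqP; rewrite eq_le;
  apply/andP; split; apply: (ge0_le_integral_off_null mN N0) => // x Nx;
  by rewrite ?funeposE ?funenegE eqr.
Qed.

End null_set.

(** * Product rule for independent random variables *)

Section independence.
Context d (T : measurableType d) (R : realType) (P : probability T R).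

(** The law of the pair agrees with the product of the two laws on rectangles, hence everywhere, and
    Fubini finishes. Integrability of the product is obtained first, from Tonelli applied to
    absolute values. *)
Lemma indep_expectation (U V : T -> R) :
  measurable_fun setT U -> measurable_fun setT V ->
  (forall A B, measurable A -> measurable B ->
    P (U @^-1` A `&` V @^-1` B) = (P (U @^-1` A) * P (V @^-1` B))%E) ->
  P.-integrable setT (EFin \o U) -> P.-integrable setT (EFin \o V) ->
  P.-integrable setT (fun w => (U w * V w)%:E) /\
  \int[P]_w (U w * V w) = \int[P]_w U w * \int[P]_w V w.
Proof.
move=> mU mV ind iU iV.
pose U' : {mfun T >-> R} := HB.pack U (isMeasurableFun.Build _ _ _ _ U mU).
pose V' : {mfun T >-> R} := HB.pack V (isMeasurableFun.Build _ _ _ _ V mV).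
have mW : measurable_fun setT (fun w => (U w, V w)) by exact: measurable_fun_pair.
pose W : {mfun T >-> (R * R)%type} :=
  HB.pack (fun w => (U w, V w)) (isMeasurableFun.Build _ _ _ _ _ mW).
pose m1 := distribution P U'. pose m2 := distribution P V'.
have E A : measurable A -> (m1 \x m2)%E A = distribution P W A.
  apply: product_measure_unique => A1 A2 mA1 mA2.
  by rewrite /= -ind.
have tr (f : R * R -> \bar R) : measurable_fun setT f -> (forall x, 0 <= f x)%E ->
    (\int[P]_w f (U w, V w) = \int[(m1 \x m2)%E]_p f p)%E.
  move=> mf f0.
  rewrite -[LHS](@ge0_integral_distribution _ _ _ _ _ P W f mf f0).
  by apply: eq_measure_integral => A mA _; exact/esym/E.
have mp : measurable_fun setT (fun p : R * R => (p.1 * p.2)%:E).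
  apply/measurable_EFinP; apply: measurable_funM => //.
have fin (X : T -> R) : P.-integrable setT (EFin \o X) ->
    (\int[P]_w `|X w|%:E < +oo)%E.
  by move=> /integrableP[_]; under eq_integral do rewrite abse_EFin.
have iUV : (m1 \x m2)%E.-integrable setT (fun p => (p.1 * p.2)%:E).
  apply/integrableP; split=> //.
  have mabs : measurable_fun setT (fun y : R => `|y|%:E).
    by apply/measurable_EFinP; exact: normr_measurable.
  rewrite fubini_tonelli1//; last by apply: measurableT_comp.
  rewrite /fubini_F /=.
  have -> : (\int[m1]_x \int[m2]_y `|x * y|%:E =
      \int[m1]_x ( `|x|%:E * \int[m2]_y `|y|%:E))%E.
    apply: eq_integral => x _; rewrite -ge0_integralZl//.
    by apply: eq_integral => y _; rewrite normrM EFinM.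
  rewrite ge0_integralZr//; last exact: integral_ge0.
  rewrite !ge0_integral_distribution//.
  rewrite lte_mul_pinfty//.
  - by apply: integral_ge0 => x _; rewrite lee_fin.
  - by rewrite ge0_fin_numE; [exact: fin|apply: integral_ge0 => x _; rewrite lee_fin].
  - exact: fin.
have iP : P.-integrable setT (fun w => (U w * V w)%:E).
  apply/integrableP; split.
    by apply/measurable_EFinP; apply: measurable_funM.
  case/integrableP: iUV => _; rewrite -(tr (fun p => `|(p.1 * p.2)%:E|%E))//.
  exact: measurableT_comp.
split=> //.
rewrite /Rintegral; have iP' := iP.
have -> : (\int[P]_w (U w * V w)%:E = \int[distribution P W]_p (p.1 * p.2)%:E)%E.
  by rewrite (@integral_distribution _ _ _ _ _ P W).
have -> : (\int[distribution P W]_p (p.1 * p.2)%:E =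
           \int[(m1 \x m2)%E]_p (p.1 * p.2)%:E)%E.
  by apply: eq_measure_integral => A mA _; exact/esym/E.
rewrite -integral12_prod_meas1// /fubini_F /=.
have i2 : m2.-integrable setT (@EFin R).
  apply/integrableP; split; first exact: EFin_measurable.
  rewrite ge0_integral_distribution//; first exact: fin.
  exact: measurableT_comp.
have i1 : m1.-integrable setT (@EFin R).
  apply/integrableP; split; first exact: EFin_measurable.
  rewrite ge0_integral_distribution//; first exact: fin.
  exact: measurableT_comp.
have -> : (\int[m1]_x \int[m2]_y (x * y)%:E = \int[m1]_x (x%:E * \int[m2]_y y%:E))%E.
  by apply: eq_integral => x _; rewrite -integralZl.
have f2 : (\int[m2]_y y%:E)%E \is a fin_num by exact: integrable_fin_num.
have e1 : (\int[m1]_x x%:E = \int[P]_w (U w)%:E)%E.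
  by rewrite (@integral_distribution _ _ _ _ _ P U' EFin).
have e2 : (\int[m2]_x x%:E = \int[P]_w (V w)%:E)%E.
  by rewrite (@integral_distribution _ _ _ _ _ P V' EFin).
under eq_integral do rewrite -(fineK f2).
rewrite integralZr// fineM//; last by rewrite e1; exact: integrable_fin_num.
by rewrite e1 e2.
Qed.

End independence.

(** * Integration against a measure given by a density *)

Section density.
Context d (T : measurableType d) (R : realType) (mu nu : {measure set T -> \bar R}).
Variable g : T -> R.
Hypothesis mg : measurable_fun setT g.
Hypothesis g0 : forall x, 0 <= g x.
Hypothesis nuE : forall A, measurable A -> nu A = (\int[mu]_(x in A) (g x)%:E)%E.
Import HBNNSimple.

(** True for simple functions by linearity; an increasing approximation of [f] carries it over by
    monotone convergence on both sides. *)
Lemma ge0_integral_density (f : T -> \bar R) :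
  measurable_fun setT f -> (forall x, 0 <= f x)%E ->
  (\int[nu]_x f x = \int[mu]_x (f x * (g x)%:E))%E.
Proof.
move=> mf f0.
pose f_ := nnsfun_approx measurableT mf.
have mgE : measurable_fun setT (EFin \o g) by apply/measurable_EFinP.
have simple n : (\int[nu]_x (f_ n x)%:E = \int[mu]_x ((f_ n x)%:E * (g x)%:E))%E.
  rewrite integralT_nnsfun sintegralE.
  transitivity (\int[mu]_x (\sum_(y \in range (f_ n))
      (y * \1_(f_ n @^-1` [set y]) x)%:E * (g x)%:E))%E; last first.
    apply: eq_integral => x _; rewrite [in RHS](fimfunE (f_ n)) -fsumEFin//.
    rewrite ge0_mule_fsuml// => y.
    rewrite lee_fin; exact: nnfun_muleindic_ge0.
  rewrite ge0_integral_fsum//; last 2 first.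
  - move=> y; apply: emeasurable_funM => //; apply/measurable_EFinP.
    exact: measurable_funM.
  - move=> y x _; rewrite mule_ge0 ?lee_fin//; exact: nnfun_muleindic_ge0.
  apply: eq_fsbigr => y /set_mem [x0 _ yE].
  have y0 : 0 <= y by rewrite -yE.
  rewrite nuE//; under [RHS]eq_integral do rewrite EFinM -muleA.
  rewrite ge0_integralZl//; last 2 first.
  - by apply: emeasurable_funM => //; apply/measurable_EFinP.
  - by move=> x _; rewrite mule_ge0// lee_fin.
  congr (_ * _)%E; rewrite integral_mkcond; apply: eq_integral => x _.
  by rewrite patchE indicE; case: ifPn => _; rewrite ?mul1e ?mul0e.
transitivity (limn (fun n => \int[nu]_x (f_ n x)%:E)%E).
  rewrite -monotone_convergence//.
  - by apply: eq_integral => x _; apply/esym/cvg_lim => //; exact: cvg_nnsfun_approx.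
  - by move=> n; apply/measurable_EFinP.
  - by move=> n x _; rewrite lee_fin.
  - by move=> x _ a b ab; rewrite lee_fin; exact/lefP/nd_nnsfun_approx.
rewrite (_ : (fun n => _) = (fun n => \int[mu]_x ((f_ n x)%:E * (g x)%:E)))%E; last first.
  by apply/funext => n; exact: simple.
rewrite -monotone_convergence//.
- apply: eq_integral => x _; apply/cvg_lim => //.
  apply: cvgeZr => //; exact: cvg_nnsfun_approx.
- move=> n; apply: emeasurable_funM => //; exact/measurable_EFinP.
- by move=> n x _; rewrite mule_ge0// lee_fin.
- move=> x _ a b ab; apply: lee_wpmul2r; rewrite lee_fin//.
  exact/lefP/nd_nnsfun_approx.
Qed.

End density.

(** * Calculus of real-valued integrals *)

Definition rintegrable d (T : measurableType d) (R : realType)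
  (mu : {measure set T -> \bar R}) (D : set T) (f : T -> R) :=
  mu.-integrable D (EFin \o f).

Section real_integrals.
Context d (T : measurableType d) (R : realType) (mu : {measure set T -> \bar R}).
Context (D : set T) (mD : measurable D).
Implicit Types f g : T -> R.
Local Notation rint := (rintegrable mu D).

Lemma rint_measurable f : rint f -> measurable_fun D f.
Proof. by move=> /measurable_int/measurable_EFinP. Qed.

Lemma rintD f g : rint f -> rint g -> rint (fun x => f x + g x).
Proof. by move=> h1 h2; exact: (integrableD mD h1 h2). Qed.

Lemma rintN f : rint f -> rint (fun x => - f x).
Proof. by move=> h; exact: (integrableN h). Qed.

Lemma rintB f g : rint f -> rint g -> rint (fun x => f x - g x).
Proof. by move=> h1 h2; exact: (rintD h1 (rintN h2)). Qed.

Lemma rintZ k f : rint f -> rint (fun x => k * f x).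
Proof. by move=> h; exact: (integrableZl mD k h). Qed.

Lemma rintZr k f : rint f -> rint (fun x => f x * k).
Proof. by move=> h; rewrite (_ : (fun x => _) = (fun x => k * f x)); [exact: rintZ|apply/funext => x; exact: mulrC]. Qed.

Lemma rint_cst k : (mu D < +oo)%E -> rint (fun=> k).
Proof.
move=> fD; apply/integrableP; split; first exact/measurable_EFinP.
apply: (@le_lt_trans _ _ (\int[mu]_(x in D) cst `|k|%:E x)%E) => //.
by rewrite integral_cst// lte_mul_pinfty// lee_fin.
Qed.

Lemma rint_le f g : measurable_fun D f -> rint g ->
  (forall x, D x -> `|f x| <= g x) -> rint f.
Proof.
move=> mf ig fg; apply: (le_integrable mD _ _ ig); first exact/measurable_EFinP.
move=> x Dx /=; rewrite lee_fin (le_trans (fg x Dx))//.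
exact: ler_norm.
Qed.

Lemma rint_bounded f k : (mu D < +oo)%E -> measurable_fun D f ->
  (forall x, D x -> `|f x| <= k) -> rint f.
Proof. by move=> fD mf fk; apply: (rint_le mf (rint_cst k fD)). Qed.

Lemma rint_norm f : rint f -> rint (fun x => `|f x|).
Proof. exact: integrable_norm. Qed.

Lemma rint_sum (I : Type) (r : seq I) (Q : pred I) (f : I -> T -> R) :
  (forall i, Q i -> rint (f i)) -> rint (fun x => \sum_(i <- r | Q i) f i x).
Proof.
move=> h; elim: r => [|i r IH].
  rewrite (_ : (fun x => _) = cst 0); first exact: integrable0.
  by apply/funext => x; rewrite big_nil.
rewrite (_ : (fun x => _) =
   (fun x => (if Q i then f i x else 0) + \sum_(i <- r | Q i) f i x)); last first.
  by apply/funext => x; rewrite big_cons; case: (Q i); rewrite ?add0r.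
apply: rintD => //; case: (boolP (Q i)) => [|_]; [exact: h|exact: integrable0].
Qed.

Lemma EintD f g : rint f -> rint g ->
  \int[mu]_(x in D) (f x + g x) = \int[mu]_(x in D) f x + \int[mu]_(x in D) g x.
Proof. exact: RintegralD. Qed.

Lemma EintZ k f : rint f -> \int[mu]_(x in D) (k * f x) = k * \int[mu]_(x in D) f x.
Proof. exact: RintegralZl. Qed.

Lemma EintZr k f : rint f -> \int[mu]_(x in D) (f x * k) = \int[mu]_(x in D) f x * k.
Proof. exact: RintegralZr. Qed.

Lemma EintB f g : rint f -> rint g ->
  \int[mu]_(x in D) (f x - g x) = \int[mu]_(x in D) f x - \int[mu]_(x in D) g x.
Proof. exact: RintegralB. Qed.

Lemma Eint_cst k : \int[mu]_(x in D) k = k * fine (mu D).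
Proof. exact: Rintegral_cst. Qed.

Lemma Eint_sum (I : Type) (r : seq I) (Q : pred I) (f : I -> T -> R) :
  (forall i, Q i -> rint (f i)) ->
  \int[mu]_(x in D) (\sum_(i <- r | Q i) f i x) =
  \sum_(i <- r | Q i) \int[mu]_(x in D) f i x.
Proof.
move=> h; elim: r => [|i r IH].
  rewrite big_nil; under eq_Rintegral do rewrite big_nil.
  by rewrite Eint_cst// mul0r.
rewrite big_cons -IH; under eq_Rintegral do rewrite big_cons.
by case: (boolP (Q i)) => // Qi; rewrite EintD//; [exact: h|exact: rint_sum].
Qed.

Lemma le_Eint f g : rint f -> rint g -> (forall x, D x -> f x <= g x) ->
  \int[mu]_(x in D) f x <= \int[mu]_(x in D) g x.
Proof. exact: le_Rintegral. Qed.

Lemma le_norm_Eint f : rint f ->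
  `|\int[mu]_(x in D) f x| <= \int[mu]_(x in D) `|f x|.
Proof. exact: le_normr_Rintegral. Qed.

Lemma Eint_EFin f : rint f -> (\int[mu]_(x in D) (f x)%:E)%E = (\int[mu]_(x in D) f x)%:E.
Proof. by move=> h; rewrite fineK//; exact: (integrable_fin_num mD h). Qed.

Lemma rint_ge0 f : measurable_fun D f -> (forall x, D x -> 0 <= f x) ->
  (\int[mu]_(x in D) (f x)%:E < +oo)%E -> rint f.
Proof.
move=> mf f0 foo; apply/integrableP; split; first exact/measurable_EFinP.
by rewrite (eq_integral (fun x => (f x)%:E))// => x /set_mem Dx; rewrite /= ger0_norm// f0.
Qed.

Lemma rintM f g : measurable_fun D f -> measurable_fun D g ->
  rint (fun x => f x ^+ 2) -> rint (fun x => g x ^+ 2) -> rint (fun x => f x * g x).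
Proof.
move=> mf mg f2 g2; apply: (rint_le _ (rintD f2 g2)) => [|x _].
  exact: measurable_funM.
by rewrite normrM -(real_normK (num_real (f x))) -(real_normK (num_real (g x))); nra.
Qed.

Lemma rintMb f g k : measurable_fun D f -> (forall x, D x -> `|f x| <= k) ->
  rint g -> rint (fun x => f x * g x).
Proof.
move=> mf fk ig; apply: (rint_le _ (rintZ k (rint_norm ig))) => [|x Dx].
  by apply: measurable_funM => //; exact: rint_measurable.
by rewrite normrM ler_wpM2r// fk.
Qed.

Lemma rint_sqrD f g : measurable_fun D f -> measurable_fun D g ->
  rint (fun x => f x ^+ 2) -> rint (fun x => g x ^+ 2) ->
  rint (fun x => (f x + g x) ^+ 2).
Proof.
move=> mf mg f2 g2; apply: (rint_le _ (rintD (rintZ 2 f2) (rintZ 2 g2))) => [|x _].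
  by apply: measurable_funX; exact: measurable_funD.
by rewrite ger0_norm ?sqr_ge0//; have := sqr_ge0 (f x - g x); nra.
Qed.

End real_integrals.

(** * Moments of centred normal laws up to order four *)

Section gaussian_moments.
Context (R : realType) (s : R).
Hypothesis s0 : 0 < s.
Let nu := @normal_prob R 0 s.

Let nuT : nu setT = 1%E.
Proof. exact: (probability_setT (normal_prob 0 s)). Qed.

Let nuy : (nu setT < +oo)%E.
Proof. by rewrite nuT ltry. Qed.

Let Ecst (k : R) : \int[nu]_x k = k.
Proof.
by transitivity (k * fine (nu setT)); [exact: Eint_cst|rewrite nuT mulr1].
Qed.

(** Every normal density has mass one, so a weight turning one density into a multiple of another
    has a known integral. All Gaussian moments are derived from this, without integration by
    parts. *)
Lemma normal_reweight (m r k : R) (q : R -> R) : r != 0 -> 0 <= k ->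
  measurable_fun setT q -> (forall x, 0 <= q x) ->
  (forall x, q x * normal_pdf 0 s x = k * normal_pdf m r x) ->
  rintegrable nu setT q /\ \int[nu]_x q x = k.
Proof.
move=> r0 k0 mq q0 qE.
have I : (\int[nu]_x (q x)%:E = k%:E)%E.
  rewrite (@ge0_integral_density _ _ _ lebesgue_measure _ (normal_pdf 0 s))//.
  - under eq_integral do rewrite -EFinM qE EFinM.
    rewrite ge0_integralZl//.
    + by rewrite integral_normal_pdf mule1.
    + by apply/measurable_EFinP; exact: measurable_normal_pdf.
    + by move=> x _; rewrite lee_fin normal_pdf_ge0.
  - exact: measurable_normal_pdf.
  - by move=> x; exact: normal_pdf_ge0.
  - exact/measurable_EFinP.
split; last by rewrite /Rintegral I.
apply/integrableP; split; first exact/measurable_EFinP.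
under eq_integral do rewrite /= ger0_norm//.
by rewrite I ltry.
Qed.

Let pdfE (m r x : R) : r != 0 -> normal_pdf m r x =
  (Num.sqrt (r ^+ 2 * pi *+ 2))^-1 * expR (- (x - m) ^+ 2 / (r ^+ 2 *+ 2)).
Proof. by move=> r0; rewrite normal_pdfE. Qed.

Let sqrtE r : 0 < r -> Num.sqrt (r ^+ 2 * pi *+ 2) = r * Num.sqrt (pi *+ 2) :> R.
Proof. by move=> r0; rewrite -mulrnAr sqrtrM ?sqr_ge0// sqrtr_sqr gtr0_norm. Qed.

Let mexp (f : R -> R) : continuous f -> measurable_fun setT (fun x => expR (f x)).
Proof. by move=> cf; apply: measurableT_comp => //; exact: continuous_measurable_fun. Qed.

Let csqr (c : R) : continuous (fun x : R => c * x ^+ 2).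
Proof. move=> x; apply: cvgMr; exact: exprn_continuous. Qed.

(** The weight replaces the standard deviation [s] by [r * s] in the exponent; the factor [r]
    restores the normalisation. *)
Lemma normal_exp_sqr (r : R) : 0 < r ->
  let q := fun x : R => expR ((1 - (r ^+ 2)^-1) / (s ^+ 2 *+ 2) * x ^+ 2) in
  rintegrable nu setT q /\ \int[nu]_x q x = r.
Proof.
move=> r0 q.
have rs0 : 0 < r * s by rewrite mulr_gt0.
apply: (@normal_reweight 0 (r * s)); rewrite ?gt_eqF// ?ltW//.
- exact: (mexp (@csqr _)).
- by move=> x; rewrite /q expR_ge0.
move=> x; rewrite /q !pdfE ?gt_eqF// !sqrtE// !subr0 invfM.
rewrite [LHS]mulrCA -expRD [RHS]mulrA.
congr (_ * _).
  rewrite invfM; field; rewrite !gt_eqF// sqrtr_gt0 pmulrn_lgt0// pi_gt0//.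
congr expR; field; rewrite !gt_eqF//.
Qed.

Let mX n : measurable_fun setT (fun x : R => x ^+ n).
Proof. exact: exprn_measurable. Qed.

(** Only the order s^4 matters. With [r] = sqrt 2 the exponent is e = x^2 / (4 s^2), so x^4 = 64 s^4
    (e^2 / 4) and e^2 / 4 <= (1 + e/2)^2 <= exp e. The exponential integrates to sqrt 2 <= 2, whence
    128. *)
Lemma normal_pow4 : (\int[nu]_x (x ^+ 4)%:E <= (128 * s ^+ 4)%:E)%E.
Proof.
pose r := Num.sqrt 2 : R.
have r0 : 0 < r by rewrite sqrtr_gt0.
have [iq qE] := normal_exp_sqr r0.
have r2 : r ^+ 2 = 2 by rewrite sqr_sqrtr.
have le x : x ^+ 4 <= 64 * s ^+ 4 *
    expR ((1 - (r ^+ 2)^-1) / (s ^+ 2 *+ 2) * x ^+ 2).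
  rewrite r2; set e := _ * x ^+ 2.
  have eE : x ^+ 2 = 4 * s ^+ 2 * e.
    by rewrite /e; field; rewrite gt_eqF.
  have e0 : 0 <= e by rewrite -(pmulr_rge0 _ (_ : 0 < 4 * s ^+ 2)) -?eE ?sqr_ge0// mulr_gt0// exprn_gt0.
  have : (1 + e / 2) ^+ 2 <= expR e.
    have -> : expR e = expR (e / 2) ^+ 2.
      by rewrite expr2 -expRD -splitr.
    by rewrite ler_sqr ?nnegrE ?expR_ge0 ?expR_ge1Dx// addr_ge0// divr_ge0.
  move=> H; have -> : x ^+ 4 = 64 * s ^+ 4 * (e ^+ 2 / 4).
    rewrite (_ : x ^+ 4 = (x ^+ 2) ^+ 2); last by rewrite -exprM.
    by rewrite eE; field.
  rewrite ler_pM2l; last by rewrite mulr_gt0// exprn_gt0.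
  by apply: le_trans H; nra.
have fin : (\int[nu]_x (expR ((1 - (r ^+ 2)^-1) / (s ^+ 2 *+ 2) * x ^+ 2))%:E = r%:E)%E.
  rewrite -[LHS]fineK; last exact: (integrable_fin_num measurableT iq).
  by congr EFin; exact: qE.
apply: (@le_trans _ _ (\int[nu]_x (64 * s ^+ 4 *
    expR ((1 - (r ^+ 2)^-1) / (s ^+ 2 *+ 2) * x ^+ 2))%:E)%E).
  apply: ge0_le_integral => //.
  - by move=> x _; rewrite lee_fin exprn_even_ge0.
  - exact/measurable_EFinP.
  - by apply/measurable_EFinP; apply: measurable_funM => //; exact: (mexp (@csqr _)).
  - by move=> x _; rewrite lee_fin.
under eq_integral do rewrite EFinM.
rewrite ge0_integralZl//; last 2 first.
- by apply/measurable_EFinP; exact: (mexp (@csqr _)).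
- by rewrite lee_fin mulr_ge0// exprn_ge0// ltW.
rewrite fin -EFinM lee_fin.
have : r <= 2 by rewrite -ler_sqr ?nnegrE ?(ltW r0)// r2; lra.
move: (exprn_gt0 4 s0); nra.
Qed.

Lemma normal_integrableX n : (n <= 4)%N -> rintegrable nu setT (fun x => x ^+ n).
Proof.
move=> n4; have i4 : rintegrable nu setT (fun x => x ^+ 4).
  apply: rint_ge0 => //; first by move=> x _; rewrite exprn_even_ge0.
  exact: le_lt_trans normal_pow4 (ltry _).
have i1 : rintegrable nu setT (fun x => 1 + x ^+ 4).
  by apply: rintD => //; apply: rint_cst.
apply: (rint_le _ _ i1) => // x _; rewrite normrX.
have -> : x ^+ 4 = `|x| ^+ 4 by rewrite -normrX ger0_norm// exprn_even_ge0.
have [x1|/ltW x1] := leP `|x| 1.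
  by rewrite (@le_trans _ _ 1) ?lerDl ?exprn_ge0// exprn_ile1.
by rewrite (@le_trans _ _ (`|x| ^+ 4)) ?lerDr// ler_weXn2l.
Qed.

(** Integrating 1 + y <= exp y against the law, with the exponent of [normal_exp_sqr], gives an
    inequality in [r] that is an equality at [r] = 1. Comparing slopes there from both sides forces
    m / (2 s^2) = 1/2. *)
Lemma normal_variance : \int[nu]_x (x ^+ 2) = s ^+ 2.
Proof.
have iX2 := @normal_integrableX 2 isT.
have i1 k : rintegrable nu setT (fun=> k).
  by apply: rint_cst => //; rewrite (le_lt_trans (probability_le1 _ _))// ltry.
set m := Rintegral _ _ _.
have key r : 0 < r -> 1 + (1 - (r ^+ 2)^-1) * (m / (s ^+ 2 *+ 2)) <= r.
  move=> r0; have [iq qE] := normal_exp_sqr r0; rewrite -[leRHS]qE.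
  have -> : 1 + (1 - (r ^+ 2)^-1) * (m / (s ^+ 2 *+ 2)) =
      \int[nu]_x (1 + (1 - (r ^+ 2)^-1) / (s ^+ 2 *+ 2) * x ^+ 2).
    rewrite EintD//; last exact: rintZ.
    rewrite EintZ// Ecst -/m.
    by congr (_ + _); rewrite mulrA mulrAC.
  apply: le_Eint => //; first by apply: rintD => //; exact: rintZ.
  by move=> x _; exact: expR_ge1Dx.
have {}key r : 0 < r -> (r - 1) * (r + 1) * (m / (s ^+ 2 *+ 2)) <= r ^+ 2 * (r - 1).
  move=> r0; have := key _ r0; set q := m / _ => H.
  have r20 : 0 < r ^+ 2 by rewrite exprn_gt0.
  have : r ^+ 2 * (1 + (1 - (r ^+ 2)^-1) * q) <= r ^+ 2 * r by rewrite ler_pM2l.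
  rewrite mulrDr mulrA mulrBr mulfV ?gt_eqF// => {}H; nra.
suff -> : m = m / (s ^+ 2 *+ 2) * (s ^+ 2 *+ 2).
  have -> : m / (s ^+ 2 *+ 2) = 2^-1.
    apply/eqP; rewrite eq_le; apply/andP; split; apply/ler_addgt0Pr => /= e e0.
    - have := key (1 + e) (addr_gt0 ltr01 e0); set q := m / _ => H.
      have : e * ((2 + e) * q) <= e * (1 + e) ^+ 2 by nra.
      rewrite ler_pM2l// => {}H.
      have : (2 + e) * q <= (2 + e) * (2^-1 + e) by nra.
      by rewrite ler_pM2l// addr_gt0.
    - pose e' := Num.min e 2^-1.
      have e'0 : 0 < e' by rewrite /e'; case: (leP e 2^-1) => //; lra.
      have e'1 : e' <= 2^-1 by rewrite ge_min lexx orbT.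
      have e'e : e' <= e by rewrite ge_min lexx.
      have := key (1 - e') ltac:(lra); set q := m / _ => H.
      have : e' * (1 - e') ^+ 2 <= e' * ((2 - e') * q) by nra.
      rewrite ler_pM2l// => {}H.
      have : (2 - e') * 2^-1 <= (2 - e') * (q + e') by nra.
      rewrite ler_pM2l => [|]; lra.
  by rewrite -mulr_natr; field.
by rewrite divfK// gt_eqF// pmulrn_lgt0// exprn_gt0.
Qed.

(** Same device with a weight that shifts the mean to [h]: it gives h m <= h^2 / 2 for every [h],
    and the choice [h] = [m] leaves only [m] = 0. *)
Lemma normal_mean : \int[nu]_x x = 0.
Proof.
have iX := @normal_integrableX 1 isT.
have i1 k : rintegrable nu setT (fun=> k).
  by apply: rint_cst => //; rewrite (le_lt_trans (probability_le1 _ _))// ltry.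
set m := Rintegral _ _ _.
have key h : h * m <= h ^+ 2 / 2.
  pose q x := expR (x * (h / s ^+ 2) - h ^+ 2 / (s ^+ 2 *+ 2)).
  have mq : measurable_fun setT q.
    apply: mexp => x; apply: cvgB; last exact: cvg_cst.
    by apply: cvgMl; exact: cvg_id.
  have [iq qE] : rintegrable nu setT q /\ \int[nu]_x q x = 1.
    apply: (@normal_reweight h s) => //; rewrite ?gt_eqF//.
    - by move=> x; exact: expR_ge0.
    move=> x; rewrite !pdfE ?gt_eqF// mul1r subr0 mulrCA -expRD.
    by congr (_ * expR _); field; rewrite gt_eqF.
  have : \int[nu]_x ((1 - h ^+ 2 / (s ^+ 2 *+ 2)) + (h / s ^+ 2) * x) <= \int[nu]_x q x.
    apply: le_Eint => //; first by apply: rintD => //; exact: rintZ.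
    move=> x _; apply: le_trans (expR_ge1Dx _).
    by rewrite le_eqVlt; apply/orP; left; apply/eqP; ring.
  rewrite qE EintD//; last exact: rintZ.
  rewrite EintZ// Ecst -/m => H.
  have s20 : 0 < s ^+ 2 by rewrite exprn_gt0.
  have : s ^+ 2 * (1 - h ^+ 2 / (s ^+ 2 *+ 2) + h / s ^+ 2 * m) <= s ^+ 2 * 1.
    by rewrite ler_pM2l.
  have -> : s ^+ 2 * (1 - h ^+ 2 / (s ^+ 2 *+ 2) + h / s ^+ 2 * m) =
     s ^+ 2 - h ^+ 2 / 2 + h * m by field; rewrite gt_eqF.
  lra.
apply/eqP; have := key m; have : 0 <= m ^+ 2 by exact: sqr_ge0.
by rewrite -(sqrf_eq0 m) => ? ?; apply/eqP; nra.
Qed.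

End gaussian_moments.

(** * Borel measurability of matrix-valued maps *)

Section borel.

Lemma borel_continuous_measurable (T : ptopologicalType) (R : realType) (f : T -> R) :
  continuous f -> measurable_fun [set: borel T] f.
Proof.
move=> /continuousP cf; apply: (measurability _ (RGenOpens.measurableE R)).
move=> _ [_ [a [b ->] <-]]; rewrite setTI.
by apply: sub_sigma_algebra; apply: cf; exact: interval_open.
Qed.

(** An open set is a countable union of balls with rational centres and radii 1/(k+1), and a ball of
    the sup norm is a finite intersection of conditions on single entries. *)
Lemma measurable_fun_borel d (X : measurableType d) (R : realType) m n
    (D : set X) (Y : X -> 'M[R]_(m, n)) :
  (forall i j, measurable_fun D (fun x => Y x i j)) ->
  measurable_fun D (Y : X -> borel 'M[R]_(m, n)).
Proof.
move=> mY mD; move: (mD).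
apply: (@measurability _ _ X (borel 'M[R]_(m, n)) D Y open) => //.
move=> _ [U oU <-].
pose I := ('M[rat]_(m, n) * nat)%type.
pose c (q : 'M[rat]_(m, n)) : 'M[R]_(m, n) := map_mx ratr q.
pose box (i : I) := [set x | ball (c i.1) i.2.+1%:R^-1 (Y x)].
pose F (i : I) := if `[< ball (c i.1) i.2.+1%:R^-1 `<=` U >] then D `&` box i else set0.
have -> : D `&` Y @^-1` U = \bigcup_i F i.
  apply/seteqP; split=> [x [Dx Ux]|x [[q k] _]]; last first.
    by rewrite /F; case: asboolP => //= bU [Dx bx]; split => //; exact: bU.
  have /nbhs_ballP[e /= e0 eU] : nbhs (Y x) U by exact: open_nbhs_nbhs.
  have [k ke] : exists k : nat, k.+1%:R^-1 < e / 2.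
    have [k ke] := ltr_add_invr (divr_gt0 e0 (ltr0Sn R 1)).
    by exists k; rewrite -[ltLHS]add0r.
  have /choice[q qE] : forall ij : 'I_m * 'I_n, exists q : rat,
      ball (Y x ij.1 ij.2) k.+1%:R^-1 (ratr q).
    move=> ij; have := @rat_in_itvoo R (Y x ij.1 ij.2 - k.+1%:R^-1) (Y x ij.1 ij.2 + k.+1%:R^-1).
    case; first by rewrite ltrBlDr -addrA ltrDl addr_gt0.
    move=> q; rewrite in_itv/= => /andP[q1 q2]; exists q.
    by rewrite /ball/= ltr_distlC q1 q2.
  pose Q : 'M[rat]_(m, n) := \matrix_(i, j) q (i, j).
  have bQ : ball (c Q) k.+1%:R^-1 (Y x).
    apply: ball_sym; split => // i j; rewrite !mxE; exact: (qE (i, j)).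
  exists (Q, k) => //; rewrite /F/=; case: asboolP => [_|[]]; first by split.
  move=> y by_; apply: eU; rewrite [e]splitr.
  apply: (@ball_triangle _ _ (c Q)).
    by apply: ball_sym; apply: le_ball bQ; exact: ltW.
  by apply: le_ball by_; exact: ltW.
apply: countable_bigcupT_measurable; first exact: countableP.
move=> [q k]; rewrite /F; case: asboolP => // _.
have -> : D `&` box (q, k) = \bigcap_(i in [set: 'I_m]) \bigcap_(j in [set: 'I_n])
     (D `&` [set x | ball (c q i j) k.+1%:R^-1 (Y x i j)]) `&` D.
  apply/seteqP; split => [x [Dx [_ bx]]|x [bx Dx]]; split => //.
    by move=> i _ j _; split => //; exact: bx.
  by split => // i j; have [] := bx i Logic.I j Logic.I.
apply: measurableI => //; apply: fin_bigcap_measurable => // i _.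
apply: fin_bigcap_measurable => // j _.
apply: mY => //; exact: measurable_ball.
Qed.

End borel.
Section probability_integrals.
Context d (T : measurableType d) (R : realType) (P : probability T R).

Lemma prob_lty : ((P : {measure set T -> \bar R}) setT < +oo)%E.
Proof. exact: le_lt_trans (probability_le1 P measurableT) (ltry 1). Qed.

Lemma prob_rint_cst (k : R) : rintegrable P setT (fun=> k).
Proof. by apply: rint_cst => //; exact: prob_lty. Qed.

Lemma prob_rint_bounded (f : T -> R) k : measurable_fun setT f ->
  (forall x, `|f x| <= k) -> rintegrable P setT f.
Proof. by move=> mf fk; apply: (rint_bounded _ prob_lty mf) => // x _; exact: fk. Qed.

Lemma prob_Eint_cst (k : R) : \int[P]_x k = k.
Proof. by rewrite Eint_cst// (congr1 fine (probability_setT P)) mulr1. Qed.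

End probability_integrals.

(** Phrased through the type carrying the generated sigma-algebra, so that the closure lemmas for
    [measurable_fun] apply to adapted variables as they stand; [FmeasP] gives back the preimage
    form. *)
Definition Fmeas (T : pointedType) (R : realType) (G : set (set T)) (f : T -> R) :=
  measurable_fun [set: g_sigma_algebraType G] (f : g_sigma_algebraType G -> R).

Section filtrations.
Context d (Omega : measurableType d) (R : realType) (P : probability Omega R).
Context (T : R) (F : R -> set (set Omega)) (hF : filtration P T F).
Implicit Types (f g : Omega -> R) (s r : R).

Lemma FmeasP s f : 0 <= s <= T ->
  Fmeas (F s) f <-> (forall U, measurable U -> F s (f @^-1` U)).
Proof.
move=> sT; have [h _ _ _] := hF; have [/sigma_algebra_id Fs _] := h s sT.
split=> [mf U mU|h' _ U mU].
  by have := mf measurableT U mU; rewrite setTI /measurable/= Fs.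
by rewrite setTI /measurable/= Fs; exact: h'.
Qed.

Lemma Fmeas_le s r f : 0 <= s -> s <= r -> r <= T -> Fmeas (F s) f -> Fmeas (F r) f.
Proof.
move=> s0 sr rT; have [_ h _ _] := hF.
have sT : 0 <= s <= T by rewrite s0 (le_trans sr).
have rT' : 0 <= r <= T by rewrite (le_trans s0 sr).
by rewrite !FmeasP// => mf U mU; apply: (h s) => //; exact: mf.
Qed.

Lemma Fmeas_measurable s f : 0 <= s <= T -> Fmeas (F s) f -> measurable_fun setT f.
Proof.
move=> sT /FmeasP => /(_ sT) mf _ U mU; rewrite setTI.
have [h _ _ _] := hF; have [_ Fs] := h s sT; exact/Fs/mf.
Qed.

Lemma Fmeas_entry s m n (Y : Omega -> 'M[R]_(m, n)) : 0 <= s <= T ->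
  measurable_wrt (F s) Y -> forall i j, Fmeas (F s) (fun w => Y w i j).
Proof. by move=> sT mY i j; apply/FmeasP => // U mU; exact: mY. Qed.

End filtrations.

(** * Law, independence and moments of Brownian increments *)

Section brownian_increments.
Context d (Omega : measurableType d) (R : realType) (P : probability Omega R).
Context (T : R) (F : R -> set (set Omega)) (hF : filtration P T F).
Context (d0 : nat) (B : R -> Omega -> 'cV[R]_d0) (hB : brownian_motion P T F B).
Local Notation rint := (rintegrable P setT).
Local Notation dB s r j := (fun w => B r w j 0 - B s w j 0).

Lemma Fmeas_B s j : 0 <= s <= T -> Fmeas (F s) (fun w => B s w j 0).
Proof.
move=> sT; have [adB _ _ _ _] := hB.
exact: (Fmeas_entry hF sT (adB s sT)).
Qed.

Lemma Fmeas_incr s r t j : 0 <= s -> s <= r -> r <= t -> t <= T -> Fmeas (F t) (dB s r j).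
Proof.
move=> s0 sr rt tT; apply: measurable_funB; last first.
  apply: (Fmeas_le hF s0 (le_trans sr rt) tT); apply: Fmeas_B.
  by rewrite s0 (le_trans sr (le_trans rt tT)).
apply: (Fmeas_le hF (le_trans s0 sr) rt tT); apply: Fmeas_B.
by rewrite (le_trans s0 sr) (le_trans rt tT).
Qed.

Lemma measurable_incr s r j : 0 <= s -> s <= r -> r <= T -> measurable_fun setT (dB s r j).
Proof.
move=> s0 sr rT; apply: (@Fmeas_measurable _ _ _ _ _ _ hF r).
  by rewrite (le_trans s0 sr).
exact: Fmeas_incr.
Qed.

(** Independence of the past is assumed for the increment as a vector, hence the detour through a
    continuous [phi]. The separate name [V] lets callers write the function in coordinates. *)
Lemma incr_independent s r (phi : 'cV[R]_d0 -> R) (Y V : Omega -> R) :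
  0 <= s -> s < r -> r <= T -> continuous phi ->
  (forall w, V w = phi (B r w - B s w)) -> Fmeas (F s) Y -> rint Y -> rint V ->
  rint (fun w => Y w * V w) /\
  \int[P]_w (Y w * V w) = \int[P]_w Y w * \int[P]_w V w.
Proof.
move=> s0 sr rT cphi /funext -> FY iY iphi; have [_ _ _ ind _] := hB.
have sT : 0 <= s <= T by rewrite s0 (le_trans (ltW sr)).
apply: indep_expectation => //.
- exact: (rint_measurable iY).
- exact: (rint_measurable iphi).
move=> A1 A2 mA1 mA2.
have mp := borel_continuous_measurable cphi.
have FA : F s (Y @^-1` A1) by move/(FmeasP hF) : FY => /(_ sT); exact.
have mU : measurable (phi @^-1` A2 : set (borel 'cV[R]_d0)).
  by rewrite -[X in measurable X]setTI; exact: mp.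
exact: (ind s r _ _ s0 sr rT FA mU).
Qed.

(** The joint law is evaluated on a rectangle whose sides other than the [j]-th are the whole
    line. *)
Lemma incr_law s r j (U : set R) : 0 <= s -> s < r -> r <= T -> measurable U ->
  P (dB s r j @^-1` U) = normal_prob 0 (Num.sqrt (r - s)) U.
Proof.
move=> s0 sr rT mU; have [_ _ _ _ law] := hB.
have := law s r (fun i => if i == j then U else setT) s0 sr rT.
rewrite (bigD1 j)//= eqxx big1 ?mule1; last first.
  by move=> i /negbTE ->; rewrite probability_setT.
move=> <-; last by move=> i; case: ifP.
congr (P _); apply/seteqP; split => w /= Uw; last by have := Uw j; rewrite eqxx.
by move=> i; case: eqP => // ->.
Qed.

Lemma incr_pair_law s r i j (U V : set R) : 0 <= s -> s < r -> r <= T -> i != j ->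
  measurable U -> measurable V ->
  P (dB s r i @^-1` U `&` dB s r j @^-1` V) =
  (P (dB s r i @^-1` U) * P (dB s r j @^-1` V))%E.
Proof.
move=> s0 sr rT ij mU mV; rewrite !incr_law//; have [_ _ _ _ law] := hB.
have := law s r (fun k => if k == i then U else if k == j then V else setT) s0 sr rT.
rewrite (bigD1 i)//= eqxx (bigD1 j)//=; last by rewrite eq_sym.
rewrite [in (j == i)%B]eq_sym (negbTE ij) eqxx big1 ?mule1; last first.
  by move=> k /andP[/negbTE -> /negbTE ->]; rewrite probability_setT.
move=> <-; last by move=> k; case: ifP => // _; case: ifP.
congr (P _); apply/seteqP; split => w /= Uw.
  by case: Uw => Uw Vw k; case: eqP => [->//|_]; case: eqP => // ->.
split; first by have := Uw i; rewrite eqxx.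
by have := Uw j; rewrite eq_sym (negbTE ij) eqxx.
Qed.

Lemma incr_integral s r j (f : R -> R) : 0 <= s -> s < r -> r <= T ->
  measurable_fun setT f ->
  rintegrable (normal_prob 0 (Num.sqrt (r - s))) setT f ->
  rint (fun w => f (B r w j 0 - B s w j 0)) /\
  \int[P]_w f (B r w j 0 - B s w j 0) = \int[normal_prob 0 (Num.sqrt (r - s))]_x f x.
Proof.
move=> s0 sr rT mf if_.
have mX := measurable_incr j s0 (ltW sr) rT.
have mX' : measurable_fun setT (dB s r j : Omega -> measurableTypeR R) by exact: mX.
pose X : {mfun Omega >-> measurableTypeR R} :=
  HB.pack (dB s r j : Omega -> measurableTypeR R) (isMeasurableFun.Build _ _ _ _ _ mX').
have ge0 (g : R -> \bar R) : measurable_fun setT g -> (forall x, 0 <= g x)%E ->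
    (\int[P]_w g (dB s r j w) = \int[normal_prob 0 (Num.sqrt (r - s))]_x g x)%E.
  move=> mg g0.
  rewrite -[LHS](@ge0_integral_distribution _ _ _ _ _ P X g mg g0).
  apply: eq_measure_integral => A mA _; exact: incr_law.
have mE : measurable_fun setT (EFin \o f) by exact/measurable_EFinP.
have ir : rint (fun w => f (B r w j 0 - B s w j 0)).
  apply/integrableP; split; first by apply/measurable_EFinP; exact: measurableT_comp.
  rewrite (ge0 (fun x => `|(f x)%:E|%E))//; last exact: measurableT_comp.
  by case/integrableP: if_.
split => //; rewrite /Rintegral; congr fine.
rewrite -[LHS](@integral_distribution _ _ _ _ _ P X (EFin \o f) mE ir).
apply: eq_measure_integral => A mA _; exact: incr_law.
Qed.

Lemma incr_pow s r j n : 0 <= s -> s <= r -> r <= T -> (n <= 4)%N ->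
  rint (fun w => (B r w j 0 - B s w j 0) ^+ n).
Proof.
(* The law of an increment is given for [s < r] only; at equal times the increment is the constant
   0. *)
move=> s0; rewrite le_eqVlt => /predU1P[<- _ _|sr rT n4].
  by under eq_fun do rewrite subrr; exact: prob_rint_cst.
have sq : 0 < Num.sqrt (r - s) by rewrite sqrtr_gt0 subr_gt0.
by have [] := incr_integral (f := fun x => x ^+ n) j s0 sr rT (@exprn_measurable R setT n)
  (normal_integrableX sq n4).
Qed.

Lemma incr_mean s r j : 0 <= s -> s <= r -> r <= T ->
  \int[P]_w (B r w j 0 - B s w j 0) = 0.
Proof.
move=> s0; rewrite le_eqVlt => /predU1P[<- _|sr rT].
  by under eq_Rintegral do rewrite subrr; rewrite prob_Eint_cst.
have sq : 0 < Num.sqrt (r - s) by rewrite sqrtr_gt0 subr_gt0.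
have [_ ->] := incr_integral (f := id) j s0 sr rT (@measurable_id _ _ _)
  (normal_integrableX sq (isT : 1 <= 4)%N).
exact: normal_mean.
Qed.

Lemma incr_variance s r j : 0 <= s -> s <= r -> r <= T ->
  \int[P]_w ((B r w j 0 - B s w j 0) ^+ 2) = r - s.
Proof.
move=> s0; rewrite le_eqVlt => /predU1P[<- _|sr rT].
  by under eq_Rintegral do rewrite subrr expr2 mul0r; rewrite prob_Eint_cst subrr.
have sq : 0 < Num.sqrt (r - s) by rewrite sqrtr_gt0 subr_gt0.
have [_ ->] := incr_integral (f := fun x => x ^+ 2) j s0 sr rT (@exprn_measurable R setT 2)
  (normal_integrableX sq (isT : 2 <= 4)%N).
by rewrite normal_variance// sqr_sqrtr// subr_ge0 ltW.
Qed.

Lemma incr_pow4 s r j : 0 <= s -> s <= r -> r <= T ->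
  \int[P]_w ((B r w j 0 - B s w j 0) ^+ 4) <= 128 * (r - s) ^+ 2.
Proof.
move=> s0; rewrite le_eqVlt => /predU1P[<- _|sr rT].
  by under eq_Rintegral do rewrite subrr; rewrite prob_Eint_cst subrr !expr0n mulr0.
have sq : 0 < Num.sqrt (r - s) by rewrite sqrtr_gt0 subr_gt0.
have i4 := normal_integrableX sq (isT : 4 <= 4)%N.
have [_ ->] := incr_integral (f := fun x => x ^+ 4) j s0 sr rT (@exprn_measurable R setT 4) i4.
rewrite -lee_fin -Eint_EFin//; apply: le_trans (normal_pow4 sq) _.
by rewrite lee_fin (_ : 4 = 2 * 2)%N// exprM sqr_sqrtr// subr_ge0 ltW.
Qed.

Lemma rint_incrM s r i j : 0 <= s -> s <= r -> r <= T ->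
  rint (fun w => (B r w i 0 - B s w i 0) * (B r w j 0 - B s w j 0)).
Proof.
by move=> s0 sr rT; apply: rintM => //;
  [exact: measurable_incr|exact: measurable_incr|exact: incr_pow|exact: incr_pow].
Qed.

Lemma incr_covariance s r i j : 0 <= s -> s <= r -> r <= T ->
  \int[P]_w ((B r w i 0 - B s w i 0) * (B r w j 0 - B s w j 0)) = (i == j)%:R * (r - s).
Proof.
move=> s0 sr rT; have [->|ij] := eqVneq i j.
  by rewrite mul1r -(incr_variance j s0 sr rT); apply: eq_Rintegral => w _; rewrite expr2.
rewrite mul0r; move: sr; rewrite le_eqVlt => /predU1P[<-|sr].
  by under eq_Rintegral do rewrite subrr mul0r; rewrite prob_Eint_cst.
have [_ ->] := @indep_expectation _ _ _ P (dB s r i) (dB s r j)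
  (measurable_incr i s0 (ltW sr) rT) (measurable_incr j s0 (ltW sr) rT)
  (fun U V mU mV => incr_pair_law s0 sr rT ij mU mV)
  (incr_pow i s0 (ltW sr) rT (isT : 1 <= 4)%N) (incr_pow j s0 (ltW sr) rT (isT : 1 <= 4)%N).
by rewrite incr_mean ?mul0r// ltW.
Qed.

(** The martingale property in weak form: no conditional expectation is formed, the weight [Y] known
    at time [s] acts as a test function. *)
Lemma Fmeas_incr_mean s r j Y : 0 <= s -> s <= r -> r <= T ->
  Fmeas (F s) Y -> rint Y ->
  rint (fun w => Y w * (B r w j 0 - B s w j 0)) /\
  \int[P]_w (Y w * (B r w j 0 - B s w j 0)) = 0.
Proof.
move=> s0; rewrite le_eqVlt => /predU1P[<- _ _ _|sr rT FY iY].
  under eq_fun do rewrite subrr mulr0; split; first exact: prob_rint_cst.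
  exact: prob_Eint_cst.
have V w : B r w j 0 - B s w j 0 = (B r w - B s w) j 0 by rewrite !mxE.
have [ir ->] := incr_independent s0 sr rT (@coord_continuous _ _ _ j 0) V FY iY
  (incr_pow j s0 (ltW sr) rT (isT : 1 <= 4)%N).
by rewrite incr_mean ?mulr0 ?(ltW sr).
Qed.

Lemma Fmeas_incr_cov s r i j Y : 0 <= s -> s <= r -> r <= T ->
  Fmeas (F s) Y -> rint Y ->
  rint (fun w => Y w * ((B r w i 0 - B s w i 0) * (B r w j 0 - B s w j 0))) /\
  \int[P]_w (Y w * ((B r w i 0 - B s w i 0) * (B r w j 0 - B s w j 0))) =
    (i == j)%:R * (r - s) * \int[P]_w Y w.
Proof.
move=> s0; rewrite le_eqVlt => /predU1P[<- _ _ _|sr rT FY iY].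
  under eq_fun do rewrite !subrr !mulr0; split; first exact: prob_rint_cst.
  by rewrite prob_Eint_cst subrr mulr0 mul0r.
have c : continuous (fun v : 'cV[R]_d0 => v i 0 * v j 0).
  by move=> v; apply: continuousM; exact: coord_continuous.
have V w : (B r w i 0 - B s w i 0) * (B r w j 0 - B s w j 0) =
  (B r w - B s w) i 0 * (B r w - B s w) j 0 by rewrite !mxE.
have [ir ->] := incr_independent s0 sr rT c V FY iY (rint_incrM i j s0 (ltW sr) rT).
by rewrite incr_covariance ?(ltW sr)// mulrC.
Qed.

End brownian_increments.

(** * Integrals of tensor products *)

Section product_integral.
Context d1 d2 (T1 : measurableType d1) (T2 : measurableType d2) (R : realType).
Context (m1 : {sigma_finite_measure set T1 -> \bar R}).
Context (m2 : {sigma_finite_measure set T2 -> \bar R}).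

Lemma rint_tensor (f : T1 -> R) (g : T2 -> R) :
  rintegrable m1 setT f -> rintegrable m2 setT g ->
  rintegrable (m1 \x m2)%E setT (fun p => f p.1 * g p.2) /\
  \int[(m1 \x m2)%E]_p (f p.1 * g p.2) = \int[m1]_x f x * \int[m2]_y g y.
Proof.
move=> if_ ig.
have mf := rint_measurable if_; have mg := rint_measurable ig.
have mp : measurable_fun setT (fun p : T1 * T2 => f p.1 * g p.2).
  apply: measurable_funM; exact: measurableT_comp.
have mpE : measurable_fun setT (fun p : T1 * T2 => (f p.1 * g p.2)%:E).
  exact/measurable_EFinP.
have fin d (X : measurableType d) (m : {measure set X -> \bar R}) (h : X -> R) :
    rintegrable m setT h -> (\int[m]_w `|h w|%:E < +oo)%E.
  by move=> /integrableP[_]; under eq_integral do rewrite abse_EFin.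
have im : rintegrable (m1 \x m2)%E setT (fun p => f p.1 * g p.2).
  apply/integrableP; split=> //.
  rewrite fubini_tonelli1//; last by apply: measurableT_comp.
  rewrite /fubini_F /=.
  have -> : (\int[m1]_x \int[m2]_y `|f x * g y|%:E =
      \int[m1]_x ( `|f x|%:E * \int[m2]_y `|g y|%:E))%E.
    apply: eq_integral => x _; rewrite -ge0_integralZl//.
      by apply: eq_integral => y _; rewrite normrM EFinM.
    by apply/measurable_EFinP; apply: measurableT_comp.
  rewrite ge0_integralZr//; last 2 first.
  - by apply/measurable_EFinP; apply: measurableT_comp.
  - by apply: integral_ge0 => x _; rewrite lee_fin.
  rewrite lte_mul_pinfty//.
  - by apply: integral_ge0 => x _; rewrite lee_fin.
  - by rewrite ge0_fin_numE; [exact: fin|apply: integral_ge0 => x _; rewrite lee_fin].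
  - exact: fin.
split=> //; rewrite /Rintegral -integral12_prod_meas1// /fubini_F /=.
have f2 : (\int[m2]_y (g y)%:E)%E \is a fin_num by exact: integrable_fin_num.
have -> : (\int[m1]_x \int[m2]_y (f x * g y)%:E =
           \int[m1]_x ((f x)%:E * (fine (\int[m2]_y (g y)%:E))%:E))%E.
  by apply: eq_integral => x _; rewrite (fineK f2) -integralZl.
by rewrite integralZr// fineM//; exact: integrable_fin_num.
Qed.

End product_integral.
(** A random value held on one interval, acting on one coordinate of the noise. Finite families of
    pieces may overlap in time, so simple processes with unrelated partitions are added and
    subtracted without a common refinement. *)
Record piece (R : realType) (Omega : Type) (n : nat) := Piece {
  pc_start : R; pc_end : R; pc_coord : 'I_n; pc_val : Omega -> R }.

(** * The isometry for families of pieces *)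

Section elementary_integrals.
Context d (Omega : measurableType d) (R : realType) (P : probability Omega R).
Context (T : R) (F : R -> set (set Omega)) (hF : filtration P T F).
Context (d0 : nat) (B : R -> Omega -> 'cV[R]_d0) (hB : brownian_motion P T F B).
Local Notation rint := (rintegrable P setT).
Local Notation pc := (piece R Omega d0).
Local Notation dB s r j := (fun w => B r w j 0 - B s w j 0).
Local Notation m := (@lebesgue_measure R \x P)%E.
Implicit Types e : pc.

Definition piece_on (lo hi : R) e := [/\ lo <= pc_start e, pc_start e <= pc_end e,
  pc_end e <= hi, Fmeas (F (pc_start e)) (pc_val e) &
  exists K, forall w, `|pc_val e w| <= K].

Definition piece_int e w :=
  pc_val e w * (B (pc_end e) w (pc_coord e) 0 - B (pc_start e) w (pc_coord e) 0).

Definition piece_dens e j (p : R * Omega) : R :=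
  if (pc_coord e == j) && (pc_start e < p.1 <= pc_end e) then pc_val e p.2 else 0.

Lemma Fmeas_bounded_rint s Y K : 0 <= s <= T -> Fmeas (F s) Y ->
  (forall w, `|Y w| <= K) -> rint Y.
Proof.
by move=> sT FY YK; apply: prob_rint_bounded YK; exact: (Fmeas_measurable hF sT).
Qed.

(** For [a <= b] the increment up to [b] is cut at [a]: the part up to [a] gives the covariance, and
    the part after [a] has mean zero against everything known at [a]. *)
Lemma Fmeas_two_incr c a b i j Y K : 0 <= c -> c <= a -> c <= b -> a <= T -> b <= T ->
  Fmeas (F c) Y -> (forall w, `|Y w| <= K) ->
  rint (fun w => Y w * (dB c a i w * dB c b j w)) /\
  \int[P]_w (Y w * (dB c a i w * dB c b j w)) =
    (i == j)%:R * (Num.min a b - c) * \int[P]_w Y w.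
Proof.
move=> c0; wlog ab : a b i j / a <= b.
  move=> W ca cb aT bT FY YK; case: (leP a b) => [ab|/ltW ba].
    have := W a b i j ab ca cb aT bT FY YK; by rewrite (min_idPl ab).
  have [h1 h2] := W b a j i ba cb ca bT aT FY YK.
  have E w : Y w * (dB c a i w * dB c b j w) = Y w * (dB c b j w * dB c a i w).
    by congr (_ * _); exact: mulrC.
  under eq_fun do rewrite E.
  by rewrite [i == j]eq_sym; move: h1 h2; rewrite (min_idPl ba).
move=> ca cb aT bT FY YK; rewrite (min_idPl ab).
have cT : 0 <= c <= T by rewrite c0 (le_trans ca).
have iY := Fmeas_bounded_rint cT FY YK.
have a0 : 0 <= a by exact: le_trans ca.
have mY := Fmeas_measurable hF cT FY.
have [i1 E1] := Fmeas_incr_cov hF hB i j c0 ca aT FY iY.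
have FZ : Fmeas (F a) (fun w => Y w * dB c a i w).
  apply: measurable_funM; first exact: (Fmeas_le hF c0 ca aT FY).
  exact: (Fmeas_incr hF hB).
have iZ : rint (fun w => Y w * dB c a i w).
  by apply: (rintMb _ mY (fun w _ => YK w)) => //; exact: (incr_pow hF hB i c0 ca aT (isT : 1 <= 4)%N).
have [i2 E2] := Fmeas_incr_mean hF hB j a0 ab bT FZ iZ.
have E w : Y w * (dB c a i w * dB c b j w) =
  Y w * (dB c a i w * dB c a j w) + Y w * dB c a i w * dB a b j w by ring.
under eq_fun do rewrite E; split; first exact: rintD.
by rewrite EintD// E1 E2 addr0.
Qed.

(** Length of the intersection of the intervals ]a, b] and ]a', b']. *)
Definition overlap (a b a' b' : R) := Num.max 0 (Num.min b b' - Num.max a a').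

Section pair.
Variables (e e' : pc).
Hypothesis he : piece_on 0 T e.
Hypothesis he' : piece_on 0 T e'.

Lemma rint_piece_sqr : rint (fun w => piece_int e w ^+ 2).
Proof.
case: he => a0 ab bT FV [K VK].
have aT : 0 <= pc_start e <= T by rewrite a0 (le_trans ab).
under eq_fun do rewrite /piece_int exprMn.
apply: (@rintMb _ _ _ _ _ _ _ _ (K ^+ 2)) => //.
- apply: measurable_funX; exact: (Fmeas_measurable hF aT FV).
- move=> w _; rewrite normrX ler_sqr ?nnegrE// ?(le_trans (normr_ge0 (pc_val e w)))//.
- exact: (incr_pow hF hB).
Qed.

Lemma measurable_piece : measurable_fun setT (piece_int e).
Proof.
case: he => a0 ab bT FV _; apply: measurable_funM.
  apply: (Fmeas_measurable hF _ FV); by rewrite a0 (le_trans ab).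
exact: (measurable_incr hF hB).
Qed.

End pair.

(** With [a <= a'], what the first piece does before [a'] is orthogonal to the second one. From [a']
    on, both increments start at a time when both values are known, which is the situation of
    [Fmeas_two_incr]. *)
Lemma piece_pair e e' : piece_on 0 T e -> piece_on 0 T e' ->
  \int[P]_w (piece_int e w * piece_int e' w) =
  (pc_coord e == pc_coord e')%:R *
  overlap (pc_start e) (pc_end e) (pc_start e') (pc_end e') *
  \int[P]_w (pc_val e w * pc_val e' w).
Proof.
wlog aa : e e' / pc_start e <= pc_start e'.
  move=> W he he'; case: (leP (pc_start e) (pc_start e')) => [|/ltW] aa.
    exact: W.
  under eq_Rintegral do rewrite mulrC.
  rewrite W// eq_sym /overlap minC [Num.max (pc_start e') _]maxC; congr (_ * _).
  by apply: eq_Rintegral => w _; rewrite mulrC.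
case: e aa => a b j V /= aa; case: e' aa => a' b' j' V' /= aa.
move=> [/= a0 ab bT FV [K VK]] [/= a'0 ab' bT' FV' [K' VK']].
rewrite /piece_int /= /overlap (max_idPr aa).
have aT : 0 <= a <= T by rewrite a0 (le_trans ab).
have aT' : 0 <= a' <= T by rewrite a'0 (le_trans ab').
have K0 : 0 <= K by exact: le_trans (normr_ge0 _) (VK point).
have bVV w : `|V w * V' w| <= K * K' by rewrite normrM ler_pM.
have FVV : Fmeas (F a') (fun w => V w * V' w).
  by apply: measurable_funM => //; apply: (Fmeas_le hF a0 aa _ FV); case/andP: aT'.
have mVV := Fmeas_measurable hF aT' FVV.
(* Everything up to [c] is known at [a'], so it acts as a weight for the later increment. *)
have zero c : a <= c -> c <= a' ->
    rint (fun w => V w * V' w * dB a c j w * dB a' b' j' w) /\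
    \int[P]_w (V w * V' w * dB a c j w * dB a' b' j' w) = 0.
  move=> ac ca'; apply: (Fmeas_incr_mean hF hB) => //.
  - apply: measurable_funM => //; apply: (Fmeas_incr hF hB) => //.
    by case/andP: aT'.
  - apply: (rintMb _ mVV (fun w _ => bVV w)) => //.
    apply: (incr_pow hF hB j a0 ac _ (isT : 1 <= 4)%N).
    by rewrite (le_trans ca')//; case/andP: aT'.
case: (leP b a') => [ba|/ltW ab''].
  have -> : Num.max 0 (Num.min b b' - a') = 0.
    by apply/max_idPl; rewrite subr_le0 ge_min ba.
  rewrite mulr0 mul0r -(zero b ab ba).2.
  by apply: eq_Rintegral => w _; ring.
have -> : Num.max 0 (Num.min b b' - a') = Num.min b b' - a'.
  by apply/max_idPr; rewrite subr_ge0 le_min ab'' ab'.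
have [i1 E1] := zero a' aa (lexx _).
have [i2 E2] := Fmeas_two_incr j j' a'0 ab'' ab' bT bT' FVV bVV.
rewrite -E2 -[RHS]add0r -E1 -EintD//.
by apply: eq_Rintegral => w _; ring.
Qed.

Lemma overlap_integral a b a' b' :
  rintegrable (@lebesgue_measure R) setT
     (fun s => ((a < s <= b) && (a' < s <= b'))%:R) /\
  \int[@lebesgue_measure R]_s ((a < s <= b) && (a' < s <= b'))%:R = overlap a b a' b'.
Proof.
have -> : (fun s => ((a < s <= b) && (a' < s <= b'))%:R) =
    \1_(`]Num.max a a', Num.min b b']%classic) :> (R -> R).
  apply/funext => s; rewrite indicE; congr (_%:R); congr nat_of_bool.
  by rewrite mem_setE in_itv/= gt_max le_min andbACA.
split; first exact: integrable_indic_itv.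
rewrite /Rintegral integral_indic//= setIT lebesgue_measure_itv/= lte_fin /overlap.
set u := Num.min b b'; set v := Num.max a a'; apply/esym.
by case: (ltP v u) => h /=; [apply/max_idPr; rewrite subr_ge0 ltW|apply/max_idPl; rewrite subr_le0].
Qed.

Lemma dens_pair e e' j : piece_on 0 T e -> piece_on 0 T e' ->
  rintegrable m setT (fun p => piece_dens e j p * piece_dens e' j p) /\
  \int[m]_p (piece_dens e j p * piece_dens e' j p) =
  ((pc_coord e == j) && (pc_coord e' == j))%:R *
  overlap (pc_start e) (pc_end e) (pc_start e') (pc_end e') *
  \int[P]_w (pc_val e w * pc_val e' w).
Proof.
move=> he he'; have [i1 E1] := overlap_integral (pc_start e) (pc_end e) (pc_start e') (pc_end e').
have i2 : rint (fun w => pc_val e w * pc_val e' w).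
  case: he => a0 ab bT FV [K VK]; case: he' => a'0 ab' bT' FV' [K' VK'].
  have aT : 0 <= pc_start e <= T by rewrite a0 (le_trans ab).
  have aT' : 0 <= pc_start e' <= T by rewrite a'0 (le_trans ab').
  apply: (rintMb _ _ (fun w _ => VK w)) => //; first exact: (Fmeas_measurable hF aT FV).
  exact: (Fmeas_bounded_rint aT' FV' VK').
have [i3 E3] := rint_tensor i1 i2.
set c := (_ && _)%:R.
have E p : piece_dens e j p * piece_dens e' j p =
  c * (((pc_start e < p.1 <= pc_end e) && (pc_start e' < p.1 <= pc_end e'))%:R *
       (pc_val e p.2 * pc_val e' p.2)).
  rewrite /c /piece_dens; do 2! case: (_ == j) => /=; rewrite ?mul0r ?mulr0//.
  by do 2! case: (_ < _ <= _) => /=; rewrite ?mul0r ?mulr0// !mul1r.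
split; first by under eq_fun do rewrite E; exact: rintZ.
by under eq_Rintegral do rewrite E; rewrite EintZ// E3 E1 mulrA.
Qed.

Section family.
Variables (I : finType) (e : I -> pc).
Hypothesis he : forall i, piece_on 0 T (e i).

Definition elem_int w := \sum_i piece_int (e i) w.
Definition elem_dens j p := \sum_i piece_dens (e i) j p.

Lemma measurable_elem_int : measurable_fun setT elem_int.
Proof. by apply: measurable_sum => i; exact: measurable_piece. Qed.

(** Both sides expand into sums over pairs of pieces, and each pair contributes the same overlap
    times the same mean; hence no disjointness of the intervals is asked. *)
Lemma elem_isometry :
  [/\ rint (fun w => elem_int w ^+ 2),
      rintegrable m setT (fun p => \sum_j elem_dens j p ^+ 2) &
      \int[P]_w (elem_int w ^+ 2) = \int[m]_p (\sum_j elem_dens j p ^+ 2)].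
Proof.
have rp i k : rint (fun w => piece_int (e i) w * piece_int (e k) w).
  by apply: rintM => //; (exact: measurable_piece || exact: rint_piece_sqr).
have E1 w : elem_int w ^+ 2 = \sum_i \sum_k piece_int (e i) w * piece_int (e k) w.
  by rewrite expr2 mulr_suml; apply: eq_bigr => i _; rewrite mulr_sumr.
have E2 p : \sum_j elem_dens j p ^+ 2 =
    \sum_j \sum_i \sum_k piece_dens (e i) j p * piece_dens (e k) j p.
  apply: eq_bigr => j _.
  by rewrite expr2 mulr_suml; apply: eq_bigr => i _; rewrite mulr_sumr.
have rd j i k : rintegrable m setT (fun p => piece_dens (e i) j p * piece_dens (e k) j p).
  by have [] := dens_pair j (he i) (he k).
split.
- by under eq_fun do rewrite E1; do 2! (apply: rint_sum => // ? _).
- by under eq_fun do rewrite E2; do 3! (apply: rint_sum => // ? _).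
under eq_Rintegral do rewrite E1; under [RHS]eq_Rintegral do rewrite E2.
rewrite Eint_sum//; last by move=> i _; apply: rint_sum.
rewrite Eint_sum//; last by move=> j _; do 2! (apply: rint_sum => // ? _).
transitivity (\sum_j \sum_i \sum_k
    \int[m]_p (piece_dens (e i) j p * piece_dens (e k) j p)); last first.
  apply: eq_bigr => j _; rewrite Eint_sum//; last by move=> i _; apply: rint_sum.
  by apply: eq_bigr => i _; rewrite Eint_sum.
rewrite exchange_big /=; apply: eq_bigr => i _; rewrite Eint_sum//.
rewrite exchange_big /=; apply: eq_bigr => k _.
rewrite piece_pair//.
under eq_bigr => j _ do rewrite (dens_pair j (he i) (he k)).2.
rewrite -!mulr_suml; congr (_ * _ * _).
rewrite (bigD1 (pc_coord (e i)))//= eqxx /= [pc_coord (e k) == _]eq_sym big1 ?addr0// => j.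
by rewrite eq_sym => /negbTE ->.
Qed.

End family.
End elementary_integrals.
Section euclidean_norm.
Context (R : realType) (m n : nat).
Implicit Types A : 'M[R]_(m, n).

Lemma enorm_sqr A : enorm A ^+ 2 = \sum_i \sum_j A i j ^+ 2.
Proof.
by rewrite /enorm sqr_sqrtr//; do 2! apply: sumr_ge0 => ? _; exact: sqr_ge0.
Qed.

Lemma row_le_enorm A i : \sum_j A i j ^+ 2 <= enorm A ^+ 2.
Proof.
rewrite enorm_sqr (bigD1 i)//= lerDl; do 2! apply: sumr_ge0 => ? _; exact: sqr_ge0.
Qed.

Lemma entry_le_enorm A i j : `|A i j| <= enorm A.
Proof.
rewrite -ler_sqr ?nnegrE ?sqrtr_ge0//.
rewrite real_normK ?num_real//; apply: le_trans (row_le_enorm A i).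
by rewrite (bigD1 j)//= lerDl; apply: sumr_ge0 => ? _; exact: sqr_ge0.
Qed.

End euclidean_norm.

(** * Operations on families of pieces *)

Section families.
Context d (Omega : measurableType d) (R : realType) (d0 : nat).
Context (F : R -> set (set Omega)) (B : R -> Omega -> 'cV[R]_d0).
Local Notation pc := (piece R Omega d0).

Definition fam_opp (I : Type) (e : I -> pc) i :=
  Piece (pc_start (e i)) (pc_end (e i)) (pc_coord (e i)) (fun w => - pc_val (e i) w).

Definition fam_add (I J : Type) (e : I -> pc) (e' : J -> pc) (x : I + J) :=
  match x with inl i => e i | inr j => e' j end.

Definition fam_cst s r (V : 'I_d0 -> Omega -> R) j : pc := Piece s r j (V j).

(** The part of a family after time [s]. A piece that ends before [s] becomes degenerate instead of
    being removed, so the index type does not change. *)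
Definition fam_after s (I : Type) (e : I -> pc) i :=
  Piece (Num.max (pc_start (e i)) s) (Num.max (pc_end (e i)) s)
    (pc_coord (e i)) (pc_val (e i)).

Lemma elem_int_opp (I : finType) (e : I -> pc) w :
  elem_int B (fam_opp e) w = - elem_int B e w.
Proof.
by rewrite /elem_int -sumrN; apply: eq_bigr => i _; rewrite /piece_int mulNr.
Qed.

Lemma elem_dens_opp (I : finType) (e : I -> pc) j p :
  elem_dens (fam_opp e) j p = - elem_dens e j p.
Proof.
rewrite /elem_dens -sumrN; apply: eq_bigr => i _; rewrite /piece_dens /=.
by case: ifP => //; rewrite oppr0.
Qed.

Lemma elem_int_add (I J : finType) (e : I -> pc) (e' : J -> pc) w :
  elem_int B (fam_add e e') w = elem_int B e w + elem_int B e' w.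
Proof. by rewrite /elem_int big_sumType. Qed.

Lemma elem_dens_add (I J : finType) (e : I -> pc) (e' : J -> pc) j p :
  elem_dens (fam_add e e') j p = elem_dens e j p + elem_dens e' j p.
Proof. by rewrite /elem_dens big_sumType. Qed.

Lemma elem_dens_cst s r V j p :
  elem_dens (fam_cst s r V) j p = if s < p.1 <= r then V j p.2 else 0.
Proof.
rewrite /elem_dens (bigD1 j)//= big1 ?addr0 => [|i /negbTE ij].
  by rewrite /piece_dens/= eqxx.
by rewrite /piece_dens/= ij.
Qed.

Lemma elem_dens_after (I : finType) s (e : I -> pc) j p :
  elem_dens (fam_after s e) j p = if s < p.1 then elem_dens e j p else 0.
Proof.
rewrite /elem_dens; case: ifP => sp; last first.
  apply: big1 => i _; rewrite /piece_dens /= gt_max sp andbF /=.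
  by case: ifP => // /andP[].
apply: eq_bigr => i _; rewrite /piece_dens /= gt_max sp andbT le_max.
by rewrite [p.1 <= s]leNgt sp orbF.
Qed.

Lemma elem_dens_out (I : finType) lo hi (e : I -> pc) j p :
  (forall i, piece_on F lo hi (e i)) -> ~~ (lo < p.1 <= hi) -> elem_dens e j p = 0.
Proof.
move=> he out; apply: big1 => i _; rewrite /piece_dens; case: ifP => // /and3P[_ h1 h2].
have [l1 _ l2 _ _] := he i; case/negP: out.
by rewrite (le_lt_trans l1 h1) (le_trans h2 l2).
Qed.

Lemma piece_on_opp lo hi (I : Type) (e : I -> pc) :
  (forall i, piece_on F lo hi (e i)) -> forall i, piece_on F lo hi (fam_opp e i).
Proof.
move=> he i; have [h1 h2 h3 h4 [K hK]] := he i; split => //=.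
  exact: measurable_funN.
by exists K => w; rewrite normrN.
Qed.

Lemma piece_on_add lo hi (I J : Type) (e : I -> pc) (e' : J -> pc) :
  (forall i, piece_on F lo hi (e i)) -> (forall j, piece_on F lo hi (e' j)) ->
  forall x, piece_on F lo hi (fam_add e e' x).
Proof. by move=> he he' [i|j]; [exact: he|exact: he']. Qed.

Lemma piece_on_le lo hi lo' hi' (e : pc) : lo' <= lo -> hi <= hi' ->
  piece_on F lo hi e -> piece_on F lo' hi' e.
Proof. by move=> l h [*]; split => //; [exact: le_trans l _|exact: le_trans h]. Qed.

End families.

(** * Rows of simple processes as families of pieces *)

Section simple_processes.
Context d (Omega : measurableType d) (R : realType) (P : probability Omega R).
Context (T : R) (F : R -> set (set Omega)) (hF : filtration P T F).
Context (d0 : nat) (B : R -> Omega -> 'cV[R]_d0) (m : nat).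
Implicit Types S : @simple_process d Omega R m d0.

Definition sp_family S p (kj : 'I_(sp_size S) * 'I_d0) : piece R Omega d0 :=
  Piece (sp_time S kj.1) (sp_time S kj.1.+1) kj.2 (fun w => sp_val S kj.1 w p kj.2).

#[local] Arguments sp_family : clear implicits.

Lemma sp_family_on a b S p : 0 <= a -> b <= T -> simple_on F a b S ->
  forall kj, piece_on F a b (sp_family S p kj).
Proof.
move=> a0 bT [ta tb tle tv] [k j] /=.
have up k' : (k' <= sp_size S)%N -> a <= sp_time S k'.
  elim: k' => [_|k' IH k'S]; first by rewrite ta.
  by rewrite (le_trans (IH (ltnW k'S)))// tle.
have dn k' : (k' <= sp_size S)%N -> sp_time S (sp_size S - k') <= b.
  elim: k' => [_|k' IH k'S]; first by rewrite subn0 tb.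
  apply: le_trans (IH (ltnW k'S)); rewrite -[X in _ <= sp_time S X](subnSK k'S).
  by apply: tle; rewrite ltn_subrL; exact: leq_trans k'S.
have kb : sp_time S k.+1 <= b.
  by rewrite -(subKn (ltn_ord k)); apply: dn; rewrite leq_subr.
have [mv [C vC]] := tv k (ltn_ord k).
split => //=; [exact/up/ltnW|exact: tle| |].
  apply: (Fmeas_entry hF _ mv); rewrite (le_trans a0 (up _ (ltnW (ltn_ord k))))/=.
  by rewrite (le_trans _ bT)// (le_trans _ kb)// tle.
by exists C => w; rewrite (le_trans (entry_le_enorm _ _ _)).
Qed.

Lemma elem_int_sp S p w : elem_int B (sp_family S p) w = sp_integral S B w p 0.
Proof.
rewrite /elem_int /sp_integral summxE -(pair_big xpredT xpredT
  (fun k j => piece_int B (sp_family S p (k, j)) w)) /=.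
apply: eq_bigr => k _; rewrite !mxE; apply: eq_bigr => j _.
by rewrite /piece_int /= !mxE.
Qed.

Lemma elem_dens_sp S p j x :
  elem_dens (sp_family S p) j x = sp_eval S x.1 x.2 p j.
Proof.
rewrite /elem_dens /sp_eval summxE -(pair_big xpredT xpredT
  (fun k j' => piece_dens (sp_family S p (k, j')) j x)) /=.
apply: eq_bigr => k _; rewrite (bigD1 j)//= big1 ?addr0 => [|i /negbTE ij].
  by rewrite /piece_dens/= eqxx /=; case: ifP => // _; rewrite mxE.
by rewrite /piece_dens/= ij.
Qed.

End simple_processes.
Arguments sp_family {d Omega R d0 m} S p kj.

(** * Approximation of stochastic integrals by elementary ones *)

Section ito_integrals.
Context d (Omega : measurableType d) (R : realType) (P : probability Omega R).
Context (T : R) (F : R -> set (set Omega)) (hF : filtration P T F).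
Context (d0 : nat) (B : R -> Omega -> 'cV[R]_d0) (hB : brownian_motion P T F B).
Local Notation rint := (rintegrable P setT).
Local Notation M := (@lebesgue_measure R \x P)%E.
Local Notation D a b := (`[a, b]%classic `*` [set: Omega] : set (measurableTypeR R * Omega)).

Lemma measurable_strip a b : measurable (D a b).
Proof. exact: measurableX. Qed.

Lemma measurable_elem_dens (I : finType) (e : I -> piece R Omega d0) j :
  (forall i, piece_on F 0 T (e i)) ->
  measurable_fun [set: measurableTypeR R * Omega] (elem_dens e j).
Proof.
move=> he; apply: measurable_sum => i; have [a0 ab bT FV _] := he i.
have -> : piece_dens (e i) j = fun p : measurableTypeR R * Omega =>
    (pc_coord (e i) == j)%:R *
    (\1_(`]pc_start (e i), pc_end (e i)]%classic) p.1 * pc_val (e i) p.2).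
  apply/funext => p; rewrite /piece_dens indicE mem_setE in_itv/=.
  by case: (_ == j); case: (_ < _ <= _); rewrite /= ?mul0r ?mul1r.
apply: measurable_funM => //; apply: measurable_funM.
  by apply: measurableT_comp => //; exact: measurable_indic.
apply: measurableT_comp => //; apply: (Fmeas_measurable hF _ FV).
by rewrite a0 (le_trans ab).
Qed.

Lemma measurable_enorm_sqr d' (X : measurableType d') m n (E : set X) (H : X -> 'M[R]_(m, n)) :
  (forall i j, measurable_fun E (fun p => H p i j)) ->
  measurable_fun E (fun p => enorm (H p) ^+ 2).
Proof.
move=> mH; have -> : (fun p => enorm (H p) ^+ 2) = (fun p => \sum_i \sum_j H p i j ^+ 2).
  by apply/funext => p; exact: enorm_sqr.
by apply: measurable_sum => i; apply: measurable_sum => j; apply: measurable_funX.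
Qed.

(** Tonelli turns the iterated integral into one over the product space, where the isometry
    lives. *)
Lemma sq_normE a b m n (H : R -> Omega -> 'M[R]_(m, n)) :
  (forall i j, measurable_fun (D a b) (fun p => H p.1 p.2 i j)) ->
  sq_norm P a b H = (\int[M]_(p in D a b) (enorm (H p.1 p.2) ^+ 2)%:E)%E.
Proof.
move=> mH; pose g (p : measurableTypeR R * Omega) := (enorm (H p.1 p.2) ^+ 2)%:E.
have mg : measurable_fun (D a b) g by apply/measurable_EFinP; exact: measurable_enorm_sqr.
have mgr : measurable_fun setT (g \_ (D a b)).
  by apply/(measurable_restrictT _ (measurable_strip a b)).
rewrite [RHS]integral_mkcond fubini_tonelli2//; last first.
  by apply: erestrict_ge0 => p _; rewrite lee_fin sqr_ge0.
rewrite /sq_norm /fubini_G; apply: eq_integral => w _.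
rewrite [LHS]integral_mkcond; apply: eq_integral => s _; rewrite !patchE.
by rewrite in_setX/= in_setT andbT.
Qed.

Lemma cvge0_near (u : (\bar R)^nat) (e : R) : u @ \oo --> 0%E -> 0 < e ->
  \forall k \near \oo, (u k < e%:E)%E.
Proof.
move=> /fine_cvgP[uf u0] e0.
have u1 : \forall k \near \oo, (fine \o u) k < e by exact: cvgr_lt u0 e e0.
by apply: filterS2 uf u1 => k uk uke; rewrite -(fineK uk) lte_fin.
Qed.

Definition row_err m (H : R -> Omega -> 'M[R]_(m, d0)) p (I : finType)
    (e : I -> piece R Omega d0) (x : R * Omega) : R :=
  \sum_j (H x.1 x.2 p j - elem_dens e j x) ^+ 2.

(** The form in which the definition of the integral is used: for one row, a single family of pieces
    is close to the integral in mean square and has density close to the integrand. *)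
Lemma ito_approx a b m (H : R -> Omega -> 'M[R]_(m, d0)) (I : Omega -> 'cV[R]_m)
    p (eps : R) : 0 <= a -> b <= T -> 0 < eps -> ito_integral P F B a b H I ->
  [/\ measurable_fun setT (fun w => I w p 0), rint (fun w => I w p 0 ^+ 2) &
  exists (J : finType) (e : J -> piece R Omega d0),
  [/\ forall i, piece_on F a b (e i),
      \int[P]_w ((I w p 0 - elem_int B e w) ^+ 2) <= eps,
      rintegrable M (D a b) (row_err H p e) &
      \int[M]_(x in D a b) row_err H p e x <= eps]].
Proof.
move=> a0 bT eps0 [[mH _ _] mI [S [hS cH cI]]].
have mIp : measurable_fun setT (fun w => I w p 0).
  by move=> _ U mU; rewrite setTI; exact: mI.
(* Both limits hold along the same sequence, so one index serves both estimates. *)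
have := filterI (cvge0_near cH eps0) (cvge0_near cI eps0).
case=> k _ /(_ k (leqnn k)) [/= HS IS].
have he := sp_family_on hF p a0 bT (hS k).
have he0 i : piece_on F 0 T (sp_family (S k) p i) by exact: piece_on_le (he i).
have [iE _ _] := elem_isometry hF hB he0.
have mE := measurable_elem_int hF hB he0.
have i1 : rint (fun w => (I w p 0 - elem_int B (sp_family (S k) p) w) ^+ 2) /\
    \int[P]_w ((I w p 0 - elem_int B (sp_family (S k) p) w) ^+ 2) <= eps.
  have mf : measurable_fun setT (fun w => (I w p 0 - elem_int B (sp_family (S k) p) w) ^+ 2).
    by apply: measurable_funX; exact: measurable_funB.
  (* Monotonicity is read off from the suprema over simple functions, so measurability of the full
     norm need not be established. *)
  have le : (\int[P]_w ((I w p 0 - elem_int B (sp_family (S k) p) w) ^+ 2)%:E <=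
      \int[P]_w (enorm (I w - sp_integral (S k) B w) ^+ 2)%:E)%E.
    rewrite !ge0_integralTE//; last 2 first.
    - by move=> w; rewrite lee_fin sqr_ge0.
    - by move=> w; rewrite lee_fin sqr_ge0.
    apply: le_ereal_sup => _ [h hh <-]; exists h => // w; apply: le_trans (hh w) _.
    rewrite lee_fin elem_int_sp; apply: le_trans (row_le_enorm _ p).
    by rewrite big_ord1 !mxE.
  have r : rint (fun w => (I w p 0 - elem_int B (sp_family (S k) p) w) ^+ 2).
    apply: rint_ge0 => //; first by move=> w _; exact: sqr_ge0.
    by rewrite (le_lt_trans le)// (lt_trans IS)// ltry.
  split => //; rewrite -lee_fin -Eint_EFin//; apply: le_trans le _; exact: ltW.
have mD := measurable_strip a b.
have mHd i j : measurable_fun (D a b)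
    (fun x => H x.1 x.2 i j - elem_dens (sp_family (S k) i) j x).
  apply: measurable_funB; first exact: mH.
  apply: measurable_funTS; apply: measurable_elem_dens => kj.
  exact: piece_on_le (sp_family_on hF i a0 bT (hS k) kj).
have mHd' i j : measurable_fun (D a b) (fun x => (H x.1 x.2 - sp_eval (S k) x.1 x.2) i j).
  rewrite (_ : (fun x => _) = (fun x => H x.1 x.2 i j - elem_dens (sp_family (S k) i) j x))//.
  by apply/funext => x; rewrite !mxE elem_dens_sp.
have mr : measurable_fun (D a b) (row_err H p (sp_family (S k) p)).
  by apply: measurable_sum => j; apply: measurable_funX; exact: mHd.
have r0 x : 0 <= row_err H p (sp_family (S k) p) x.
  by apply: sumr_ge0 => j _; exact: sqr_ge0.
have le : (\int[M]_(x in D a b) (row_err H p (sp_family (S k) p) x)%:E <=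
    sq_norm P a b (fun s w => (H s w - sp_eval (S k) s w)%R))%E.
  rewrite sq_normE//; apply: ge0_le_integral => //.
  - by move=> x _; rewrite lee_fin.
  - exact/measurable_EFinP.
  - by apply/measurable_EFinP; exact: measurable_enorm_sqr.
  - move=> x _; rewrite lee_fin; apply: le_trans (row_le_enorm _ p).
    by apply: ler_sum => j _; rewrite !mxE elem_dens_sp.
have rr : rintegrable M (D a b) (row_err H p (sp_family (S k) p)).
  apply: rint_ge0 => //; by rewrite (le_lt_trans le)// (lt_trans HS)// ltry.
split => //.
  have E w : I w p 0 ^+ 2 = ((I w p 0 - elem_int B (sp_family (S k) p) w) +
      elem_int B (sp_family (S k) p) w) ^+ 2 by rewrite subrK.
  under eq_fun do rewrite E; apply: rint_sqrD => //; last exact: i1.1.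
  exact: measurable_funB.
exists _, (sp_family (S k) p); split => //; first exact: i1.2.
by rewrite -lee_fin -Eint_EFin//; apply: le_trans le _; exact: ltW.
Qed.

End ito_integrals.
Section restricted_integrals.
Context d (T : measurableType d) (R : realType) (mu : {measure set T -> \bar R}).
Implicit Types (D E : set T) (f g : T -> R).

Lemma rint_restrict D f : measurable D ->
  rintegrable mu D f <-> rintegrable mu setT (f \_ D).
Proof.
move=> mD; rewrite /rintegrable; apply: (iff_trans (integrable_mkcond _ mD)).
rewrite (_ : (EFin \o f) \_ D = EFin \o (f \_ D))//.
by apply/funext => x; rewrite /= restrict_EFin.
Qed.

Lemma rintS D E f : measurable D -> measurable E -> D `<=` E ->
  rintegrable mu E f -> rintegrable mu D f.
Proof. by move=> mD mE DE; exact: integrableS. Qed.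

End restricted_integrals.

(** * Increments of stochastic integrals *)

Section ito_increments.
Context d (Omega : measurableType d) (R : realType) (P : probability Omega R).
Context (T : R) (F : R -> set (set Omega)) (hF : filtration P T F).
Context (d0 : nat) (B : R -> Omega -> 'cV[R]_d0) (hB : brownian_motion P T F B).
Local Notation rint := (rintegrable P setT).
Local Notation M := (@lebesgue_measure R \x P)%E.
Local Notation D a b := (`[a, b]%classic `*` [set: Omega] : set (measurableTypeR R * Omega)).
Local Notation D' a b := (`]a, b]%classic `*` [set: Omega] : set (measurableTypeR R * Omega)).

Context (m : nat) (H : R -> Omega -> 'M[R]_(m, d0)) (p : 'I_m).
Context (t s r : R) (t0 : 0 <= t) (ts : t <= s) (sr : s <= r) (rT : r <= T).
Context (I0 I1 : Omega -> 'cV[R]_m).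
Context (hI0 : ito_integral P F B t s H I0) (hI1 : ito_integral P F B t r H I1).

Let sT : s <= T. Proof. exact: le_trans rT. Qed.
Let s0 : 0 <= s. Proof. exact: le_trans ts. Qed.
Let tr : t <= r. Proof. exact: le_trans sr. Qed.

(** The integrals up to [s] and up to [r] come with unrelated approximations. Still, [e1] minus [e0]
    minus the comparison family [g] is one family, to which the isometry applies. The inequality (x
    - y + z)^2 <= 3 (x^2 + y^2 + z^2) accounts for 6 = 3 + 3 and for 3. *)
Lemma ito_incr_approx (J0 J1 J : finType) (e0 : J0 -> piece R Omega d0)
    (e1 : J1 -> piece R Omega d0) (g : J -> piece R Omega d0) eps :
  (forall i, piece_on F t s (e0 i)) -> (forall i, piece_on F t r (e1 i)) ->
  (forall i, piece_on F 0 T (g i)) -> 0 < eps ->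
  \int[P]_w ((I0 w p 0 - elem_int B e0 w) ^+ 2) <= eps ->
  \int[P]_w ((I1 w p 0 - elem_int B e1 w) ^+ 2) <= eps ->
  [/\ rint (fun w => (I1 w p 0 - I0 w p 0 - elem_int B g w) ^+ 2),
      rintegrable M setT
        (fun x => \sum_j (elem_dens e1 j x - elem_dens e0 j x - elem_dens g j x) ^+ 2) &
      \int[P]_w ((I1 w p 0 - I0 w p 0 - elem_int B g w) ^+ 2) <=
        6 * eps + 3 * \int[M]_x
          \sum_j (elem_dens e1 j x - elem_dens e0 j x - elem_dens g j x) ^+ 2].
Proof.
move=> he0 he1 hg eps0 E0 E1.
have he0' i : piece_on F 0 T (e0 i) by exact: piece_on_le (he0 i).
have he1' i : piece_on F 0 T (e1 i) by exact: piece_on_le (he1 i).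
have [mI0 I02 _] := ito_approx hF hB p t0 sT eps0 hI0.
have [mI1 I12 _] := ito_approx hF hB p t0 rT eps0 hI1.
pose h := fam_add (fam_add e1 (fam_opp e0)) (fam_opp g).
have hh : forall i, piece_on F 0 T (h i).
  by apply: piece_on_add; [apply: piece_on_add => //|]; exact: piece_on_opp.
have [ih jh Eh] := elem_isometry hF hB hh.
have dE x : \sum_j elem_dens h j x ^+ 2 =
    \sum_j (elem_dens e1 j x - elem_dens e0 j x - elem_dens g j x) ^+ 2.
  by apply: eq_bigr => j _; rewrite !elem_dens_add !elem_dens_opp.
have iE w : elem_int B h w = elem_int B e1 w - elem_int B e0 w - elem_int B g w.
  by rewrite !elem_int_add !elem_int_opp.
have [i0 _ _] := elem_isometry hF hB he0'.
have [i1 _ _] := elem_isometry hF hB he1'.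
have me0 := measurable_elem_int hF hB he0'.
have me1 := measurable_elem_int hF hB he1'.
have mh := measurable_elem_int hF hB hh.
have sB (f k : Omega -> R) : measurable_fun setT f -> measurable_fun setT k ->
    rint (fun w => f w ^+ 2) -> rint (fun w => k w ^+ 2) -> rint (fun w => (f w - k w) ^+ 2).
  move=> mf mk f2 k2; apply: (rint_sqrD _ mf _ f2) => //; first exact: measurable_funN.
  by apply: eq_integrable k2 => // w _; rewrite /= sqrrN.
have r0 := sB _ _ mI0 me0 I02 i0.
have r1 := sB _ _ mI1 me1 I12 i1.
have r3 : rint (fun w => 3 * (I1 w p 0 - elem_int B e1 w) ^+ 2 +
    3 * (I0 w p 0 - elem_int B e0 w) ^+ 2 + 3 * elem_int B h w ^+ 2).
  by apply: rintD => //; [apply: rintD => //|]; exact: rintZ.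
have le w : (I1 w p 0 - I0 w p 0 - elem_int B g w) ^+ 2 <=
    3 * (I1 w p 0 - elem_int B e1 w) ^+ 2 +
    3 * (I0 w p 0 - elem_int B e0 w) ^+ 2 + 3 * elem_int B h w ^+ 2.
  rewrite iE; set x := I1 w p 0 - elem_int B e1 w; set y := I0 w p 0 - elem_int B e0 w.
  set z := elem_int B e1 w - _ - _.
  have -> : I1 w p 0 - I0 w p 0 - elem_int B g w = x - y + z by rewrite /x /y /z; ring.
  have := sqr_ge0 (x + y); have := sqr_ge0 (x - z); have := sqr_ge0 (y + z); nra.
have ir : rint (fun w => (I1 w p 0 - I0 w p 0 - elem_int B g w) ^+ 2).
  apply: (rint_le _ _ r3) => // [|w _]; last by rewrite ger0_norm ?sqr_ge0.
  have mg := measurable_elem_int hF hB hg.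
  by apply: measurable_funX; apply: measurable_funB => //; exact: measurable_funB.
split => //.
  by apply: eq_integrable jh => // x _; rewrite /= dE.
apply: (@le_trans _ _ (3 * \int[P]_w ((I1 w p 0 - elem_int B e1 w) ^+ 2) +
    3 * \int[P]_w ((I0 w p 0 - elem_int B e0 w) ^+ 2) + 3 * \int[P]_w (elem_int B h w ^+ 2))).
  rewrite -!EintZ// -!EintD//; try (by exact: rintZ); last by apply: rintD => //; exact: rintZ.
  by apply: le_Eint.
have -> : \int[M]_x (\sum_j (elem_dens e1 j x - elem_dens e0 j x - elem_dens g j x) ^+ 2) =
    \int[P]_w (elem_int B h w ^+ 2).
  by rewrite Eh; apply: eq_Rintegral => x _; rewrite dE.
lra.
Qed.

(** The arithmetic shared by the next two results: 6e + 3 (2e + 2e + 2c) = 18e + 6c. *)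
Let lin (e a b c S : R) : a <= e -> b <= e -> S <= 2 * a + 2 * b + 2 * c ->
  6 * e + 3 * S <= 18 * e + 6 * c.
Proof. by move=> *; lra. Qed.

Let errS (J : finType) (e : J -> piece R Omega d0) := row_err H p e.

Let err0 (J : finType) (e : J -> piece R Omega d0) x : 0 <= errS e x.
Proof. by apply: sumr_ge0 => j _; exact: sqr_ge0. Qed.

(** On ]s, r] the density of [e1] approximates [H]; before [s] the densities of [e0] and [e1]
    approximate the same [H] and nearly cancel. The constant 6 in place of the exact isometry is
    what the crude inequalities leave once the accuracy tends to 0; only the order is needed. *)
Lemma ito_incr_L2 (V : 'I_d0 -> Omega -> R) K :
  (forall j, Fmeas (F s) (V j)) -> (forall j w, `|V j w| <= K) ->
  [/\ rint (fun w => (I1 w p 0 - I0 w p 0 - \sum_j V j w * (B r w j 0 - B s w j 0)) ^+ 2),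
      rintegrable M (D' s r) (fun x => \sum_j (H x.1 x.2 p j - V j x.2) ^+ 2) &
      \int[P]_w ((I1 w p 0 - I0 w p 0 - \sum_j V j w * (B r w j 0 - B s w j 0)) ^+ 2) <=
      6 * \int[M]_(x in D' s r) \sum_j (H x.1 x.2 p j - V j x.2) ^+ 2].
Proof.
move=> FV VK; pose g := fam_cst s r V.
have hg i : piece_on F s r (g i) by split => //=; exists K.
have hg' i : piece_on F 0 T (g i) by exact: piece_on_le (hg i).
have mD a b : measurable (D a b) by exact: measurable_strip.
have mD' : measurable (D' s r) by exact: measurableX.
have sub : D' s r `<=` D t r.
  move=> x [/=]; rewrite !in_itv/= => /andP[x1 x2] _; split => //=.
  by rewrite x2 andbT (le_trans ts)// ltW.
pose DV (x : R * Omega) := \sum_j (H x.1 x.2 p j - V j x.2) ^+ 2.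
have DV0 x : 0 <= DV x by apply: sumr_ge0 => j _; exact: sqr_ge0.
have [[mH _ _] _ _] := hI1.
have mDV : measurable_fun (D' s r) DV.
  apply: measurable_sum => j; apply: measurable_funX; apply: measurable_funB.
    by apply: (measurable_funS (mD t r) sub); exact: mH.
  apply: measurable_funTS; apply: measurableT_comp => //.
  by apply: (Fmeas_measurable hF _ (FV j)); rewrite s0.
have rDV : rintegrable M (D' s r) DV.
  (* Any accuracy would do here: (H - V)^2 is dominated by 2 (H - e1)^2 + 2 (e1 - V)^2, both
     integrable. *)
  have [_ _ [J1 [e1 [he1 _ r1 _]]]] := ito_approx hF hB p t0 rT ltr01 hI1.
  have he1' i : piece_on F 0 T (e1 i) by exact: piece_on_le (he1 i).
  have hh : forall i, piece_on F 0 T (fam_add e1 (fam_opp g) i).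
    by apply: piece_on_add => //; exact: piece_on_opp.
  have [_ jh _] := elem_isometry hF hB hh.
  have r1' := rintS mD' (mD t r) sub r1.
  have jh' := rintS mD' measurableT (@subsetT _ _) jh.
  apply: (rint_le mD' mDV (rintD mD' (rintZ mD' 2 r1') (rintZ mD' 2 jh'))) => // x [/= xsr _].
  rewrite ger0_norm// /DV /row_err !mulr_sumr -big_split /=; apply: ler_sum => j _.
  rewrite elem_dens_add elem_dens_opp elem_dens_cst.
  move: xsr; rewrite in_itv/= => ->.
  set a := H _ _ _ _; set b := elem_dens _ _ _; set c := V _ _.
  have := sqr_ge0 (a - b - (b - c)); nra.
suff key eps : 0 < eps ->
    rint (fun w => (I1 w p 0 - I0 w p 0 - elem_int B g w) ^+ 2) /\
    \int[P]_w ((I1 w p 0 - I0 w p 0 - elem_int B g w) ^+ 2) <=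
    18 * eps + 6 * \int[M]_(x in D' s r) DV x.
  split => //; first by have [] := key 1 ltr01.
  apply/ler_addgt0Pr => eps eps0; have e18 : 0 < eps / 18 by rewrite divr_gt0.
  have [_] := key _ e18; rewrite addrC mulrCA mulfV ?mulr1//.
move=> eps0.
have [_ _ [J1 [e1 [he1 E1 r1 R1]]]] := ito_approx hF hB p t0 rT eps0 hI1.
have [_ _ [J0 [e0 [he0 E0 r0 R0]]]] := ito_approx hF hB p t0 sT eps0 hI0.
have [ih jh le] := ito_incr_approx he0 he1 hg' eps0 E0 E1.
split => //; apply: le_trans le _.
have r1T := (rint_restrict _ _ (mD t r)).1 r1.
have r0T := (rint_restrict _ _ (mD t s)).1 r0.
have rVT := (rint_restrict _ _ mD').1 rDV.
suff : \int[M]_x (\sum_j (elem_dens e1 j x - elem_dens e0 j x - elem_dens g j x) ^+ 2) <=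
   2 * \int[M]_(x in D t r) row_err H p e1 x + 2 * \int[M]_(x in D t s) row_err H p e0 x +
   2 * \int[M]_(x in D' s r) DV x by move=> h; apply: lin R1 R0 h.
rewrite !(Rintegral_mkcond M (D _ _)) (Rintegral_mkcond M (D' _ _)) -!EintZ// -!EintD//;
  try (by exact: rintZ); last by apply: rintD => //; exact: rintZ.
apply: le_Eint => //.
  by apply: rintD => //; [apply: rintD => //|]; exact: rintZ.
move=> x _; rewrite !patchE !in_setX !in_setT !andbT !mem_setE !in_itv/=.
(* After [s] the family [e0] vanishes and [g] equals [V] up to time [r]; up to [s] the family [g]
   vanishes, and [e1] and [e0] are compared through [H]. Outside ]t, r] every density is 0. *)
have [xs|sx] := leP x.1 s; last first.
  have -> : t <= x.1 by rewrite (le_trans ts)// ltW.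
  rewrite /= mulr0 addr0; have [xr|rx] := leP x.1 r; last first.
    rewrite !mulr0 addr0 big1// => j _.
    rewrite (elem_dens_out j he1) ?(elem_dens_out j he0) ?(elem_dens_out j hg) ?subrr ?expr0n//.
    - by rewrite leNgt rx andbF.
    - by rewrite leNgt sx andbF.
    - by rewrite leNgt rx andbF.
  rewrite /DV /row_err !mulr_sumr -big_split /=; apply: ler_sum => j _.
  rewrite (elem_dens_out j he0) ?elem_dens_cst ?sx ?xr/=; last by rewrite leNgt sx andbF.
  set a := H _ _ _ _; set b := elem_dens _ _ _; set c := V _ _.
  have := sqr_ge0 (b - a - (a - c)); nra.
rewrite (le_trans xs sr) andbT /= mulr0 addr0; have [tx|xt] := leP t x.1; last first.
  rewrite !mulr0 addr0 big1// => j _.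
  rewrite (elem_dens_out j he1) ?(elem_dens_out j he0) ?(elem_dens_out j hg) ?subrr ?expr0n//.
  - by rewrite ltNge xs.
  - by rewrite ltNge (ltW xt).
  - by rewrite ltNge (ltW xt).
rewrite /row_err !mulr_sumr -big_split /=; apply: ler_sum => j _.
rewrite (elem_dens_out j hg) ?subr0; last by rewrite ltNge xs.
set a := H _ _ _ _; set b := elem_dens _ _ _; set c := elem_dens _ _ _.
have := sqr_ge0 (b - a - (a - c)); nra.
Qed.

(** The increment is approximated by an elementary integral living after [s], each piece of which
    has mean zero against [Z]; the mean then passes to the limit. *)
Lemma ito_incr_mean (Z : Omega -> R) K : Fmeas (F s) Z -> (forall w, `|Z w| <= K) ->
  \int[P]_w (Z w * (I1 w p 0 - I0 w p 0)) = 0.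
Proof.
move=> FZ ZK.
have mD a b : measurable (D a b) by exact: measurable_strip.
have mZ : measurable_fun setT Z by apply: (Fmeas_measurable hF _ FZ); rewrite s0.
have K0 : 0 <= K by exact: le_trans (normr_ge0 _) (ZK point).
have key eps : 0 < eps -> exists G : Omega -> R,
   [/\ rint (fun w => Z w * G w), measurable_fun setT (fun w => I1 w p 0 - I0 w p 0 - G w),
     \int[P]_w (Z w * G w) = 0,
     rint (fun w => (I1 w p 0 - I0 w p 0 - G w) ^+ 2) &
     \int[P]_w ((I1 w p 0 - I0 w p 0 - G w) ^+ 2) <= 18 * eps].
  move=> eps0.
  have [mI1 _ [J1 [e1 [he1 E1 r1 R1]]]] := ito_approx hF hB p t0 rT eps0 hI1.
  have [mI0 _ [J0 [e0 [he0 E0 r0 R0]]]] := ito_approx hF hB p t0 sT eps0 hI0.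
  (* Comparing with the tail of [e1] itself makes the density error on ]s, r] vanish, so only the
     approximation errors remain. *)
  pose g := fam_after s e1.
  have hg i : piece_on F s r (g i).
    have [h1 h2 h3 h4 h5] := he1 i; split => //=.
    - by rewrite le_max lexx orbT.
    - by rewrite ge_max !le_max h2 lexx orbT.
    - by rewrite ge_max h3.
    - apply: (Fmeas_le hF _ _ _ h4); first exact: le_trans h1.
      + by rewrite le_max lexx.
      + by rewrite ge_max sT (le_trans h2)// (le_trans h3).
  have hg' i : piece_on F 0 T (g i) by exact: piece_on_le (hg i).
  have [ih jh le] := ito_incr_approx he0 he1 hg' eps0 E0 E1.
  have pz i : rint (fun w => Z w * piece_int B (g i) w) /\
      \int[P]_w (Z w * piece_int B (g i) w) = 0.
    have [h1 h2 h3 h4 [K' hK']] := hg i.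
    under eq_fun do rewrite /piece_int mulrA.
    have a0 : 0 <= pc_start (g i) by exact: le_trans h1.
    have bT : pc_end (g i) <= T by exact: le_trans rT.
    have FZV : Fmeas (F (pc_start (g i))) (fun w => Z w * pc_val (g i) w).
      apply: measurable_funM => //; apply: (Fmeas_le hF s0 h1 _ FZ).
      exact: le_trans bT.
    apply: (Fmeas_incr_mean hF hB) => //.
    apply: (@Fmeas_bounded_rint _ _ _ _ _ _ hF (pc_start (g i)) _ (K * K')) => //.
      by rewrite a0 (le_trans h2).
    by move=> w; rewrite normrM ler_pM.
  exists (elem_int B g); split => //.
  - under eq_fun do rewrite /elem_int mulr_sumr.
    by apply: rint_sum => // i _; exact: (pz i).1.
  - have mg := measurable_elem_int hF hB hg'.
    by apply: measurable_funB => //; exact: measurable_funB.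
  - under eq_Rintegral do rewrite /elem_int mulr_sumr.
    rewrite Eint_sum//; last by move=> i _; exact: (pz i).1.
    by apply: big1 => i _; exact: (pz i).2.
  apply: le_trans le _.
  have r1T := (rint_restrict _ _ (mD t r)).1 r1.
  have r0T := (rint_restrict _ _ (mD t s)).1 r0.
  suff : \int[M]_x (\sum_j (elem_dens e1 j x - elem_dens e0 j x - elem_dens g j x) ^+ 2) <=
     2 * \int[M]_(x in D t r) row_err H p e1 x + 2 * \int[M]_(x in D t s) row_err H p e0 x + 2 * 0.
    by move=> h; have := lin R1 R0 h; rewrite mulr0 addr0.
  rewrite mulr0 addr0.
  rewrite !(Rintegral_mkcond M (D _ _)) -!EintZ// -!EintD//; try (by exact: rintZ).
  apply: le_Eint => //.
    by apply: rintD => //; exact: rintZ.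
  move=> x _; rewrite !patchE !in_setX !in_setT !andbT !mem_setE !in_itv/=.
  have [xs|sx] := leP x.1 s; last first.
    rewrite andbF mulr0 addr0 big1 => [|j _].
      by case: ifP => // _; rewrite mulr_ge0// err0.
    rewrite (elem_dens_out j he0) ?elem_dens_after ?sx ?subr0 ?subrr ?expr0n//.
    by rewrite leNgt sx andbF.
  rewrite (le_trans xs sr) andbT /=; have [tx|xt] := leP t x.1; last first.
    rewrite !mulr0 addr0 big1// => j _.
    rewrite (elem_dens_out j he1) ?(elem_dens_out j he0) ?(elem_dens_out j hg) ?subrr ?expr0n//.
    - by rewrite ltNge xs.
    - by rewrite ltNge (ltW xt).
    - by rewrite ltNge (ltW xt).
  rewrite /row_err !mulr_sumr -big_split /=; apply: ler_sum => j _.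
  rewrite (elem_dens_out j hg) ?subr0; last by rewrite ltNge xs.
  set a := H _ _ _ _; set b := elem_dens _ _ _; set c := elem_dens _ _ _.
  have := sqr_ge0 (b - a - (a - c)); nra.
apply/eqP; rewrite -normr_eq0 eq_le normr_ge0 andbT.
apply/ler_addgt0Pr => e e0; rewrite add0r.
(* The final bound is (K + 1) (eta + 18 eta^2 / eta) = 19 (K + 1) eta, which is [e]. *)
pose eta := e / (19 * (K + 1)).
have K1 : 0 < K + 1 by rewrite ltr_wpDl.
have eta0 : 0 < eta by rewrite divr_gt0// mulr_gt0.
have [G [iG mG EG i2 le]] := key (eta ^+ 2) ltac:(by rewrite exprn_gt0).
pose X w := I1 w p 0 - I0 w p 0 - G w.
(* This elementary inequality replaces Cauchy-Schwarz in passing from mean square to mean. *)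
have bX w : `|X w| <= eta + X w ^+ 2 / eta.
  have -> : eta + X w ^+ 2 / eta = (eta ^+ 2 + X w ^+ 2) / eta.
    by field; rewrite gt_eqF.
  rewrite ler_pdivlMr//.
  rewrite -(real_normK (num_real (X w))).
  have := sqr_ge0 (`|X w| - eta); have := sqr_ge0 `|X w|; have := sqr_ge0 eta; nra.
have rb : rint (fun w => eta + X w ^+ 2 / eta).
  by apply: rintD => //; [exact: prob_rint_cst|exact: rintZr].
have rX : rint X by exact: (rint_le measurableT mG rb (fun w _ => bX w)).
have rZX : rint (fun w => Z w * X w) by exact: (rintMb measurableT mZ (fun w _ => ZK w) rX).
have -> : \int[P]_w (Z w * (I1 w p 0 - I0 w p 0)) = \int[P]_w (Z w * X w).
  rewrite -[RHS]addr0 -EG -EintD//; apply: eq_Rintegral => w _; rewrite /X; ring.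
apply: le_trans (le_norm_Eint _ rZX) _ => //.
apply: (@le_trans _ _ (\int[P]_w ((K + 1) * (eta + X w ^+ 2 / eta)))).
  apply: le_Eint => //; [exact: rint_norm|exact: rintZ|].
  move=> w _; rewrite normrM; apply: ler_pM => //.
  by rewrite (le_trans (ZK w))// lerDl.
rewrite EintZ// EintD//; [|exact: prob_rint_cst|exact: rintZr].
rewrite prob_Eint_cst EintZr//.
have : (\int[P]_w (X w ^+ 2)) / eta <= 18 * eta.
  by rewrite ler_pdivrMr// -mulrA -expr2.
have -> : e = (K + 1) * (19 * eta).
  by rewrite /eta; field; rewrite gt_eqF.
by move=> h; rewrite ler_pM2l//; lra.
Qed.

End ito_increments.

(** * Joint measurability of functions continuous in time *)

Section caratheodory.
Context d (X : measurableType d) (R : realType).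

(** Rounding the time down to multiples of 1/(n+1) gives functions whose preimages are countable
    unions of rectangles; continuity in time makes them converge pointwise to [f]. *)
Lemma caratheodory_measurable (D : set X) (a b : R) (f : R -> X -> R) :
  measurable D ->
  (forall s, a <= s <= b -> measurable_fun D (f s)) ->
  (forall x, D x -> {within `[a, b], continuous (f^~ x)}) ->
  measurable_fun (`[a, b]%classic `*` D : set (measurableTypeR R * X)) (fun p => f p.1 p.2).
Proof.
move=> mD mf cf.
have [ab|ba] := leP a b; last first.
  by rewrite set_itv_ge ?bnd_simp -?ltNge// set0X; exact: measurable_fun_set0.
(* Rounding may fall outside [a, b]; clamping keeps the evaluation where [f] is under control. *)
pose c (x : R) := Num.max a (Num.min b x).
have cab x : a <= c x <= b by rewrite /c le_max lexx ge_max ab ge_min lexx.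
pose q (n : nat) (s : R) := c ((Num.floor (s * n.+1%:R))%:~R / n.+1%:R).
pose h n (p : measurableTypeR R * X) := f (q n p.1) p.2.
have mE : measurable (`[a, b]%classic `*` D : set (measurableTypeR R * X)).
  exact: measurableX.
apply: (measurable_fun_cvg (h := h)) => [n|[s x] [/=]].
  move=> _ U mU.
  pose A (z : int) : set (measurableTypeR R) :=
    `[a, b]%classic `&` `[z%:~R / n.+1%:R, (z + 1)%:~R / n.+1%:R[%classic.
  pose G z : set X := D `&` f (c (z%:~R / n.+1%:R)) @^-1` U.
  rewrite (_ : _ `&` _ = \bigcup_z (A z `*` G z)).
    apply: countable_bigcupT_measurable; first exact: countableP.
    move=> z; apply: measurableX; first exact: measurableI.
    exact: mf.
  have fl (s : R) (z : int) : (z%:~R / n.+1%:R <= s < (z + 1)%:~R / n.+1%:R) =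
      (Num.floor (s * n.+1%:R) == z).
    rewrite ler_pdivrMr// ltr_pdivlMr//.
    apply/idP/eqP => [/floor_def//|<-]; exact: floor_itv.
  apply/seteqP; split => [[s x] [[/= sab Dx] Uh]|[s x] [z _ [[/= sab +] [Dx Ux]]]].
    exists (Num.floor (s * n.+1%:R)) => //; split => //=; split => //=.
    by rewrite in_itv/= fl.
  by rewrite in_itv/= fl => /eqP zE; split => //; rewrite /preimage/= /h /q /= zE.
move=> sab Dx; have /subspace_continuousP/(_ s sab) := cf x Dx.
move=> /cvgrPdist_lt fs; apply/cvgrPdist_lt => e e0.
have := fs e e0; rewrite /= near_withinE => /nbhs_ballP[r /= r0 rP].
have [k] := ltr_add_invr r0; rewrite add0r => kr.
exists k => // n /= kn; apply: rP; last by rewrite /= in_itv/= cab.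
rewrite /ball /= /q.
have n0 : 0 < n.+1%:R :> R by [].
have nk : n.+1%:R^-1 <= k.+1%:R^-1 :> R by rewrite lef_pV2 ?posrE// ler_nat.
have /andP[f1 f2] := floor_itv (s * n.+1%:R).
set z := Num.floor _ in f1 f2 *.
have z1 : z%:~R / n.+1%:R <= s by rewrite ler_pdivrMr.
have z2 : s < z%:~R / n.+1%:R + n.+1%:R^-1.
  by rewrite -[X in _ + X]mul1r -mulrDl ltr_pdivlMr// (lt_le_trans f2)// intrD.
move: sab; rewrite /= in_itv/= => /andP[as_ sb].
apply: le_lt_trans kr; apply: le_trans nk; rewrite ler_norml /c.
move: z1 z2; set u := z%:~R / _; set v := _^-1 => z1 z2.
have v0 : 0 < v by rewrite invr_gt0.
case: (leP b u) => bu; first by case: (leP a b) => ?; apply/andP; split; lra.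
by case: (leP a u) => ?; apply/andP; split; lra.
Qed.

End caratheodory.

(** * Continuity on the strip and uniformity on boxes *)

Section strip_continuity.
Context (R : realType) (T : R) (n : nat).
Implicit Types (f : R -> 'cV[R]_n -> R).

(** Continuity relative to the strip in epsilon form and in coordinates, the shape consumed by the
    Taylor estimates; [within_scont] and [scont_within] relate it to the topological form. *)
Definition scont f := forall (s : R) (x : 'cV[R]_n), 0 <= s <= T -> forall e, 0 < e -> exists2 r, 0 < r &
  forall s' (y : 'cV[R]_n), 0 <= s' <= T -> `|s' - s| < r -> (forall i, `|y i 0 - x i 0| < r) ->
  `|f s' y - f s x| < e.

Lemma within_scont f : {within strip T, continuous (fun q => f q.1 q.2)} -> scont f.
Proof.
move=> /subspace_continuousP cf s x sT e e0.
have /cvgrPdist_lt /(_ e e0) := cf (s, x) sT.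
rewrite /= near_withinE => /nbhs_ballP[r /= r0 rP]; exists r => // s' y s'T s's yx.
rewrite distrC; apply: (rP (s', y)) => //; split; rewrite /=.
  by rewrite /ball/= distrC.
by split => // i j; rewrite (ord1 j) /ball/= distrC.
Qed.

Lemma scont_within f : scont f -> {within strip T, continuous (fun q => f q.1 q.2)}.
Proof.
move=> cf; apply/subspace_continuousP => -[s x] /= sT.
apply/cvgrPdist_lt => e e0; have [r r0 rP] := cf s x sT e e0.
rewrite near_withinE; apply/nbhs_ballP; exists r => //= -[s' y] [/= s's [_ yx]] s'T.
rewrite distrC; apply: rP => //; first by rewrite distrC.
by move=> i; rewrite distrC; exact: yx.
Qed.

Lemma scont_section f s : 0 <= s <= T -> scont f -> continuous (f s).
Proof.
move=> sT cf x.
suff : forall e, 0 < e -> \forall y \near x, `|f s x - f s y| < e by move/cvgrPdist_lt.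
move=> e e0; have [r r0 rP] := cf s x sT e e0.
apply/nbhs_ballP; exists r => //= y [_ yx].
rewrite distrC; apply: rP => //; first by rewrite subrr normr0.
by move=> i; rewrite distrC; exact: yx.
Qed.

(** The common compactness argument: a property that holds near every point for all small parameters
    holds on the whole box for one parameter. *)
Lemma strip_covering (N : R) (Q : R -> R -> 'cV[R]_n -> Prop) :
  (forall (s : R) (x : 'cV[R]_n), 0 <= s <= T -> exists2 r, 0 < r &
    forall s' (y : 'cV[R]_n) e, 0 <= s' <= T -> `|s' - s| < r -> (forall i, `|y i 0 - x i 0| < r) ->
      0 < e < r -> Q e s' y) ->
  exists2 e, 0 < e & forall s (x : 'cV[R]_n), 0 <= s <= T -> (forall i, `|x i 0| <= N) -> Q e s x.
Proof.
move=> loc.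
(* Time is stored as coordinate 0 of a row vector of length n+1, so the box is a product of compact
   intervals. *)
pose A (i : 'I_n.+1) : set R := if i == ord0 then `[0, T]%classic else `[- N, N]%classic.
have cA : compact [set v : 'rV[R]_n.+1 | forall i, A i (v ord0 i)].
  by apply: rV_compact => i; rewrite /A; case: ifP => _; exact: segment_compact.
pose dec (v : 'rV[R]_n.+1) : 'cV[R]_n := \col_i v ord0 (lift ord0 i).
have := (compact_near_coveringP _).1 cA _ (0 : R)^'+
  (fun e v => 0 <= v ord0 ord0 <= T -> Q e (v ord0 ord0) (dec v)) _.
case.
- move=> v vA; have v0 : 0 <= v ord0 ord0 <= T.
    by have := vA ord0; rewrite /A eqxx /= in_itv.
  have [r r0 rP] := loc _ (dec v) v0.
  exists (ball v r, [set e | 0 < e < r]).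
    split; first exact: nbhsx_ballx.
    by near=> e => /=; apply/andP; split; near: e; [exact: nbhs_right_gt|exact: nbhs_right_lt].
  move=> [v' e] [/= [_ vv'] er] v'T; apply: rP => //.
    by rewrite distrC; exact: vv'.
  by move=> i; rewrite !mxE distrC; exact: vv'.
move=> r /= r0 rP; have r2 : 0 < r / 2 by rewrite divr_gt0.
exists (r / 2) => // s x sT xN.
pose v : 'rV[R]_n.+1 := \row_j (if unlift ord0 j is Some i then x i 0 else s).
have v0 : v ord0 ord0 = s by rewrite mxE unlift_none.
have vx : dec v = x by apply/colP => i; rewrite !mxE liftK.
have := rP (r / 2); rewrite /= sub0r normrN ger0_norm ?ltW// ltr_pdivrMr// ltr_pMr// ltr1n.
move=> /(_ isT r2 v); rewrite v0 vx; apply => // i.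
rewrite /A; case: (unliftP ord0 i) => [j ->|->].
  by rewrite eq_sym (negbTE (neq_lift _ _)) /= in_itv/= mxE liftK -ler_norml.
by rewrite eqxx /= in_itv/= v0.
Unshelve. all: by end_near. Qed.

(** Uniform continuity in which only [x] is confined to the box: a path that starts in the box may
    leave it within a step. *)
Lemma scont_unif f N e : scont f -> 0 < e -> exists2 r, 0 < r &
  forall s s' (x y : 'cV[R]_n), 0 <= s <= T -> 0 <= s' <= T -> (forall i, `|x i 0| <= N) ->
    `|s' - s| < r -> (forall i, `|y i 0 - x i 0| < r) -> `|f s' y - f s x| <= e.
Proof.
move=> cf e0; pose Q (r s : R) (x : 'cV[R]_n) := forall (s' : R) (y : 'cV[R]_n), 0 <= s' <= T -> `|s' - s| < r ->
  (forall i, `|y i 0 - x i 0| < r) -> `|f s' y - f s x| <= e.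
have [|r r0 rP] := @strip_covering N Q; last by exists r => // s s' x y *; exact: rP.
move=> s x sT; have [r r0 rP] := cf s x sT (e / 2) ltac:(by rewrite divr_gt0).
exists (r / 2); first by rewrite divr_gt0.
move=> s' x' e' s'T s's x'x /andP[e'0 e'r] s'' y s''T ss yx.
have h1 : `|f s' x' - f s x| < e / 2.
  apply: rP => // [|i]; first by apply: lt_trans s's _; rewrite ltr_pdivrMr// ltr_pMr// ltr1n.
  by apply: lt_trans (x'x i) _; rewrite ltr_pdivrMr// ltr_pMr// ltr1n.
have tri (u v w : R) : `|u - v| < e' -> `|v - w| < r / 2 -> `|u - w| < r.
  move=> uv vw; rewrite (_ : u - w = (u - v) + (v - w)); last by ring.
  by apply: le_lt_trans (ler_normD _ _) _; lra.
have h2 : `|f s'' y - f s x| < e / 2.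
  by apply: rP => // [|i]; [exact: tri ss s's|exact: tri (yx i) (x'x i)].
rewrite (_ : f s'' y - f s' x' = (f s'' y - f s x) - (f s' x' - f s x)); last by ring.
by apply: le_trans (ler_normB _ _) _; lra.
Qed.

Lemma scont_bounded f N : scont f -> exists2 M, 0 < M &
  forall s (x : 'cV[R]_n), 0 <= s <= T -> (forall i, `|x i 0| <= N) -> `|f s x| <= M.
Proof.
(* Bounding by the inverse makes the property easier as the parameter shrinks, as [strip_covering]
   wants. *)
move=> cf; pose Q (r s : R) (x : 'cV[R]_n) := `|f s x| <= r^-1.
have [|r r0 rP] := @strip_covering N Q; last by exists r^-1 => //; rewrite invr_gt0.
move=> s x sT; have [r r0 rP] := cf s x sT 1 ltr01.
pose M := `|f s x| + 1; have M0 : 0 < M by rewrite ltr_pwDr.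
exists (Num.min r M^-1); first by rewrite lt_min r0 invr_gt0.
move=> s' y e s'T; rewrite lt_min => /andP[s's _] yx; rewrite lt_min => /and3P[e0 er eM].
rewrite /Q; apply: (@le_trans _ _ M); last first.
  by rewrite -[M]invrK lef_pV2 ?posrE ?invr_gt0// ltW.
have : `|f s' y - f s x| < 1.
  by apply: rP => // i; have := yx i; rewrite lt_min => /andP[].
have := ler_normD (f s' y - f s x) (f s x); rewrite subrK /M; lra.
Qed.

Lemma scontD f g : scont f -> scont g -> scont (fun s x => f s x + g s x).
Proof.
move=> /scont_within cf /scont_within cg; apply: within_scont => q.
by apply: cvgD; [exact: cf|exact: cg].
Qed.

Lemma scontM f g : scont f -> scont g -> scont (fun s x => f s x * g s x).
Proof.
move=> /scont_within cf /scont_within cg; apply: within_scont => q.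
by apply: cvgM; [exact: cf|exact: cg].
Qed.

Lemma scont_cst k : scont (fun _ _ => k).
Proof. by move=> s x _ e e0; exists 1 => // *; rewrite subrr normr0. Qed.

Lemma scont_sum (I : Type) (r : seq I) (f : I -> R -> 'cV[R]_n -> R) :
  (forall i, scont (f i)) -> scont (fun s x => \sum_(i <- r) f i s x).
Proof.
move=> cf; elim: r => [|i r IH].
  rewrite (_ : (fun s x => _) = (fun _ _ => 0)); first exact: scont_cst.
  by apply/funext => s; apply/funext => x; rewrite big_nil.
rewrite (_ : (fun s x => _) = (fun s x => f i s x + \sum_(j <- r) f j s x)).
  exact: scontD.
by apply/funext => s; apply/funext => x; rewrite big_cons.
Qed.

End strip_continuity.

(** * Differentiation along lines and second-order expansion *)

Section taylor.
Context (R : realType).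

Lemma is_derive_eps (phi : R -> R) (c l : R) :
  (forall e, 0 < e -> exists2 r, 0 < r & forall h, h != 0 -> `|h| < r ->
     `|h^-1 * (phi (h + c) - phi c) - l| < e) ->
  is_derive c 1 phi l.
Proof.
move=> H.
have L : (fun h : R => h^-1 *: ((phi \o shift c) (h *: 1) - phi c)) @ 0^' --> l.
  apply/cvgrPdist_lt => e e0; have [r r0 rP] := H e e0.
  rewrite /= /dnbhs near_withinE; apply/nbhs_ballP; exists r => //= h hr h0.
  by rewrite distrC /GRing.scale/= mulr1; apply: rP => //; move: hr; rewrite /ball/= sub0r normrN.
apply: DeriveDef; first exact: cvgP L.
exact: cvg_lim L.
Qed.

Lemma is_derive_line (V : normedModType R) (f : V -> R) (z v : V) (c df : R) :
  is_derive (z + c *: v) v f df -> is_derive c 1 (fun t => f (z + t *: v)) df.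
Proof.
move=> [d E].
have Q : (fun h : R => h^-1 *: (((fun t => f (z + t *: v)) \o shift c) (h *: 1) - f (z + c *: v))) =
    (fun h : R => h^-1 *: ((f \o shift (z + c *: v)) (h *: v) - f (z + c *: v))).
  apply/funext => h; congr (_ *: (_ - _)) => /=; congr f.
  by rewrite [h%:A]mulr1 scalerDl addrCA.
apply: DeriveDef; first by rewrite /derivable Q.
by rewrite /derive Q.
Qed.

Lemma is_derive_continuous (phi dphi : R -> R) : (forall t : R, is_derive t 1 phi (dphi t)) ->
  continuous phi.
Proof.
by move=> H t; apply: differentiable_continuous; apply/derivable1_diffP; case: (H t).
Qed.

Lemma MVT0 (phi dphi : R -> R) (a : R) : (forall t : R, is_derive t 1 phi (dphi t)) ->
  exists2 c, `|c| <= `|a| & phi a - phi 0 = dphi c * a.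
Proof.
move=> H; have cphi := is_derive_continuous H.
have [a0|a0] := leP 0 a.
  have [|c] := @MVT_segment R phi dphi 0 a a0 (fun t _ => H t).
    exact: continuous_subspaceT.
  rewrite in_itv/= subr0 => /andP[c0 ca] E; exists c => //.
  by rewrite !ger0_norm.
have [|c] := @MVT_segment R phi dphi a 0 (ltW a0) (fun t _ => H t).
  exact: continuous_subspaceT.
rewrite in_itv/= sub0r => /andP[ac c0] E; exists c.
  by rewrite !ler0_norm ?lerN2// ltW.
by rewrite -[LHS]opprB E; ring.
Qed.

Lemma sum_sqr_ge0 n (f : 'I_n -> R) : 0 <= \sum_i f i ^+ 2.
Proof. by apply: sumr_ge0 => i _; exact: sqr_ge0. Qed.

(** Continuous partial derivatives give the chain rule on a line: the displacement is made one
    coordinate at a time, the mean value theorem is applied to each move, and continuity brings the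
    intermediate points back to [y]. *)
Lemma is_derive_partials n (f : 'cV[R]_n -> R) (Df : 'I_n -> 'cV[R]_n -> R) :
  (forall x i, is_derive x (evec i) f (Df i x)) -> (forall i, continuous (Df i)) ->
  forall x v (t : R), is_derive t 1 (fun t => f (x + t *: v)) (\sum_i v i 0 * Df i (x + t *: v)).
Proof.
move=> Hf Hc x v t; apply: is_derive_eps => e e0.
set y := x + t *: v.
have cont i : exists2 r, 0 < r &
    forall z : 'cV[R]_n, (forall k, `|z k 0 - y k 0| < r) -> `|Df i z - Df i y| < e / (n.+1%:R * (`|v i 0| + 1)).
  have d0 : 0 < e / (n.+1%:R * (`|v i 0| + 1)) by rewrite divr_gt0// mulr_gt0// ltr_pwDr.
  have /cvgrPdist_lt/(_ _ d0) /nbhs_ballP[r /= r0 rP] := Hc i y.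
  exists r => // z zy; rewrite distrC; apply: rP; split => // k j.
  by rewrite (ord1 j) /ball/= distrC.
have [rr rr0 rrP] : exists2 r, 0 < r & forall i (z : 'cV[R]_n), (forall k, `|z k 0 - y k 0| < r) ->
    `|Df i z - Df i y| < e / (n.+1%:R * (`|v i 0| + 1)).
  pose r i := sval (cid2 (cont i)).
  exists (\big[Num.min/1]_i r i).
    by apply/bigmin_gtP; split => // i _; rewrite /r; case: cid2.
  move=> i z zy; move: (zy); rewrite /r; have := svalP (cid2 (cont i)); rewrite -/(r i).
  case=> _ rP _; apply: rP => k; apply: lt_le_trans (zy k) _.
  exact: bigmin_le.
pose W := \sum_i `|v i 0| + 1.
have W0 : 0 < W by rewrite ltr_pwDr// sumr_ge0.
exists (rr / W) => [|h h0 hr]; first by rewrite divr_gt0.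
(* The displacement after [k] moves. Since [W] dominates every entry of [v], the condition |h| W <
   rr keeps all intermediate points close to [y]. *)
pose vk (k : nat) : 'cV[R]_n := \col_i (if (i < k)%N then v i 0 else 0).
pose G k := f (y + h *: vk k).
have step (k : 'I_n) : exists2 z : 'cV[R]_n, (forall l, `|z l 0 - y l 0| < rr) &
    G k.+1 - G k = Df k z * (h * v k 0).
  have vkS : vk k.+1 = vk k + v k 0 *: evec k.
    apply/colP => i; rewrite !mxE ltnS leq_eqVlt eqxx andbT.
    have [->|ik] := eqVneq i k; first by rewrite eqxx ltnn /= mulr1 add0r.
    by rewrite (inj_eq val_inj) (negbTE ik) /= mulr0 addr0.
  have [c ca E] := @MVT0 (fun t => f (y + h *: vk k + t *: evec k))
    (fun t => Df k (y + h *: vk k + t *: evec k)) (h * v k 0)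
    (fun t => is_derive_line (Hf (y + h *: vk k + t *: evec k) k)).
  exists (y + h *: vk k + c *: evec k).
    move=> l; rewrite !mxE.
    have vW i : `|v i 0| < W.
      rewrite /W (bigD1 i)//= -addrA ltrDl ltr_pwDr// sumr_ge0//.
    have hv i : `|h * v i 0| < rr.
      rewrite normrM; apply: (@le_lt_trans _ _ (`|h| * W)).
        by rewrite ler_wpM2l// ltW.
      by rewrite -ltr_pdivlMr.
    set u := (if _ then _ else _).
    rewrite eqxx andbT (_ : _ - _ = h * u + c * (l == k)%:R); last by ring.
    rewrite /u.
    have [->|lk] := eqVneq l k.
      by rewrite ltnn mulr0 add0r mulr1; apply: le_lt_trans ca _.
    rewrite mulr0 addr0; case: ifP => _; last by rewrite mulr0 normr0.
    exact: hv.
  rewrite -E /G vkS scalerDr addrA scalerA.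
  by rewrite scale0r addr0.
have tele : f (y + h *: v) - f y = \sum_(k < n) (G k.+1 - G k).
  rewrite -(big_mkord xpredT (fun k => G k.+1 - G k)) telescope_sumr//.
  congr (f _ - f _); first by congr (_ + _ *: _); apply/colP => i; rewrite !mxE ltn_ord.
  rewrite (_ : vk 0%N = 0) ?scaler0 ?addr0//.
  by apply/colP => i; rewrite !mxE.
have xh : x + (h + t) *: v = y + h *: v by rewrite /y scalerDl addrA addrAC.
rewrite xh tele mulr_sumr -sumrB.
apply: (@le_lt_trans _ _ (\sum_(k < n) e / n.+1%:R)).
  apply: le_trans (ler_norm_sum _ _ _) _; apply: ler_sum => k _.
  have [z zr ->] := step k.
  rewrite (_ : _ - _ = v k 0 * (Df k z - Df k y)); last by field.
  rewrite normrM; apply: (@le_trans _ _ ((`|v k 0| + 1) * (e / (n.+1%:R * (`|v k 0| + 1))))).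
    by apply: ler_pM => //; [rewrite lerDl|exact/ltW/rrP].
  rewrite le_eqVlt; apply/orP; left; apply/eqP; field.
  by apply/andP; split; [rewrite nat1r pnatr_eq0|rewrite gt_eqF// ltr_pwDr].
by rewrite sumr_const card_ord -[X in X < _]mulr_natr mulrAC ltr_pdivrMr// ltr_pM2l// ltr_nat.
Qed.

(** Subtracting the linear and quadratic terms from [phi] and using the mean value theorem twice
    leaves (ddphi c' - ddphi 0) c with |c'| <= |c| <= 1. *)
Lemma taylor_line (phi dphi ddphi : R -> R) e :
  (forall t : R, is_derive t 1 phi (dphi t)) -> (forall t : R, is_derive t 1 dphi (ddphi t)) ->
  (forall t : R, `|t| <= 1 -> `|ddphi t - ddphi 0| <= e) ->
  `|phi 1 - phi 0 - dphi 0 - 2^-1 * ddphi 0| <= e.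
Proof.
move=> H1 H2 He.
pose psi t := phi t - dphi 0 * t - 2^-1 * ddphi 0 * t ^+ 2.
pose dpsi t := dphi t - dphi 0 - ddphi 0 * t.
have H (t : R) : is_derive t 1 psi (dpsi t).
  have h2 := is_deriveZ (dphi 0) (is_derive_id t (1 : R)).
  have h3 := is_deriveZ (2^-1 * ddphi 0) (is_deriveX 2 (is_derive_id t (1 : R))).
  have -> : psi = phi - dphi 0 \*: id - (2^-1 * ddphi 0) \*: (id ^+ 2 : R -> R).
    by apply/funext => x; rewrite /psi !fctE /GRing.scale.
  have h4 := is_deriveB (is_deriveB (H1 t) h2) h3; apply: (is_derive_eq h4).
  by rewrite /dpsi /GRing.scale/= expr1; field.
have [c c1 E] := MVT0 1 H.
have [c' cc' E'] := MVT0 c H2.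
move: c1; rewrite normr1 => c1.
have -> : phi 1 - phi 0 - dphi 0 - 2^-1 * ddphi 0 = psi 1 - psi 0 by rewrite /psi; ring.
rewrite E mulr1 /dpsi E'.
have -> : ddphi c' * c - ddphi 0 * c = (ddphi c' - ddphi 0) * c by ring.
rewrite normrM -[e]mulr1; apply: ler_pM => //; apply: He; exact: le_trans cc' c1.
Qed.

End taylor.

(** * Taylor estimates for functions smooth on the strip *)

Section smooth_functions.
Context (R : realType) (T : R) (n : nat).

(** Derivatives are named functions rather than limits. The time derivative is required on the open
    interval only: the mean value theorem asks no more, and continuity covers the endpoints. *)
Record strip_smooth (u ut : R -> 'cV[R]_n -> R) (g : 'I_n -> R -> 'cV[R]_n -> R)
    (H : 'I_n -> 'I_n -> R -> 'cV[R]_n -> R) : Prop := {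
  ss_u : scont T u;
  ss_ut : scont T ut;
  ss_g : forall i, scont T (g i);
  ss_H : forall i j, scont T (H i j);
  ss_time : forall (s : R) x, 0 < s < T -> is_derive s 1 (u^~ x) (ut s x);
  ss_grad : forall (s : R) x i, 0 <= s <= T -> is_derive x (evec i) (u s) (g i s x);
  ss_hess : forall (s : R) x i j, 0 <= s <= T -> is_derive x (evec i) (g j s) (H i j s x) }.

Lemma sum_mul_le (v : 'I_n -> R) (h : 'I_n -> 'I_n -> R) e : (forall i j, `|h i j| <= e) ->
  `|\sum_i v i * \sum_j v j * h j i| <= e * n%:R * \sum_i v i ^+ 2.
Proof.
move=> he.
apply: (@le_trans _ _ (\sum_i \sum_j (2^-1 * (v i ^+ 2 + v j ^+ 2) * e))).
  apply: le_trans (ler_norm_sum _ _ _) _; apply: ler_sum => i _.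
  rewrite mulr_sumr; apply: le_trans (ler_norm_sum _ _ _) _; apply: ler_sum => j _.
  rewrite mulrA normrM; apply: ler_pM => //; rewrite normrM.
  rewrite -(real_normK (num_real (v i))) -(real_normK (num_real (v j))).
  have := sqr_ge0 (`|v i| - `|v j|); nra.
under eq_bigr do (rewrite -mulr_suml -mulr_sumr big_split/= sumr_const card_ord).
rewrite -mulr_suml -mulr_sumr big_split/= sumr_const card_ord sumrMnl.
set S := \sum_i _; rewrite -mulr_natr le_eqVlt; apply/orP; left; apply/eqP.
by field.
Qed.

Variables (u ut : R -> 'cV[R]_n -> R) (g : 'I_n -> R -> 'cV[R]_n -> R).
Variables (H : 'I_n -> 'I_n -> R -> 'cV[R]_n -> R) (ssu : strip_smooth u ut g H).

Lemma taylor_space (s : R) (x v : 'cV[R]_n) e : 0 <= s <= T ->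
  (forall t : R, `|t| <= 1 -> forall i j, `|H i j s (x + t *: v) - H i j s x| <= e) ->
  `|u s (x + v) - u s x - \sum_i v i 0 * g i s x
    - 2^-1 * \sum_i v i 0 * \sum_j v j 0 * H j i s x| <= e * n%:R * \sum_i v i 0 ^+ 2.
Proof.
move=> sT He.
have d1 (t : R) := is_derive_partials (fun x i => ss_grad ssu x i sT)
  (fun i => scont_section sT (ss_g ssu i)) x v t.
have d2 (t : R) : is_derive t 1 (fun t => \sum_i v i 0 * g i s (x + t *: v))
    (\sum_i v i 0 * \sum_j v j 0 * H j i s (x + t *: v)).
  have h1 i := is_deriveZ (v i 0) (is_derive_partials (fun x j => ss_hess ssu x j i sT)
    (fun j => scont_section sT (ss_H ssu j i)) x v t).
  have := is_derive_sum h1.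
  by congr is_derive; apply/funext => y; rewrite fct_sumE.
have := taylor_line (e := e * n%:R * \sum_i v i 0 ^+ 2) d1 d2.
rewrite scale1r !scale0r !addr0; apply => t t1; rewrite -sumrB.
under eq_bigr do (rewrite -mulrBr -sumrB; under eq_bigr do rewrite -mulrBr).
by apply: sum_mul_le => i j; apply: He.
Qed.

Lemma taylor_time (s s' : R) x : 0 <= s -> s <= s' -> s' <= T ->
  exists2 c, s <= c <= s' & u s' x - u s x = ut c x * (s' - s).
Proof.
move=> s0 ss' s'T.
have [||c] := @MVT_segment R (u^~ x) (ut^~ x) s s' ss'; last first.
- by rewrite in_itv/= => cs E; exists c.
- apply/subspace_continuousP => r /=; rewrite in_itv/= => /andP[sr rs'].
  have rT : 0 <= r <= T by rewrite (le_trans s0)// (le_trans rs').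
  apply/cvgrPdist_lt => e e0; have [d d0 dP] := ss_u ssu x rT e0.
  rewrite near_withinE; apply/nbhs_ballP; exists d => //.
  move=> y yr; rewrite /= in_itv/= => /andP[sy ys'].
  rewrite distrC; apply: dP; first by rewrite (le_trans s0)// (le_trans ys').
    by rewrite distrC.
  by move=> i; rewrite subrr normr0.
- move=> r; rewrite in_itv/= => /andP[sr rs']; apply: (ss_time ssu).
  by rewrite (le_lt_trans s0)// (lt_le_trans rs').
Qed.

(** The move is made in time at the new point [y], then in space at the old time [s]; both
    derivative errors come from uniform continuity near the box. The accuracy [e / n.+1] for the
    Hessian absorbs the dimension. *)
Lemma taylor_uniform N e : 0 < e -> exists2 r, 0 < r & forall (s s' : R) (x y : 'cV[R]_n),
  0 <= s -> s <= s' -> s' <= T -> (forall i, `|x i 0| <= N) -> s' - s < r ->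
  (forall i, `|y i 0 - x i 0| < r) ->
  `|u s' y - u s x - ut s x * (s' - s) - \sum_i (y i 0 - x i 0) * g i s x
    - 2^-1 * \sum_i (y i 0 - x i 0) * \sum_j (y j 0 - x j 0) * H j i s x|
  <= e * (s' - s + \sum_i (y i 0 - x i 0) ^+ 2).
Proof.
move=> e0; have [r1 r10 r1P] := scont_unif N (ss_ut ssu) e0.
have e1 : 0 < e / n.+1%:R by rewrite divr_gt0.
pose rH (ij : 'I_n * 'I_n) := sval (cid2 (scont_unif N (ss_H ssu ij.1 ij.2) e1)).
pose r2 := \big[Num.min/1]_ij rH ij.
have r20 : 0 < r2 by apply/bigmin_gtP; split => // ij _; rewrite /rH; case: cid2.
exists (Num.min r1 r2) => [|s s' x y s0 ss' s'T xN]; first by rewrite lt_min r10.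
rewrite lt_min => /andP[sr1 sr2] yx.
have sT : 0 <= s <= T by rewrite s0 (le_trans ss').
have [c /andP[sc cs'] E] := taylor_time y s0 ss' s'T.
have cT : 0 <= c <= T by rewrite (le_trans s0)// (le_trans cs').
pose v := y - x; have yE : y = x + v by rewrite addrC subrK.
have vE i : y i 0 - x i 0 = v i 0 by rewrite !mxE.
have /= S1 := @taylor_space s x v (e / n.+1%:R) sT.
rewrite [X in `|X|](_ : _ = (ut c y - ut s x) * (s' - s) +
   (u s (x + v) - u s x - \sum_i v i 0 * g i s x
    - 2^-1 * \sum_i v i 0 * \sum_j v j 0 * H j i s x)); last first.
  rewrite mulrBl -E -yE.
  under eq_bigr do rewrite vE.
  under [in X in _ - _ * X = _]eq_bigr do (rewrite vE; under eq_bigr do rewrite vE).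
  ring.
rewrite [leRHS]mulrDr; apply: le_trans (ler_normD _ _) _; apply: lerD.
  rewrite normrM [X in _ * X]ger0_norm ?subr_ge0// ler_wpM2r ?subr_ge0//.
  apply: r1P => //; first by rewrite ger0_norm ?subr_ge0// (le_lt_trans _ sr1)// lerD2r.
  by move=> i; apply: lt_le_trans (yx i) _; rewrite ge_min lexx.
apply: le_trans (S1 _) _; last first.
  under [in X in _ <= _ * X]eq_bigr do rewrite vE.
  apply: ler_wpM2r; first exact: sum_sqr_ge0.
  by rewrite mulrAC ler_pdivrMr// ler_pM2l// ler_nat.
move=> t t1 i j.
have := svalP (cid2 (scont_unif N (ss_H ssu i j) e1)); rewrite -/(rH (i, j)) => -[rp rP].
apply: rP => //; first by rewrite subrr normr0.
move=> k; rewrite !mxE addrAC subrr add0r normrM.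
apply: (@le_lt_trans _ _ `|v k 0|); first by rewrite -vE ler_piMl.
rewrite -vE; apply: lt_le_trans (yx k) _; rewrite ge_min; apply/orP; right.
exact: (@bigmin_le _ _ _ 1 (i, j)).
Qed.

End smooth_functions.

(** * From the class C12 to smoothness of components on the strip *)

Section C12_functions.
Context (R : realType) (T : R) (n p : nat).

Lemma cvg_entry (m q : nat) (U : Type) (f : U -> 'M[R]_(m, q)) (A : set_system U) (l : 'M[R]_(m, q)) i j :
  f @ A --> l -> (fun u => f u i j) @ A --> l i j.
Proof.
exact: (fun h => cvg_comp f (fun M : 'M[R]_(m, q) => M i j) h (@coord_continuous R m q i j l)).
Qed.

Lemma scont_entry m q (G : R -> 'cV[R]_n -> 'M[R]_(m, q)) i j :
  {within strip T, continuous (fun z => G z.1 z.2)} -> scont T (fun s x => G s x i j).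
Proof.
move=> cG; apply: within_scont; apply/subspace_continuousP => z zT.
have /subspace_continuousP/(_ z zT) h := cG.
exact: cvg_entry h.
Qed.

Lemma C12_strip_smooth (v : R -> 'cV[R]_n -> 'cV[R]_p) k : C12 T v ->
  strip_smooth T (fun s x => v s x k 0) (fun s x => dtime T v s x k 0)
    (fun i s x => jac (v s) x k i) (fun i j s x => hess (fun y => v s y k 0) x i j).
Proof.
move=> [ct dg dh [cv cvt cj ch]]; split.
- exact: scont_entry cv.
- exact: scont_entry cvt.
- by move=> i; apply: scont_entry cj.
- by move=> i j; apply: scont_entry (ch k).
- move=> s x sT; have sT' : 0 <= s <= T by case/andP: sT => /ltW -> /ltW.
  have L : tquot v s x r k 0 @[r --> within `[0, T] s^'] --> dtime T v s x k 0.
    exact: cvg_entry (ct s x sT').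
  apply: is_derive_eps => e e0.
  have /cvgrPdist_lt/(_ e e0) := L.
  rewrite /= near_withinE /dnbhs near_withinE => /nbhs_ballP[r /= r0 rP].
  (* With so small an increment [h + s] stays in [0, T], so the restricted difference quotient is
     the ordinary two-sided one. *)
  exists (Num.min r (Num.min s (T - s))).
    by rewrite !lt_min r0 subr_gt0.
  move=> h h0; rewrite !lt_min => /and3P[hr hs hT].
  have := rP (h + s); rewrite /ball/= opprD addrCA subrr addr0 normrN => /(_ hr).
  rewrite (_ : h + s != s); last by rewrite -subr_eq0 addrK.
  move=> /(_ isT); rewrite in_itv/= => H.
  rewrite distrC; move: H; rewrite /tquot !mxE addrK; apply.
  by move: hs hT; rewrite !ltr_norml; lra.
- by move=> s x i sT; rewrite !mxE; apply: DeriveDef => //; exact: dg.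
- move=> s x i j sT; rewrite !mxE; apply: DeriveDef.
    rewrite (_ : (fun y => _) = (fun y => 'D_(evec j) (fun y' => v s y' k 0) y)).
      exact: dh.
    by apply/funext => y; rewrite !mxE.
  by congr ('D_ _ _ _); apply/funext => y; rewrite !mxE.
Qed.

End C12_functions.

Section uniform_choice.
Context (R : realType) (I : finType) (Q : I -> R -> Prop).

Lemma fin_large : (forall i a b, a <= b -> Q i a -> Q i b) ->
  (forall i, exists a, Q i a) -> exists2 a, 0 < a & forall i, Q i a.
Proof.
move=> mQ hQ; exists (\sum_i `|sval (cid (hQ i))| + 1) => [|i].
  by rewrite ltr_pwDr// sumr_ge0.
apply: mQ (svalP (cid (hQ i))); rewrite (bigD1 i)//= -addrA.
by rewrite (le_trans (ler_norm _))// lerDl addr_ge0// sumr_ge0.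
Qed.

End uniform_choice.

(** * Algebra of quadratic terms over one time step *)

Section step_estimates.
Context (R : realType) (n : nat).
Implicit Types (v M : 'I_n -> R).

Lemma sqr_sum_split v M :
  \sum_i v i ^+ 2 <= 2 * (\sum_i M i ^+ 2) + 2 * \sum_i (v i - M i) ^+ 2.
Proof.
rewrite !mulr_sumr -big_split/=; apply: ler_sum => i _.
by have := sqr_ge0 (v i - M i - M i); nra.
Qed.

(** If [c] dominates then a <= 4c. Otherwise a <= 4b, and a >= r^2 gives a <= a^2 / r^2 <= 16 b^2 /
    r^2. This trades the square of a long increment for a fourth power of its Gaussian part. *)
Lemma large_sqr_bound (r a b c : R) : 0 < r -> 0 <= b -> 0 <= c -> r ^+ 2 <= a ->
  a <= 2 * b + 2 * c -> a <= 16 / r ^+ 2 * b ^+ 2 + 4 * c.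
Proof.
move=> r0 b0 c0 ra abc; have r20 : 0 < r ^+ 2 by rewrite exprn_gt0.
have [bc|cb] := leP b c.
  apply: le_trans (_ : 4 * c <= _); first by lra.
  by rewrite lerDr mulr_ge0 ?sqr_ge0// divr_ge0// sqr_ge0.
apply: le_trans (_ : 16 / r ^+ 2 * b ^+ 2 <= _); last by rewrite lerDl mulr_ge0.
rewrite mulrAC ler_pdivlMr//; nra.
Qed.

(** With d = v - M, the products differ by d_i v_j + d_j M_i. A weighted arithmetic-geometric
    inequality puts the small weight on [v] and [M] and the large one on [d], whose mean square is
    of higher order. *)
Lemma quadratic_step Q e : 0 <= Q -> 0 < e -> exists2 K, 0 <= K &
  forall v M (h : 'I_n -> 'I_n -> R), (forall i j, `|h i j| <= Q) ->
  `|2^-1 * (\sum_i v i * \sum_j v j * h j i) - 2^-1 * \sum_i M i * \sum_j M j * h j i|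
    <= e * (\sum_i v i ^+ 2 + \sum_i M i ^+ 2) + K * \sum_i (v i - M i) ^+ 2.
Proof.
move=> Q0 e0; pose c := e / (Q * n%:R + 1).
have Qn0 : 0 <= Q * n%:R by rewrite mulr_ge0.
have Qn1 : 0 < Q * n%:R + 1 by rewrite ltr_pwDr.
have c0 : 0 < c by rewrite divr_gt0.
have cQ : c * (Q * n%:R) <= e by rewrite /c mulrAC ler_pdivrMr// ler_pM2l// lerDl.
exists (Q * n%:R / c); first by rewrite divr_ge0// ltW.
move=> v M h hQ.
have amgm (a b : R) : `|a * b| <= c * b ^+ 2 + a ^+ 2 / c.
  rewrite normrM -(real_normK (num_real a)) -(real_normK (num_real b)).
  rewrite -(ler_pM2r c0) mulrDl divfK ?gt_eqF//.
  have := sqr_ge0 (`|a| - c * `|b|); have := normr_ge0 a; have := normr_ge0 b; nra.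
pose d i := v i - M i.
have E : 2^-1 * (\sum_i v i * \sum_j v j * h j i) - 2^-1 * (\sum_i M i * \sum_j M j * h j i) =
    2^-1 * \sum_i \sum_j (d i * v j + d j * M i) * h j i.
  rewrite -mulrBr -sumrB; congr (_ * _); apply: eq_bigr => i _.
  rewrite !mulr_sumr -sumrB; apply: eq_bigr => j _; rewrite /d; ring.
rewrite E normrM ger0_norm ?invr_ge0//.
apply: (@le_trans _ _ (2^-1 * (\sum_i \sum_j
   Q * ((c * v j ^+ 2 + d i ^+ 2 / c) + (c * M i ^+ 2 + d j ^+ 2 / c))))).
  rewrite ler_wpM2l ?invr_ge0//.
  apply: le_trans (ler_norm_sum _ _ _) _; apply: ler_sum => i _.
  apply: le_trans (ler_norm_sum _ _ _) _; apply: ler_sum => j _.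
  rewrite normrM mulrC; apply: ler_pM => //.
  by apply: le_trans (ler_normD _ _) _; apply: lerD.
under eq_bigr do (rewrite -mulr_sumr !big_split/= !sumr_const card_ord -mulr_sumr -mulr_suml).
rewrite -mulr_sumr !big_split/= !sumr_const card_ord !sumrMnl -!mulr_sumr -!mulr_suml.
rewrite -/d; set V := \sum_i v i ^+ 2; set W := \sum_i M i ^+ 2.
rewrite (_ : \sum_i (v i - M i) ^+ 2 = \sum_i d i ^+ 2)//; set D := \sum_i d i ^+ 2.
have V0 : 0 <= V by exact: sum_sqr_ge0.
have W0 : 0 <= W by exact: sum_sqr_ge0.
have D0 : 0 <= D / c by rewrite divr_ge0 ?sum_sqr_ge0// ltW.
clearbody V W D.
have -> : Q * n%:R / c * D = Q * n%:R * (D / c) by rewrite mulrAC mulrA.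
rewrite -[(c * V) *+ n]mulr_natr -[(c * W) *+ n]mulr_natr -[(D / c) *+ n]mulr_natr.
have h1 := ler_wpM2r (addr_ge0 V0 W0) cQ.
have h2 := mulr_ge0 (ltW c0) (mulr_ge0 Qn0 (addr_ge0 V0 W0)).
move: h1 h2; move: (D / c) => Dc; clear - Q0; clearbody c.
rewrite (_ : c * (Q * n%:R) * (V + W) = Q * n%:R * c * (V + W)); last by ring.
rewrite (_ : c * (Q * n%:R * (V + W)) = Q * n%:R * c * (V + W)); last by ring.
move=> h1 h2; rewrite (_ : 2^-1 * _ = 2^-1 * (Q * n%:R * c * (V + W)) + Q * n%:R * Dc); last first.
  by field.
rewrite lerD2r; by apply: le_trans h1; rewrite ler_piMl// invf_le1 ?ler1n ?ltr0n.
Qed.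

End step_estimates.

(** * Taylor estimate without restriction on the increment *)

Section bounded_smooth.
Context (R : realType) (T : R) (n : nat).
Variables (u ut : R -> 'cV[R]_n -> R) (g : 'I_n -> R -> 'cV[R]_n -> R).
Variables (H : 'I_n -> 'I_n -> R -> 'cV[R]_n -> R) (ssu : strip_smooth T u ut g H).

Lemma box_bound N : exists2 Q, 0 < Q & forall s (x : 'cV[R]_n), 0 <= s <= T ->
  (forall i, `|x i 0| <= N) ->
  [/\ `|ut s x| <= Q, forall i, `|g i s x| <= Q & forall i j, `|H i j s x| <= Q].
Proof.
have [Q1 Q10 Q1P] := scont_bounded N (ss_ut ssu).
have [Q2 Q20 Q2P] : exists2 a, 0 < a & forall i s (x : 'cV[R]_n), 0 <= s <= T ->
    (forall i, `|x i 0| <= N) -> `|g i s x| <= a.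
  apply: fin_large => [i a b ab h s x sT xN|i]; first exact: le_trans (h s x sT xN) ab.
  by have [a _ aP] := scont_bounded N (ss_g ssu i); exists a.
have [Q3 Q30 Q3P] : exists2 a, 0 < a & forall ij s (x : 'cV[R]_n), 0 <= s <= T ->
    (forall i, `|x i 0| <= N) -> `|H ij.1 ij.2 s x| <= a.
  apply: fin_large => [i a b ab h s x sT xN|i]; first exact: le_trans (h s x sT xN) ab.
  by have [a _ aP] := scont_bounded N (ss_H ssu i.1 i.2); exists a.
exists (Q1 + Q2 + Q3); first by rewrite !addr_gt0.
move=> s x sT xN; split => [|i|i j].
- by have := Q1P s x sT xN; lra.
- by have := Q2P i s x sT xN; lra.
- by have := Q3P (i, j) s x sT xN; rewrite /=; lra.
Qed.

(** [taylor_uniform] covers short increments. For a long one every term is at most a constant times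
    its square [A], which [large_sqr_bound] controls. The vector [M] is free here and becomes the
    Gaussian increment, for which a fourth moment is known. *)
Lemma taylor_step N e C : 0 < e ->
  (forall (s : R) x, 0 <= s <= T -> `|u s x| <= C) ->
  exists2 r, 0 < r & exists2 K, 0 <= K & forall (s s' : R) (x y : 'cV[R]_n) (M : 'I_n -> R),
  0 <= s -> s <= s' -> s' <= T -> (forall i, `|x i 0| <= N) -> s' - s < r ->
  `|u s' y - u s x - ut s x * (s' - s) - \sum_i (y i 0 - x i 0) * g i s x
    - 2^-1 * \sum_i (y i 0 - x i 0) * \sum_j (y j 0 - x j 0) * H j i s x|
  <= e * (s' - s + \sum_i (y i 0 - x i 0) ^+ 2) +
     K * (\sum_i (y i 0 - x i 0 - M i) ^+ 2 + (\sum_i M i ^+ 2) ^+ 2).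
Proof.
move=> e0 uC; have [r r0 rP] := taylor_uniform ssu N e0.
have [Q Q0 QP] := box_bound N.
pose B0 := 2 * `|C| + Q * r + Q * n%:R.
have B00 : 0 <= B0 by rewrite !addr_ge0 ?mulr_ge0// ltW.
(* [B0] collects the terms that do not grow with the increment; A >= r^2 turns it into a multiple of
   [A]. *)
pose K0 := B0 / r ^+ 2 + Q + Q * n%:R.
have Qn0 : 0 <= Q * n%:R by rewrite mulr_ge0// ltW.
have K00 : 0 <= K0 by rewrite /K0; have := divr_ge0 B00 (sqr_ge0 r); lra.
have r16 : 0 <= 16 / r ^+ 2 by rewrite divr_ge0// sqr_ge0.
exists r => //; exists (K0 * (4 + 16 / r ^+ 2)).
  by rewrite mulr_ge0// addr_ge0.
move=> s s' x y M s0 ss' s'T xN sr.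
have sT : 0 <= s <= T by rewrite s0 (le_trans ss').
have s'T' : 0 <= s' <= T by rewrite (le_trans s0).
set Dl := s' - s in sr *; have Dl0 : 0 <= Dl by rewrite subr_ge0.
pose v i := y i 0 - x i 0.
pose A := \sum_i v i ^+ 2; pose b := \sum_i M i ^+ 2; pose c := \sum_i (v i - M i) ^+ 2.
rewrite -/A -/b -/c.
have [A0 b0 c0] : [/\ 0 <= A, 0 <= b & 0 <= c] by split; exact: sum_sqr_ge0.
have r2 : 0 < r ^+ 2 by rewrite exprn_gt0.
have [/forallP yx|] := boolP [forall i, `|y i 0 - x i 0| < r].
  apply: le_trans (rP s s' x y s0 ss' s'T xN sr yx) _.
  by rewrite lerDl (mulr_ge0 (mulr_ge0 K00 _) (addr_ge0 c0 (sqr_ge0 b)))// addr_ge0.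
rewrite negb_forall => /existsP[i0]; rewrite -leNgt -/(v i0) => vr.
have rA : r ^+ 2 <= A.
  rewrite /A (bigD1 i0)//=; apply: le_trans (_ : v i0 ^+ 2 <= _).
    by rewrite -(real_normK (num_real (v i0))) ler_sqr ?nnegrE// ltW.
  by rewrite lerDl; apply: sumr_ge0 => i _; exact: sqr_ge0.
have AB : A <= 16 / r ^+ 2 * b ^+ 2 + 4 * c.
  exact: large_sqr_bound (sqr_sum_split v M).
have [q1 q2 q3] := QP s x sT xN.
have u1 := uC s x sT; have u2 := uC s' y s'T'.
have t1 : `|ut s x * Dl| <= Q * r by rewrite normrM ler_pM// ger0_norm// ltW.
have t2 : `|\sum_i v i * g i s x| <= Q * n%:R + Q * A.
  apply: le_trans (ler_norm_sum _ _ _) _.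
  apply: (@le_trans _ _ (\sum_i (Q + Q * v i ^+ 2))); last first.
    by rewrite big_split/= sumr_const card_ord -mulr_sumr mulr_natr.
  apply: ler_sum => i _; rewrite normrM -(real_normK (num_real (v i))).
  have := q2 i; have := normr_ge0 (g i s x); have := normr_ge0 (v i).
  have := sqr_ge0 (`|v i| - 1); nra.
have t3 : `|2^-1 * \sum_i v i * \sum_j v j * H j i s x| <= Q * n%:R * A.
  rewrite normrM ger0_norm ?invr_ge0//.
  apply: le_trans (sum_mul_le v (h := fun i j => H i j s x) q3).
  by rewrite ler_piMl// invf_le1 ?ler1n ?ltr0n.
have BA : B0 <= B0 / r ^+ 2 * A by rewrite mulrAC ler_pdivlMr// ler_wpM2l.
apply: (@le_trans _ _ (K0 * A)); last first.
  apply: le_trans (_ : K0 * (4 + 16 / r ^+ 2) * (c + b ^+ 2) <= _); last first.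
    by rewrite lerDr (mulr_ge0 (ltW e0) (addr_ge0 Dl0 A0)).
  rewrite -mulrA ler_wpM2l//; apply: le_trans AB _.
  have := mulr_ge0 r16 c0; have := sqr_ge0 b; lra.
apply: (@le_trans _ _ (B0 + Q * A + Q * n%:R * A)); last by rewrite /K0 2!mulrDl !lerD2r.
apply: le_trans (ler_normB _ _) _; apply: lerD t3.
apply: le_trans (ler_normB _ _) _.
have h1 := le_trans (ler_normB (u s' y - u s x) (ut s x * Dl)) (lerD (ler_normB _ _) t1).
apply: le_trans (lerD h1 t2) _; rewrite /B0.
have := le_trans u1 (ler_norm C); have := le_trans u2 (ler_norm C); lra.
Qed.

End bounded_smooth.

(** * Integrals over a time segment *)

Section time_integrals.
Context (R : realType).
Local Notation mu := (@lebesgue_measure R).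

Lemma seg_lty (a b : R) : (mu `[a, b]%classic < +oo)%E.
Proof. by rewrite lebesgue_measure_itv/=; case: ifP => _; rewrite ?ltry// -EFinB ltry. Qed.

Lemma seg_measure (a b : R) : a <= b -> mu `[a, b]%classic = (b - a)%:E.
Proof.
move=> ab; rewrite lebesgue_measure_itv/= lte_fin; case: ltP => // ba.
by rewrite (_ : b = a) ?subrr//; apply/le_anti/andP.
Qed.

Lemma seg_cst (a b k : R) : a <= b -> \int[mu]_(s in `[a, b]) k = k * (b - a).
Proof.
by move=> ab; rewrite Eint_cst//; congr (_ * _); exact: (congr1 fine (seg_measure ab)).
Qed.

Lemma seg_rint_cst (a b k : R) : rintegrable mu `[a, b] (fun=> k).
Proof. by apply: rint_cst => //; exact: seg_lty. Qed.

Lemma seg_rint_bounded (f : R -> R) (a b k : R) : measurable_fun `[a, b] f ->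
  (forall s, a <= s <= b -> `|f s| <= k) -> rintegrable mu `[a, b] f.
Proof.
move=> mf fk; apply: (@rint_bounded _ _ _ _ _ _ _ k) => //; exact: seg_lty.
Qed.

Lemma seg_rint_continuous (f : R -> R) (a b : R) : {within `[a, b], continuous f} ->
  rintegrable mu `[a, b] f.
Proof. by move=> cf; apply: continuous_compact_integrable => //; exact: segment_compact. Qed.

(** The right endpoint is left out of the pointwise bound because the equation holds only before
    time [T]. *)
Lemma seg_le_norm (f g : R -> R) (a b : R) : rintegrable mu `[a, b] f -> rintegrable mu `[a, b] g ->
  (forall s, a <= s < b -> `|f s| <= g s) -> `|\int[mu]_(s in `[a, b]) f s| <= \int[mu]_(s in `[a, b]) g s.
Proof.
move=> fi gi fg; have sub : `[a, b[ `<=` `[a, b] by apply: subset_itv_co_cc.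
have fi' : rintegrable mu `[a, b[ f by apply: rintS fi.
have gi' : rintegrable mu `[a, b[ g by apply: rintS gi.
rewrite -!Rintegral_itv_bndo_bndc//.
apply: le_trans (le_norm_Eint _ fi') _ => //; apply: le_Eint => //; first exact: rint_norm.
Qed.

End time_integrals.

(** * The equation integrated over one step *)

Section generator.
Context (R : realType) (T : R) (n : nat).
Context (u ut : R -> 'cV[R]_n -> R) (g : 'I_n -> R -> 'cV[R]_n -> R).
Context (H : 'I_n -> 'I_n -> R -> 'cV[R]_n -> R) (ssu : strip_smooth T u ut g H).
Context (a : 'I_n -> 'I_n -> R -> 'cV[R]_n -> R) (ca : forall i l, scont T (a i l)).
Local Notation mu := (@lebesgue_measure R).

Definition second_order s (x : 'cV[R]_n) := 2^-1 * \sum_i \sum_l a i l s x * H l i s x.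

Lemma scont_second_order : scont T second_order.
Proof.
apply: scontM; first exact: scont_cst.
by do 2 (apply: scont_sum => ?); apply: scontM => //; exact: (ss_H ssu).
Qed.

(** The equation holds at (s, X s), the Taylor expansion has coefficients at (s0, X s0). Only the
    derivatives of [u] and the second-order term are frozen, since [beta] and [G] are merely
    measurable in time. Where the path has moved by [r] or more, a crude bound times (displacement /
    r)^2 suffices. *)
Lemma generator_step N e Kb CG : 0 < e -> exists2 r, 0 < r & exists2 K, 0 <= K &
  forall (s0 s1 : R) (X : R -> 'cV[R]_n) (beta : 'I_n -> R -> R) (G : R -> R),
  0 <= s0 -> s0 <= s1 -> s1 <= T -> s1 - s0 < r -> (forall i, `|X s0 i 0| <= N) ->
  (forall i, {within `[s0, s1], continuous (fun s => X s i 0)}) ->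
  (forall i, measurable_fun `[s0, s1] (beta i)) ->
  (forall i s, s0 <= s <= s1 -> `|beta i s| <= Kb) ->
  measurable_fun `[s0, s1] G -> (forall s, s0 <= s <= s1 -> `|G s| <= CG) ->
  (forall s, s0 <= s < s1 ->
     ut s (X s) + \sum_i beta i s * g i s (X s) + second_order s (X s) = - G s) ->
  `|ut s0 (X s0) * (s1 - s0) + \sum_i (\int[mu]_(s in `[s0, s1]) beta i s) * g i s0 (X s0)
     + second_order s0 (X s0) * (s1 - s0) + \int[mu]_(s in `[s0, s1]) G s|
  <= e * (s1 - s0) + K * \int[mu]_(s in `[s0, s1]) \sum_i (X s i 0 - X s0 i 0) ^+ 2.
Proof.
move=> e0; pose e' := e / (2 + n%:R * `|Kb|).
have d0 : 0 < 2 + n%:R * `|Kb| by rewrite ltr_pwDl// mulr_ge0.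
have e'0 : 0 < e' by rewrite divr_gt0.
have [r1 r10 r1P] := scont_unif N (ss_ut ssu) e'0.
have [r2 r20 r2P] := scont_unif N scont_second_order e'0.
pose rg i := sval (cid2 (scont_unif N (ss_g ssu i) e'0)).
pose r3 := \big[Num.min/1]_i rg i.
have r30 : 0 < r3 by apply/bigmin_gtP; split => // i _; rewrite /rg; case: cid2.
have [Q1 Q10 Q1P] := box_bound ssu N.
have [Q2 Q20 Q2P] := scont_bounded N scont_second_order.
pose r := Num.min r1 (Num.min r2 r3).
have r0 : 0 < r by rewrite !lt_min r10 r20.
pose Q := Q1 + n%:R * (`|Kb| * Q1) + Q2 + `|CG|.
have Q0 : 0 <= Q by rewrite !addr_ge0 ?mulr_ge0// ltW.
have r2' : 0 < r ^+ 2 by rewrite exprn_gt0.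
exists r => //; exists (Q / r ^+ 2); first by rewrite divr_ge0// ltW.
move=> s0 s1 X beta G s00 s01 s1T sr XN cX mb bK mG GC pde.
have s0T : 0 <= s0 <= T by rewrite s00 (le_trans s01).
pose sq s := \sum_i (X s i 0 - X s0 i 0) ^+ 2.
have ib i : rintegrable mu `[s0, s1] (beta i) by apply: seg_rint_bounded (mb i) (bK i).
have iG : rintegrable mu `[s0, s1] G by exact: seg_rint_bounded mG GC.
have isq : rintegrable mu `[s0, s1] sq.
  apply: rint_sum => // i _; apply: seg_rint_continuous.
  rewrite (_ : (fun s => _) = (fun s => (X s i 0 - X s0 i 0) * (X s i 0 - X s0 i 0)))// => s.
  by apply: cvgM; apply: cvgB; [exact: cX|exact: cvg_cst|exact: cX|exact: cvg_cst].
pose c := ut s0 (X s0) + second_order s0 (X s0).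
pose th s := c + \sum_i beta i s * g i s0 (X s0) + G s.
have ibg : rintegrable mu `[s0, s1] (fun s => \sum_i beta i s * g i s0 (X s0)).
  by apply: rint_sum => // i _; exact: rintZr.
have ith : rintegrable mu `[s0, s1] th.
  by do 2 (apply: rintD => //); exact: seg_rint_cst.
have E : ut s0 (X s0) * (s1 - s0) + \sum_i (\int[mu]_(s in `[s0, s1]) beta i s) * g i s0 (X s0)
     + second_order s0 (X s0) * (s1 - s0) + \int[mu]_(s in `[s0, s1]) G s =
    \int[mu]_(s in `[s0, s1]) th s.
  rewrite EintD//; last by apply: rintD => //; exact: seg_rint_cst.
  rewrite EintD//; last exact: seg_rint_cst.
  rewrite seg_cst// Eint_sum//; last by move=> i _; exact: rintZr.
  under [in RHS]eq_bigr do rewrite EintZr//.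
  by rewrite /c mulrDl; ring.
rewrite E.
have ik : rintegrable mu `[s0, s1] (fun s => e + Q / r ^+ 2 * sq s).
  by apply: rintD => //; [exact: seg_rint_cst|exact: rintZ].
apply: le_trans (seg_le_norm ith ik _) _; last first.
  by rewrite EintD// ?seg_cst ?EintZ//; [exact: seg_rint_cst|exact: rintZ].
move=> s /andP[s0s ss1].
have sT : 0 <= s <= T by rewrite (le_trans s00)//= (le_trans (ltW ss1)).
have ss : s0 <= s <= s1 by rewrite s0s ltW.
have sq0 : 0 <= sq s by exact: sum_sqr_ge0.
have ssr : `|s - s0| < r by rewrite ger0_norm ?subr_ge0// (le_lt_trans _ sr)// lerD2r ltW.
have [/forallP yx|] := boolP [forall i, `|X s i 0 - X s0 i 0| < r].
  apply: (@le_trans _ _ e); last by rewrite lerDl mulr_ge0// divr_ge0// ltW.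
  (* The equation at time [s] eliminates [G s], leaving only differences of continuous functions.
     They add up to e' (2 + n |Kb|), which is [e]. *)
  have -> : th s = (ut s0 (X s0) - ut s (X s)) + (\sum_i beta i s * (g i s0 (X s0) - g i s (X s)))
      + (second_order s0 (X s0) - second_order s (X s)).
    rewrite /th /c; have -> : G s = - (ut s (X s) + \sum_i beta i s * g i s (X s) + second_order s (X s)).
      by rewrite (pde s) ?opprK// s0s.
    under [in RHS]eq_bigr do rewrite mulrBr.
    by rewrite sumrB; ring.
  have b1 : `|ut s0 (X s0) - ut s (X s)| <= e'.
    rewrite distrC; apply: r1P => // [|i]; first by apply: lt_le_trans ssr _; rewrite ge_min lexx.
    by apply: lt_le_trans (yx i) _; rewrite ge_min lexx.
  have b2 : `|second_order s0 (X s0) - second_order s (X s)| <= e'.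
    rewrite distrC; apply: r2P => // [|i].
      by apply: lt_le_trans ssr _; rewrite /r !ge_min lexx orbT.
    by apply: lt_le_trans (yx i) _; rewrite !ge_min lexx orbT.
  have b3 : `|\sum_i beta i s * (g i s0 (X s0) - g i s (X s))| <= n%:R * `|Kb| * e'.
    apply: le_trans (ler_norm_sum _ _ _) _.
    apply: (@le_trans _ _ (\sum_(i < n) `|Kb| * e')); last first.
      by rewrite sumr_const card_ord -mulrA mulr_natl.
    apply: ler_sum => i _; rewrite normrM; apply: ler_pM => //.
      by apply: le_trans (bK i s ss) (ler_norm _).
    have := svalP (cid2 (scont_unif N (ss_g ssu i) e'0)); rewrite -/(rg i) => -[rp rP].
    have r3i : r <= rg i.
      by rewrite /r !ge_min; do 2 (apply/orP; right); exact: (@bigmin_le _ _ _ 1 i).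
    rewrite distrC; apply: rP => // [|j]; first exact: lt_le_trans ssr r3i.
    exact: lt_le_trans (yx j) r3i.
  have ee : e = e' * (2 + n%:R * `|Kb|) by rewrite /e' divfK// gt_eqF.
  apply: le_trans (ler_normD _ _) _; apply: le_trans (lerD (ler_normD _ _) b2) _.
  by apply: le_trans (lerD (lerD b1 b3) (lexx e')) _; rewrite ee; lra.
rewrite negb_forall => /existsP[i0]; rewrite -leNgt => vr.
have rA : r ^+ 2 <= sq s.
  rewrite /sq (bigD1 i0)//=; apply: le_trans (_ : (X s i0 0 - X s0 i0 0) ^+ 2 <= _).
    by rewrite -(real_normK (num_real (X s i0 0 - _))) ler_sqr ?nnegrE// ltW.
  by rewrite lerDl; apply: sumr_ge0 => i _; exact: sqr_ge0.
apply: (@le_trans _ _ (Q / r ^+ 2 * sq s)); last by rewrite lerDr ltW.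
apply: (@le_trans _ _ Q); last by rewrite mulrAC ler_pdivlMr// ler_wpM2l.
have [q1 q2 _] := Q1P s0 (X s0) s0T XN; have q3 := Q2P s0 (X s0) s0T XN.
have q4 := le_trans (GC s ss) (ler_norm CG).
have q5 : `|\sum_i beta i s * g i s0 (X s0)| <= n%:R * (`|Kb| * Q1).
  apply: le_trans (ler_norm_sum _ _ _) _.
  apply: (@le_trans _ _ (\sum_(i < n) `|Kb| * Q1)); last first.
    by rewrite sumr_const card_ord mulr_natl.
  apply: ler_sum => i _; rewrite normrM; apply: ler_pM => //.
  by apply: le_trans (bK i s ss) (ler_norm _).
rewrite /th /c /Q.
apply: le_trans (ler_normD _ _) (lerD _ q4).
apply: le_trans (ler_normD _ _) _; rewrite addrAC; apply: lerD q5.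
exact: le_trans (ler_normD _ _) (lerD q1 q3).
Qed.

End generator.

(** * Tonelli and Fubini on a strip *)

Section strip_integrals.
Context d1 d2 (T1 : measurableType d1) (T2 : measurableType d2) (R : realType).
Context (m1 : {sigma_finite_measure set T1 -> \bar R}).
Context (m2 : {sigma_finite_measure set T2 -> \bar R}).
Context (D : set T1) (mD : measurable D) (f : T1 * T2 -> R).
Local Notation DT := (D `*` [set: T2]).

Let mDT : measurable DT. Proof. exact: measurableX. Qed.

Let restrict_left x y : ((EFin \o f) \_ DT) (x, y) = ((fun x => (f (x, y))%:E) \_ D) x.
Proof. by rewrite !patchE in_setX in_setT andbT. Qed.

Lemma strip_tonelli k : measurable_fun DT f -> (forall p, DT p -> 0 <= f p) ->
  (m1 D < +oo)%E -> (forall x, D x -> (\int[m2]_y (f (x, y))%:E <= k%:E)%E) ->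
  rintegrable (m1 \x m2)%E DT f /\ \int[(m1 \x m2)%E]_(p in DT) f p <= k * fine (m1 D).
Proof.
move=> mf f0 Dfin fk.
have mg : measurable_fun setT ((EFin \o f) \_ DT).
  by apply/(measurable_restrictT _ mDT)/measurable_EFinP.
have g0 p : (0 <= ((EFin \o f) \_ DT) p)%E.
  by apply: erestrict_ge0 => q qD; rewrite lee_fin f0.
have le : (\int[(m1 \x m2)%E]_(p in DT) (f p)%:E <= (k * fine (m1 D))%:E)%E.
  rewrite integral_mkcond fubini_tonelli1//.
  rewrite EFinM fineK ?ge0_fin_numE// -integral_cst// [leRHS]integral_mkcond.
  apply: ge0_le_integral => //.
  - by move=> x _; apply: integral_ge0 => y _.
  - exact: measurable_fun_fubini_tonelli_F.
  - by apply/(measurable_restrictT _ mD).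
  move=> x _; rewrite patchE; case: ifPn => [/set_mem Dx|xD].
    rewrite /fubini_F; apply: le_trans (fk x Dx); rewrite le_eqVlt; apply/orP; left.
    by apply/eqP/eq_integral => y _; rewrite restrict_left patchE mem_set.
  rewrite /fubini_F integral0_eq// => y _.
  by rewrite restrict_left patchE (negbTE xD).
have fi : rintegrable (m1 \x m2)%E DT f.
  by apply: rint_ge0 => //; exact: le_lt_trans le (ltry _).
by split => //; rewrite -lee_fin -Eint_EFin.
Qed.

Lemma strip_measurable : rintegrable (m1 \x m2)%E DT f ->
  (forall y, rintegrable m1 D (fun x => f (x, y))) ->
  measurable_fun setT (fun y => \int[m1]_(x in D) f (x, y)) /\
  (\int[m2]_y (\int[m1]_(x in D) f (x, y))%:E = \int[(m1 \x m2)%E]_(p in DT) (f p)%:E)%E.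
Proof.
move=> fi fy; have gi : (m1 \x m2)%E.-integrable setT ((EFin \o f) \_ DT).
  exact: (integrable_mkcond _ mDT).1.
have E : fubini_G m1 ((EFin \o f) \_ DT) = EFin \o (fun y => \int[m1]_(x in D) f (x, y)).
  apply/funext => y; rewrite /= -Eint_EFin// [RHS]integral_mkcond; apply: eq_integral => x _.
  by rewrite restrict_left.
split; first by apply/measurable_EFinP; rewrite -[X in measurable_fun _ X]E; exact: (measurable_fubini_G gi).
rewrite [RHS]integral_mkcond -(integral21_prod_meas1 gi).
by rewrite -/(fubini_G _ _) E.
Qed.

Lemma strip_fubini : rintegrable (m1 \x m2)%E DT f -> (forall p, DT p -> 0 <= f p) ->
  (forall y, rintegrable m1 D (fun x => f (x, y))) ->
  rintegrable m2 setT (fun y => \int[m1]_(x in D) f (x, y)) /\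
  \int[m2]_y \int[m1]_(x in D) f (x, y) = \int[(m1 \x m2)%E]_(p in DT) f p.
Proof.
move=> fi f0 fy; have [mg E] := strip_measurable fi fy.
split; last by rewrite /Rintegral -E.
apply: rint_ge0 => //; first by move=> y _; apply: Rintegral_ge0 => x Dx; exact: f0.
by rewrite E Eint_EFin// ltry.
Qed.

End strip_integrals.

(** * Almost sure equality *)

Section almost_everywhere.
Context d (Omega : measurableType d) (R : realType) (P : probability Omega R).
Local Notation rint := (rintegrable P setT).

Lemma ae_Eint (f g : Omega -> R) : {ae P, forall w, f w = g w} ->
  \int[P]_w f w = \int[P]_w g w.
Proof.
move=> [N [mN N0 fg]]; rewrite /Rintegral; congr fine.
apply: (integral_off_null mN N0) => w _ wN; congr EFin; apply: contrapT => fgw.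
exact/wN/fg.
Qed.

Lemma ae_rint (f g : Omega -> R) : measurable_fun setT f -> {ae P, forall w, f w = g w} ->
  rint g -> rint f.
Proof.
move=> mf [N [mN N0 fg]] /integrableP[_ gi]; apply/integrableP; split; first exact/measurable_EFinP.
rewrite (_ : (\int[P]_w _ = \int[P]_w `|(EFin \o g) w|)%E)//.
apply: (integral_off_null mN N0) => w _ wN; congr (`|EFin _|)%E; apply: contrapT => fgw.
exact/wN/fg.
Qed.

End almost_everywhere.

(** The hypothesis is Hölder regularity of order 1/2 in time and Lipschitz regularity in space, both
    squared, because squares are what the isometry integrates. *)
Lemma holder_scont (R : realType) (T : R) (n : nat) (f : R -> 'cV[R]_n -> R) L :
  (forall (s s' : R) y y', 0 <= s <= T -> 0 <= s' <= T ->
    (f s y - f s' y') ^+ 2 <= L * (`|s - s'| + \sum_k (y k 0 - y' k 0) ^+ 2)) ->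
  scont T f.
Proof.
move=> hf s y sT e e0.
pose k := (`|L| + 1) * n.+1%:R; have k0 : 0 < k by rewrite mulr_gt0// ltr_pwDr.
have e2 : 0 < e ^+ 2 by rewrite exprn_gt0.
exists (Num.min 1 (e ^+ 2 / k)); first by rewrite lt_min ltr01 divr_gt0.
set r := Num.min _ _; have r0 : 0 < r by rewrite lt_min ltr01 divr_gt0.
have r1 : r <= 1 by rewrite ge_min lexx.
have rk : k * r <= e ^+ 2 by rewrite mulrC -ler_pdivlMr// ge_min lexx orbT.
move=> s' y' s'T s's y'y.
have h := hf s' s y' y s'T sT.
have S : \sum_k (y' k 0 - y k 0) ^+ 2 <= n%:R * r.
  rewrite mulr_natl -[X in _ *+ X](card_ord n) -sumr_const; apply: ler_sum => l _.
  rewrite -(real_normK (num_real (_ - _))) expr2.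
  have := y'y l; have := normr_ge0 (y' l 0 - y l 0); nra.
have : (f s' y' - f s y) ^+ 2 < e ^+ 2.
  apply: le_lt_trans h _; apply: lt_le_trans rk.
  have S0 : 0 <= `|s' - s| + \sum_k (y' k 0 - y k 0) ^+ 2 by rewrite addr_ge0// sum_sqr_ge0.
  apply: (@le_lt_trans _ _ (`|L| * (n.+1%:R * r))).
    apply: le_trans (ler_wpM2r S0 (ler_norm L)) _; rewrite ler_wpM2l//.
    by rewrite -natr1 mulrDl mul1r addrC lerD// ltW.
  by rewrite /k -mulrA ltr_pM2r ?mulr_gt0// ltrDl.
rewrite -(real_normK (num_real (_ - _))) ltr_sqr ?nnegrE//; exact: ltW.
Qed.

Lemma ge0_subset_Eint d (T : measurableType d) (R : realType) (mu : {measure set T -> \bar R})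
    (D E : set T) (f : T -> R) : measurable D -> measurable E -> D `<=` E ->
  rintegrable mu E f -> (forall x, E x -> 0 <= f x) ->
  \int[mu]_(x in D) f x <= \int[mu]_(x in E) f x.
Proof.
move=> mD mE DE fi f0; rewrite -lee_fin -!Eint_EFin//; last exact: rintS fi.
by apply: ge0_subset_integral => //; exact: measurable_int fi.
Qed.

(** * Itô processes with bounded drift and their increments *)

Section ito_process.
Context d (Omega : measurableType d) (R : realType) (P : probability Omega R).
Context (T : R) (F : R -> set (set Omega)) (hF : filtration P T F).
Context (d0 : nat) (B : R -> Omega -> 'cV[R]_d0) (hB : brownian_motion P T F B).
Context (n : nat) (t : R) (x : 'cV[R]_n) (X : R -> Omega -> 'cV[R]_n).
Context (sg : R -> 'cV[R]_n -> 'M[R]_(n, d0)) (beta : 'I_n -> R -> Omega -> R).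
Context (Kb Ks Ls : R).
Local Notation rint := (rintegrable P setT).
Local Notation mu := (@lebesgue_measure R).
Local Notation M := (@lebesgue_measure R \x P)%E.
Local Notation D a b := (`[a, b]%classic `*` [set: Omega] : set (measurableTypeR R * Omega)).

(** Continuity and the initial value are required for every outcome, which a modification on a null
    set provides. The drift is an arbitrary bounded jointly measurable process, so that the
    compensator, which need not be continuous in time, can be part of it. *)
Record ito_process : Prop := {
  ip_start : 0 <= t <= T;
  ip_adapted : forall s i, t <= s <= T -> Fmeas (F s) (fun w => X s w i 0);
  ip_cont : forall w i, {within `[t, T], continuous (fun s => X s w i 0)};
  ip_init : forall w, X t w = x;
  ip_drift_meas : forall i, measurable_fun (D t T) (fun p => beta i p.1 p.2);
  ip_drift : forall i s w, t <= s <= T -> `|beta i s w| <= Kb;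
  ip_diffusion : forall (s : R) y i j, 0 <= s <= T -> `|sg s y i j| <= Ks;
  ip_diffusion_lip : forall (s s' : R) y y' i j, 0 <= s <= T -> 0 <= s' <= T ->
    (sg s y i j - sg s' y' i j) ^+ 2 <= Ls * (`|s - s'| + \sum_k (y k 0 - y' k 0) ^+ 2);
  ip_sde : forall r : R, t <= r <= T ->
    exists2 I, ito_integral P F B t r (fun s w => sg s (X s w)) I &
      {ae P, forall w, forall i,
        X r w i 0 = x i 0 + \int[mu]_(s in `[t, r]) beta i s w + I w i 0} }.

Hypothesis ip : ito_process.

Let t0 : 0 <= t. Proof. by have /andP[] := ip_start ip. Qed.

Lemma scont_diffusion i j : scont T (fun s y => sg s y i j).
Proof.
by apply: holder_scont => s s' y y' sT s'T; exact: (@ip_diffusion_lip ip).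
Qed.

Lemma Fmeas_comp s (phi : 'cV[R]_n -> R) : t <= s <= T -> continuous phi ->
  Fmeas (F s) (fun w => phi (X s w)).
Proof.
move=> sT cphi.
have mX : measurable_fun [set: g_sigma_algebraType (F s)] (X s : _ -> borel 'cV[R]_n).
  by apply: measurable_fun_borel => i j; rewrite (ord1 j); exact: (@ip_adapted ip).
exact: (measurableT_comp (borel_continuous_measurable cphi) mX).
Qed.

Lemma path_continuous phi w : scont T phi -> {within `[t, T], continuous (fun s => phi s (X s w))}.
Proof.
move=> cphi; apply/subspace_continuousP => s /=; rewrite in_itv/= => /andP[ts sT].
have s0T : 0 <= s <= T by rewrite (le_trans t0).
apply/cvgrPdist_lt => e e0; have [r r0 rP] := cphi s (X s w) s0T e e0.
have [q q0 qP] : exists2 q, 0 < q & forall s', t <= s' <= T -> `|s - s'| < q ->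
    forall i, `|X s' w i 0 - X s w i 0| < r.
  have hq i : exists2 q, 0 < q & forall s', t <= s' <= T -> `|s - s'| < q ->
      `|X s' w i 0 - X s w i 0| < r.
    have /subspace_continuousP/(_ s) := @ip_cont ip w i.
    rewrite /= in_itv/= ts sT => /(_ isT)/cvgrPdist_lt/(_ r r0).
    rewrite near_withinE => /nbhs_ballP[q /= q0 qP]; exists q => // s' s'T ss'.
    by rewrite distrC; apply: qP => //; rewrite /= in_itv.
  pose q i := sval (cid2 (hq i)).
  exists (\big[Num.min/1]_i q i) => [|s' s'T ss' i].
    by apply/bigmin_gtP; split => // i _; rewrite /q; case: cid2.
  have := svalP (cid2 (hq i)); rewrite -/(q i) => -[_]; apply => //.
  by apply: lt_le_trans ss' _; exact: (@bigmin_le _ _ _ 1 i).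
rewrite near_withinE; apply/nbhs_ballP; exists (Num.min q r); first by rewrite /= lt_min q0.
move=> s' /=; rewrite /ball/= lt_min => /andP[sq sr]; rewrite in_itv/= => s'T.
rewrite distrC; apply: rP; last exact: qP.
  by case/andP: s'T => ts' ->; rewrite (le_trans t0).
by rewrite distrC.
Qed.

Lemma measurable_along phi : scont T phi ->
  measurable_fun (D t T) (fun p => phi p.1 (X p.1 p.2)).
Proof.
move=> cphi; apply: (@caratheodory_measurable _ _ _ _ _ _ (fun s w => phi s (X s w))) => // [s sT|w _].
  have s0T : 0 <= s <= T by case/andP: sT => ts ->; rewrite (le_trans t0).
  exact: (Fmeas_measurable hF s0T (Fmeas_comp sT (scont_section s0T cphi))).
exact: path_continuous.
Qed.

Lemma scont_coord i : scont T (fun _ (y : 'cV[R]_n) => y i 0).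
Proof. by move=> s y _ e e0; exists e => // s' y' _ _; exact. Qed.

Lemma measurable_section (a b : R) (f : R * Omega -> R) w : measurable_fun (D a b) f ->
  measurable_fun `[a, b] (fun s => f (s, w)).
Proof.
move=> mf; apply: (measurable_comp (measurable_strip a b) _ mf).
  by move=> _ [s /= sab <-].
by apply: measurable_funTS; apply: measurable_fun_pair.
Qed.

Lemma strip_lty (a b : R) : (M (D a b) < +oo)%E.
Proof.
rewrite product_measure1E//; apply: lte_mul_pinfty => //; last exact: prob_lty.
by rewrite ge0_fin_numE//; exact: seg_lty.
Qed.

Lemma strip_measureE (A : set (measurableTypeR R)) : measurable A ->
  (M (A `*` [set: Omega]) = mu A)%E.
Proof.
move=> mA; rewrite product_measure1E//; transitivity (mu A * 1%:E)%E; last by rewrite mule1.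
by congr (_ * _)%E; exact: probability_setT.
Qed.

Lemma strip_measure (a b : R) : a <= b ->
  (M (`]a, b]%classic `*` setT : set (measurableTypeR R * Omega)) = (b - a)%:E)%E.
Proof.
move=> ab; rewrite strip_measureE//; transitivity (@lebesgue_measure R `]a, b]%classic) => //.
rewrite lebesgue_measure_itv/= lte_fin; case: ltP => // ba.
by rewrite (_ : b = a) ?subrr//; apply/le_anti/andP.
Qed.

Section increment.
Context (s0 s1 : R) (ts0 : t <= s0) (s01 : s0 <= s1) (s1T : s1 <= T).
Local Notation Dl := (s1 - s0).

Let s00 : 0 <= s0. Proof. exact: le_trans ts0. Qed.
Let s0T : s0 <= T. Proof. exact: le_trans s1T. Qed.
Let s0T' : 0 <= s0 <= T. Proof. by rewrite s00. Qed.
Let ts1 : t <= s1. Proof. exact: le_trans s01. Qed.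
Let Dl0 : 0 <= Dl. Proof. by rewrite subr_ge0. Qed.

Definition drift_incr i w := \int[mu]_(s in `[s0, s1]) beta i s w.
Definition gauss_incr i w := \sum_j sg s0 (X s0 w) i j * (B s1 w j 0 - B s0 w j 0).
Definition path_incr i w := X s1 w i 0 - X s0 w i 0.

Let sub (a b : R) : t <= a -> b <= T -> D a b `<=` D t T.
Proof.
move=> ta bT [s w] [/= + _]; rewrite !in_itv/= => /andP[as_ sb]; split => //=.
by rewrite (le_trans ta as_) (le_trans sb bT).
Qed.

Lemma drift_section i w a b : t <= a -> b <= T -> rintegrable mu `[a, b] (fun s => beta i s w).
Proof.
move=> ta bT; apply: (@seg_rint_bounded _ _ _ _ Kb); last first.
  by move=> s /andP[as_ sb]; apply: (ip_drift ip); rewrite (le_trans ta as_) (le_trans sb bT).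
apply: (measurable_section (f := fun p => beta i p.1 p.2)).
exact: (measurable_funS (measurable_strip t T) (sub ta bT) (@ip_drift_meas ip i)).
Qed.

Lemma drift_incr_bound i w : `|drift_incr i w| <= Kb * Dl.
Proof.
rewrite -(seg_cst Kb s01); apply: seg_le_norm; first exact: drift_section.
  exact: seg_rint_cst.
move=> s /andP[s0s ss1]; apply: (@ip_drift ip).
by rewrite (le_trans ts0 s0s) (le_trans (ltW ss1) s1T).
Qed.

Lemma measurable_drift_incr i : measurable_fun setT (drift_incr i).
Proof.
have mD := measurable_strip (Omega := Omega) s0 s1.
have h := measurable_funS (measurable_strip t T) (sub ts0 s1T) (@ip_drift_meas ip i).
have fi : rintegrable M (D s0 s1) (fun p => beta i p.1 p.2).
  apply: (@rint_bounded _ _ _ _ _ _ _ Kb) => //; first exact: strip_lty.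
  move=> [s w] [/= + _]; rewrite in_itv/= => /andP[s0s ss1]; apply: (@ip_drift ip).
  by rewrite (le_trans ts0 s0s) (le_trans ss1 s1T).
have mI : measurable (`[s0, s1]%classic : set (measurableTypeR R)) by [].
by have [] := strip_measurable mI fi (fun w => drift_section i w ts0 s1T).
Qed.

(** [J] is the difference of versions of the integral up to [s1] and up to [s0]. They are chosen
    separately, so the path increment splits only almost surely. Both moment estimates are instances
    of [ito_incr_L2]: comparison with 0, then with the coefficient frozen at [s0]. *)
Lemma ito_increment : exists J : 'I_n -> Omega -> R, [/\
  forall i, measurable_fun setT (J i),
  {ae P, forall w, forall i, path_incr i w = drift_incr i w + J i w},
  forall i Z K, Fmeas (F s0) Z -> (forall w, `|Z w| <= K) -> \int[P]_w (Z w * J i w) = 0,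
  forall i, rint (fun w => J i w ^+ 2) /\ \int[P]_w (J i w ^+ 2) <= 6 * (d0%:R * Ks ^+ 2 * Dl) &
  forall i, [/\ rint (fun w => (J i w - gauss_incr i w) ^+ 2),
    rintegrable M (`]s0, s1]%classic `*` setT)
      (fun p => \sum_j (sg p.1 (X p.1 p.2) i j - sg s0 (X s0 p.2) i j) ^+ 2) &
    \int[P]_w ((J i w - gauss_incr i w) ^+ 2) <=
      6 * \int[M]_(p in `]s0, s1]%classic `*` setT)
            \sum_j (sg p.1 (X p.1 p.2) i j - sg s0 (X s0 p.2) i j) ^+ 2]].
Proof.
have [|I0 hI0 ae0] := @ip_sde ip s0; first by rewrite ts0.
have [|I1 hI1 ae1] := @ip_sde ip s1; first by rewrite ts1.
exists (fun i w => I1 w i 0 - I0 w i 0); split.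
- have mI r (I : Omega -> 'cV[R]_n) : ito_integral P F B t r (fun s w => sg s (X s w)) I ->
      forall i, measurable_fun setT (fun w => I w i 0).
    by move=> [_ mI _] i _ U mU; rewrite setTI; exact: mI.
  by move=> i; apply: measurable_funB; [exact: mI hI1 i|exact: mI hI0 i].
- apply: filterS2 ae0 ae1 => w e0 e1 i; rewrite /path_incr e0 e1 /drift_incr.
  have := @Rintegral_itvB R (fun s => beta i s w) (BLeft t) (BRight s1) s0.
  have bi := @drift_section i w t s1 (lexx t) s1T.
  move=> /(_ bi); rewrite !bnd_simp => /(_ ts0 s01).
  rewrite Rintegral_itv_obnd_cbnd; last first.
    by apply: rintS bi => //; apply: subset_itvr; rewrite bnd_simp.
  by move=> <-; ring.
- by move=> i Z K FZ ZK; exact: (ito_incr_mean hF hB i t0 ts0 s01 s1T hI0 hI1 FZ ZK).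
- move=> i.
  (* With zero comparison integrand the estimate is a bound on the second moment of [J]. *)
  pose V0 (j : 'I_d0) (w : Omega) : R := 0.
  have FV j : Fmeas (F s0) (V0 j) by exact: measurable_cst.
  have VK j w : `|V0 j w| <= 0 by rewrite normr0.
  have [j1 j2 j3] := ito_incr_L2 hF hB i t0 ts0 s01 s1T hI0 hI1 FV VK.
  have E : (fun w => (I1 w i 0 - I0 w i 0) ^+ 2) =
     (fun w => (I1 w i 0 - I0 w i 0 - \sum_j V0 j w * (B s1 w j 0 - B s0 w j 0)) ^+ 2).
    by apply/funext => w; rewrite big1 ?subr0// => j _; rewrite mul0r.
  rewrite E; split => //; apply: le_trans j3 _; rewrite ler_pM2l//.
  have <- : fine (M (`]s0, s1]%classic `*` setT : set (measurableTypeR R * Omega))) = Dl.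
    by rewrite strip_measure.
  have mD' : measurable (`]s0, s1]%classic `*` setT : set (measurableTypeR R * Omega)).
    exact: measurableX.
  rewrite -Eint_cst//; apply: le_Eint => //.
    by apply: rint_cst => //; apply: le_lt_trans (ltry Dl); rewrite -(strip_measure s01).
  move=> [s w] [/= + _]; rewrite in_itv/= => /andP[s0s ss1].
  rewrite mulr_natl -[X in _ *+ X](card_ord d0) -sumr_const; apply: ler_sum => j _.
  rewrite subr0 -(real_normK (num_real (sg _ _ _ _))).
  have := @ip_diffusion ip s (X s w) i j; have := normr_ge0 (sg s (X s w) i j).
  rewrite (le_trans s00 (ltW s0s)) (le_trans ss1 s1T) => h0 /(_ isT) h1; nra.
move=> i; pose V j w := sg s0 (X s0 w) i j.
have FV j : Fmeas (F s0) (V j).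
  by apply: (@Fmeas_comp s0 (fun y => sg s0 y i j)); [rewrite ts0|exact: scont_section (scont_diffusion i j)].
have VK j w : `|V j w| <= Ks by exact: (@ip_diffusion ip).
exact: (ito_incr_L2 hF hB i t0 ts0 s01 s1T hI0 hI1 FV VK).
Qed.

End increment.
Let T0 : 0 <= T. Proof. by have /andP[] := ip_start ip; exact: le_trans. Qed.

(** From (drift + J)^2 <= 2 drift^2 + 2 J^2: the drift part Kb^2 Dl^2 is at most Kb^2 T Dl, and 12 =
    2 * 6 with the 6 of [ito_incr_L2]. *)
Definition path_const := 2 * Kb ^+ 2 * T + 12 * (d0%:R * Ks ^+ 2).

Lemma path_const_ge0 : 0 <= path_const.
Proof. by rewrite addr_ge0// mulr_ge0// mulr_ge0// sqr_ge0. Qed.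

Lemma measurable_coord s i : t <= s <= T -> measurable_fun setT (fun w => X s w i 0).
Proof.
move=> /andP[ts sT]; have [_ h _ _ _ _ _ _ _] := ip.
by apply: (Fmeas_measurable hF _ (h s i _)); rewrite ?ts// (le_trans t0).
Qed.

Lemma measurable_path_incr s0 s1 i : t <= s0 -> s0 <= s1 -> s1 <= T ->
  measurable_fun setT (path_incr s0 s1 i).
Proof.
move=> ts0 s01 s1T; apply: measurable_funB; apply: measurable_coord.
  by rewrite s1T (le_trans ts0).
by rewrite ts0 (le_trans s01).
Qed.

Lemma path_moment s0 s1 i : t <= s0 -> s0 <= s1 -> s1 <= T ->
  rint (fun w => path_incr s0 s1 i w ^+ 2) /\
  \int[P]_w (path_incr s0 s1 i w ^+ 2) <= path_const * (s1 - s0).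
Proof.
move=> ts0 s01 s1T; have [J [mJ aeJ _ J2 _]] := ito_increment ts0 s01 s1T.
have [rJ EJ] := J2 i.
have mp := measurable_path_incr i ts0 s01 s1T.
have mD := measurable_drift_incr ts0 s1T i.
have bD w := drift_incr_bound ts0 s01 s1T i w.
set Dl := s1 - s0 in bD EJ *; have Dl0 : 0 <= Dl by rewrite subr_ge0.
have ae2 : {ae P, forall w, path_incr s0 s1 i w ^+ 2 = (drift_incr s0 s1 i w + J i w) ^+ 2}.
  by apply: filterS aeJ => w ->.
have le w : (drift_incr s0 s1 i w + J i w) ^+ 2 <= 2 * Kb ^+ 2 * Dl ^+ 2 + 2 * J i w ^+ 2.
  have := bD w; have := sqr_ge0 (drift_incr s0 s1 i w - J i w).
  rewrite ler_norml => h1 /andP[h2 h3].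
  have : drift_incr s0 s1 i w ^+ 2 <= Kb ^+ 2 * Dl ^+ 2 by rewrite -exprMn; nra.
  nra.
have rk : rint (fun w => 2 * Kb ^+ 2 * Dl ^+ 2 + 2 * J i w ^+ 2).
  by apply: rintD => //; [exact: prob_rint_cst|exact: rintZ].
have rD : rint (fun w => (drift_incr s0 s1 i w + J i w) ^+ 2).
  apply: (rint_le _ _ rk) => // [|w _]; last by rewrite ger0_norm ?sqr_ge0.
  by apply: measurable_funX; apply: measurable_funD.
split; first by apply: (ae_rint _ ae2 rD); exact: measurable_funX.
rewrite (ae_Eint ae2); apply: (le_trans (le_Eint _ rD rk _)) => //.
rewrite EintD//; [|exact: prob_rint_cst|exact: rintZ].
rewrite prob_Eint_cst EintZ// /path_const [leRHS]mulrDl; apply: lerD; last by rewrite -mulrA; lra.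
rewrite -[leRHS]mulrA; apply: ler_wpM2l; first by rewrite mulr_ge0 ?sqr_ge0.
rewrite expr2; apply: ler_wpM2r => //; rewrite /Dl.
have : 0 <= s0 by exact: le_trans ts0.
lra.
Qed.

Lemma path_sqr_moment s0 s1 : t <= s0 -> s0 <= s1 -> s1 <= T ->
  rint (fun w => \sum_i path_incr s0 s1 i w ^+ 2) /\
  \int[P]_w (\sum_i path_incr s0 s1 i w ^+ 2) <= n%:R * path_const * (s1 - s0).
Proof.
move=> ts0 s01 s1T; have h i := path_moment i ts0 s01 s1T.
split; first by apply: rint_sum => // i _; have [] := h i.
rewrite Eint_sum//; last by move=> i _; have [] := h i.
rewrite -mulrA mulr_natl -[X in _ *+ X](card_ord n) -sumr_const; apply: ler_sum => i _.
by have [] := h i.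
Qed.

Lemma path_time_moment s0 s1 : t <= s0 -> s0 <= s1 -> s1 <= T ->
  rintegrable M (D s0 s1) (fun p => \sum_i path_incr s0 p.1 i p.2 ^+ 2) /\
  \int[M]_(p in D s0 s1) (\sum_i path_incr s0 p.1 i p.2 ^+ 2) <=
    n%:R * path_const * (s1 - s0) ^+ 2.
Proof.
move=> ts0 s01 s1T.
have mI : measurable (`[s0, s1]%classic : set (measurableTypeR R)) by [].
have sub : D s0 s1 `<=` D t T.
  move=> [s w] [/= + _]; rewrite !in_itv/= => /andP[as_ sb]; split => //=.
  by rewrite (le_trans ts0 as_) (le_trans sb s1T).
have mf : measurable_fun (D s0 s1) (fun p => \sum_i path_incr s0 p.1 i p.2 ^+ 2).
  apply: measurable_sum => i; apply: measurable_funX; apply: measurable_funB.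
    apply: (measurable_funS (measurable_strip t T) sub).
    have h := measurable_along (scont_coord i).
    exact: h.
  have h : measurable_fun setT (fun w => X s0 w i 0).
    by apply: measurable_coord; rewrite ts0 (le_trans s01).
  exact: measurable_funTS (measurableT_comp h measurable_snd).
have k0 : 0 <= n%:R * path_const by rewrite mulr_ge0// path_const_ge0.
have [||||r1 r2] := @strip_tonelli _ _ _ _ R mu P _ mI
    (fun p => \sum_i path_incr s0 p.1 i p.2 ^+ 2) (n%:R * path_const * (s1 - s0)) => //.
- by move=> p _; exact: sum_sqr_ge0.
- exact: seg_lty.
- move=> s; rewrite /= in_itv/= => /andP[s0s ss1].
  have [i1 i2] := path_sqr_moment ts0 s0s (le_trans ss1 s1T).
  rewrite Eint_EFin// lee_fin; apply: le_trans i2 _.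
  by rewrite ler_wpM2l// lerD2r.
split => //; apply: le_trans r2 _; rewrite expr2 mulrA ler_wpM2l ?mulr_ge0 ?subr_ge0//.
  exact: path_const_ge0.
rewrite le_eqVlt; apply/orP; left; apply/eqP; exact: (congr1 fine (seg_measure s01)).
Qed.

(** The regularity of [sg] bounds the squared freezing error by the elapsed time plus the squared
    displacement. Each is of order s1 - s0 in mean, and integrating in time adds the second
    power. *)
Lemma gauss_remainder_moment s0 s1 i :
  t <= s0 -> s0 <= s1 -> s1 <= T ->
  rintegrable M (`]s0, s1]%classic `*` setT)
    (fun p => \sum_j (sg p.1 (X p.1 p.2) i j - sg s0 (X s0 p.2) i j) ^+ 2) ->
  \int[M]_(p in `]s0, s1]%classic `*` setT)
    \sum_j (sg p.1 (X p.1 p.2) i j - sg s0 (X s0 p.2) i j) ^+ 2 <=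
  d0%:R * `|Ls| * (1 + n%:R * path_const) * (s1 - s0) ^+ 2.
Proof.
move=> ts0 s01 s1T r2; have [r3 E3] := path_time_moment ts0 s01 s1T.
have s00 : 0 <= s0 by exact: le_trans ts0.
have sub : `]s0, s1]%classic `*` setT `<=` D s0 s1.
  by move=> [s w] [/= + _]; rewrite !in_itv/= => /andP[as_ sb]; split => //=; rewrite sb ltW.
have mD := measurable_strip (Omega := Omega) s0 s1.
have mD' : measurable (`]s0, s1]%classic `*` setT : set (measurableTypeR R * Omega)).
  exact: measurableX.
pose q (p : measurableTypeR R * Omega) := s1 - s0 + \sum_i path_incr s0 p.1 i p.2 ^+ 2.
have rq : rintegrable M (D s0 s1) q.
  apply: rintD => //; apply: rint_cst => //; exact: strip_lty.
have q0 p : 0 <= q p by rewrite addr_ge0 ?subr_ge0// sum_sqr_ge0.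
have c0 : 0 <= d0%:R * `|Ls| by rewrite mulr_ge0.
apply: (@le_trans _ _ (\int[M]_(p in `]s0, s1]%classic `*` setT) (d0%:R * `|Ls| * q p))).
  apply: le_Eint => //; first by apply: rintZ => //; exact: rintS rq.
  move=> [s w] [/= + _]; rewrite in_itv/= => /andP[s0s ss1].
  rewrite -mulrA mulr_natl -[X in _ *+ X](card_ord d0) -sumr_const; apply: ler_sum => j _.
  have [_ _ _ _ _ _ _ lip _] := ip.
  apply: le_trans (lip _ _ _ _ _ _ _ _) _.
  - by rewrite (le_trans s00 (ltW s0s)) (le_trans ss1).
  - by rewrite s00 (le_trans s01).
  apply: (@le_trans _ _ (`|Ls| * (`|s - s0| + \sum_k (X s w k 0 - X s0 w k 0) ^+ 2))).
    by apply: ler_wpM2r (ler_norm Ls); rewrite addr_ge0// sum_sqr_ge0.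
  rewrite ler_wpM2l// /q lerD2r ger0_norm ?subr_ge0 ?(ltW s0s)//.
  by rewrite lerD2r.
rewrite EintZ//; last exact: rintS rq.
rewrite -!mulrA ler_wpM2l// ler_wpM2l//.
apply: (@le_trans _ _ (\int[M]_(p in D s0 s1) q p)).
  exact: ge0_subset_Eint.
rewrite EintD//; last by apply: rint_cst => //; exact: strip_lty.
rewrite mulrDl mul1r; apply: lerD E3; rewrite Eint_cst//.
have -> : fine (M (D s0 s1)) = s1 - s0.
  by rewrite strip_measureE//; exact: (congr1 fine (seg_measure s01)).
by rewrite expr2.
Qed.

Lemma gauss_moments s0 s1 : t <= s0 -> s0 <= s1 -> s1 <= T ->
  [/\ forall i, measurable_fun setT (gauss_incr s0 s1 i),
     forall i, rint (fun w => gauss_incr s0 s1 i w ^+ 2),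
     \int[P]_w (\sum_i gauss_incr s0 s1 i w ^+ 2) <=
       n%:R * d0%:R ^+ 2 * Ks ^+ 2 * (s1 - s0),
     rint (fun w => (\sum_i gauss_incr s0 s1 i w ^+ 2) ^+ 2) &
     \int[P]_w ((\sum_i gauss_incr s0 s1 i w ^+ 2) ^+ 2) <=
       128 * n%:R ^+ 2 * d0%:R ^+ 4 * Ks ^+ 4 * (s1 - s0) ^+ 2].
Proof.
move=> ts0 s01 s1T.
have s00 : 0 <= s0 by exact: le_trans ts0.
have s0T : s0 <= T by exact: le_trans s1T.
pose dB j w := B s1 w j 0 - B s0 w j 0.
have mdB j : measurable_fun setT (dB j) by exact: (measurable_incr hF hB).
have Fsg i j : Fmeas (F s0) (fun w => sg s0 (X s0 w) i j).
  apply: (Fmeas_comp (s := s0) (phi := fun y => sg s0 y i j)); first by rewrite ts0.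
  by apply: scont_section (scont_diffusion i j); rewrite s00.
have mG i : measurable_fun setT (gauss_incr s0 s1 i).
  apply: measurable_sum => j; apply: measurable_funM; last exact: mdB.
  by apply: (Fmeas_measurable hF _ (Fsg i j)); rewrite s00.
have sgK w i j : sg s0 (X s0 w) i j ^+ 2 <= Ks ^+ 2.
  have [_ _ _ _ _ _ h _ _] := ip.
  rewrite -(real_normK (num_real (sg _ _ _ _))) ler_sqr ?nnegrE//; last first.
    by apply: le_trans (h s0 (X s0 w) i j _); rewrite ?s00.
  by apply: h; rewrite s00.
(* Cauchy-Schwarz, read as the bound on the quadratic form of the all-ones matrix. *)
have cs (v : 'I_d0 -> R) : (\sum_j v j) ^+ 2 <= d0%:R * \sum_j v j ^+ 2.
  have := @sum_mul_le R d0 v (fun _ _ => 1) 1 _; rewrite mul1r.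
  rewrite (eq_bigr (fun i => v i * \sum_j v j)) => [|i _].
    rewrite -mulr_suml -expr2 => h; apply: le_trans (ler_norm _) (h _).
    by move=> _ _; rewrite normr1.
  by under eq_bigr do rewrite mulr1.
have bG i w : gauss_incr s0 s1 i w ^+ 2 <= d0%:R * Ks ^+ 2 * \sum_j dB j w ^+ 2.
  apply: le_trans (cs _) _; rewrite -mulrA ler_wpM2l// mulr_sumr; apply: ler_sum => j _.
  by rewrite exprMn ler_wpM2r// sqr_ge0.
have bS w : \sum_i gauss_incr s0 s1 i w ^+ 2 <= n%:R * d0%:R * Ks ^+ 2 * \sum_j dB j w ^+ 2.
  rewrite -2!mulrA mulr_natl -[X in _ *+ X](card_ord n) -sumr_const; apply: ler_sum => i _.
  by rewrite mulrA; exact: bG.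
have r2 : rint (fun w => \sum_j dB j w ^+ 2).
  by apply: rint_sum => // j _; exact: (incr_pow hF hB).
have r4 : rint (fun w => \sum_j dB j w ^+ 4).
  by apply: rint_sum => // j _; exact: (incr_pow hF hB).
have mS : measurable_fun setT (fun w => \sum_i gauss_incr s0 s1 i w ^+ 2).
  by apply: measurable_sum => i; exact: measurable_funX.
have Ks2 : 0 <= Ks ^+ 2 by exact: sqr_ge0.
have k2 : 0 <= n%:R * d0%:R * Ks ^+ 2 by rewrite mulr_ge0// mulr_ge0.
have rG i : rint (fun w => gauss_incr s0 s1 i w ^+ 2).
  apply: (rint_le _ _ (rintZ _ (d0%:R * Ks ^+ 2) r2)) => // [|w _]; first exact: measurable_funX.
  by rewrite ger0_norm ?sqr_ge0.
have bS2 w : (\sum_i gauss_incr s0 s1 i w ^+ 2) ^+ 2 <=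
    (n%:R * d0%:R * Ks ^+ 2) ^+ 2 * d0%:R * \sum_j dB j w ^+ 4.
  apply: (@le_trans _ _ ((n%:R * d0%:R * Ks ^+ 2 * \sum_j dB j w ^+ 2) ^+ 2)).
    have h := bS w; have h0 : 0 <= \sum_i gauss_incr s0 s1 i w ^+ 2 by exact: sum_sqr_ge0.
    by rewrite ler_sqr// nnegrE// (le_trans h0 h).
  rewrite [leLHS]exprMn -[leRHS]mulrA; apply: ler_wpM2l; first exact: sqr_ge0.
  apply: le_trans (cs _) _.
  by under eq_bigr do rewrite -exprM.
have rS2 : rint (fun w => (\sum_i gauss_incr s0 s1 i w ^+ 2) ^+ 2).
  apply: (rint_le _ _ (rintZ _ ((n%:R * d0%:R * Ks ^+ 2) ^+ 2 * d0%:R) r4)) => // [|w _].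
    exact: measurable_funX.
  by rewrite ger0_norm ?sqr_ge0.
split => //.
- apply: (le_trans (le_Eint _ _ (rintZ _ (n%:R * d0%:R * Ks ^+ 2) r2) _)) => //.
    by apply: rint_sum.
  rewrite EintZ// Eint_sum//; last by move=> j _; exact: (incr_pow hF hB).
  rewrite (eq_bigr (fun=> s1 - s0)) => [|j _]; last exact: (incr_variance hF hB).
  by rewrite sumr_const card_ord -[X in _ * X <= _]mulr_natl le_eqVlt; apply/orP; left; apply/eqP; ring.
- apply: (le_trans (le_Eint _ rS2 (rintZ _ _ r4) (fun w _ => bS2 w))) => //.
  rewrite EintZ// Eint_sum//; last by move=> j _; exact: (incr_pow hF hB).
  apply: (@le_trans _ _ ((n%:R * d0%:R * Ks ^+ 2) ^+ 2 * d0%:R * (d0%:R * (128 * (s1 - s0) ^+ 2)))).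
    apply: ler_wpM2l; first by rewrite mulr_ge0// sqr_ge0.
    rewrite mulr_natl -[X in _ *+ X](card_ord d0) -sumr_const; apply: ler_sum => j _.
    exact: (incr_pow4 hF hB).
  by rewrite le_eqVlt; apply/orP; left; apply/eqP; ring.
Qed.

(** Almost surely the stochastic integral over the step, but defined from the path, hence
    independent of the version chosen. *)
Definition noise_incr s0 s1 i w := path_incr s0 s1 i w - drift_incr s0 s1 i w.

Lemma measurable_noise s0 s1 i : t <= s0 -> s0 <= s1 -> s1 <= T ->
  measurable_fun setT (noise_incr s0 s1 i).
Proof.
move=> ts0 s01 s1T; apply: measurable_funB.
  exact: (measurable_path_incr).
exact: (measurable_drift_incr).
Qed.

Lemma noise_moments s0 s1 i : t <= s0 -> s0 <= s1 -> s1 <= T ->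
  [/\ rint (noise_incr s0 s1 i),
      forall Z K, Fmeas (F s0) Z -> (forall w, `|Z w| <= K) ->
        \int[P]_w (Z w * noise_incr s0 s1 i w) = 0,
      rint (fun w => (noise_incr s0 s1 i w - gauss_incr s0 s1 i w) ^+ 2) &
      \int[P]_w ((noise_incr s0 s1 i w - gauss_incr s0 s1 i w) ^+ 2) <=
        6 * (d0%:R * `|Ls| * (1 + n%:R * path_const)) * (s1 - s0) ^+ 2].
Proof.
move=> ts0 s01 s1T; have [J [mJ aeJ J0 J2 JM]] := ito_increment ts0 s01 s1T.
have mN := measurable_noise i ts0 s01 s1T.
have [mG _ _ _ _] := gauss_moments ts0 s01 s1T.
have aeN : {ae P, forall w, noise_incr s0 s1 i w = J i w}.
  by apply: filterS aeJ => w e; rewrite /noise_incr e addrC addKr.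
have [rJ2 _] := J2 i; have [rJM r2 EJM] := JM i.
have aeM : {ae P, forall w, (noise_incr s0 s1 i w - gauss_incr s0 s1 i w) ^+ 2 =
    (J i w - gauss_incr s0 s1 i w) ^+ 2} by apply: filterS aeN => w ->.
split.
- apply: (ae_rint mN aeN); apply: (rint_le _ (mJ i) (rintD _ (prob_rint_cst P 1) rJ2)) => // w _.
  by rewrite -(real_normK (num_real (J i w))); have := sqr_ge0 (`|J i w| - 1); nra.
- move=> Z K FZ ZK; rewrite -[RHS](J0 i Z K FZ ZK); apply: ae_Eint.
  by apply: filterS aeN => w ->.
- by apply: (ae_rint _ aeM) => //; apply: measurable_funX; apply: measurable_funB.
rewrite (ae_Eint aeM); apply: le_trans EJM _; rewrite -mulrA ler_pM2l//.
exact: (gauss_remainder_moment ts0 s01 s1T r2).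
Qed.

(** The order (s1 - s0)^2 is the point: the drift is at most Kb (s1 - s0) pathwise, and the noise
    differs from its frozen version by the freezing error. No fourth moment of the path is needed
    then. *)
Lemma remainder_moment s0 s1 : t <= s0 -> s0 <= s1 -> s1 <= T ->
  rint (fun w => \sum_i (path_incr s0 s1 i w - gauss_incr s0 s1 i w) ^+ 2) /\
  \int[P]_w (\sum_i (path_incr s0 s1 i w - gauss_incr s0 s1 i w) ^+ 2) <=
    n%:R * (2 * Kb ^+ 2 + 12 * (d0%:R * `|Ls| * (1 + n%:R * path_const))) * (s1 - s0) ^+ 2.
Proof.
move=> ts0 s01 s1T; have h i := noise_moments i ts0 s01 s1T.
have [mG _ _ _ _] := gauss_moments ts0 s01 s1T.
pose bnd i w := 2 * Kb ^+ 2 * (s1 - s0) ^+ 2 +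
  2 * (noise_incr s0 s1 i w - gauss_incr s0 s1 i w) ^+ 2.
have le i w : (path_incr s0 s1 i w - gauss_incr s0 s1 i w) ^+ 2 <= bnd i w.
  have := drift_incr_bound ts0 s01 s1T i w; rewrite ler_norml => /andP[h1 h2].
  have : drift_incr s0 s1 i w ^+ 2 <= Kb ^+ 2 * (s1 - s0) ^+ 2 by rewrite -exprMn; nra.
  rewrite /bnd /noise_incr; set p := path_incr _ _ _ _; set q := gauss_incr _ _ _ _.
  by have := sqr_ge0 (drift_incr s0 s1 i w - (p - drift_incr s0 s1 i w - q)); nra.
have rb i : rint (bnd i).
  by apply: rintD => //; [exact: prob_rint_cst|apply: rintZ => //; have [] := h i].
have r i : rint (fun w => (path_incr s0 s1 i w - gauss_incr s0 s1 i w) ^+ 2).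
  apply: (rint_le _ _ (rb i)) => // [|w _]; last by rewrite ger0_norm ?sqr_ge0.
  by apply: measurable_funX; apply: measurable_funB => //; exact: (measurable_path_incr).
split; first exact: rint_sum.
rewrite Eint_sum// -mulrA mulr_natl -[X in _ *+ X](card_ord n) -sumr_const.
apply: ler_sum => i _; have [_ _ r3 E3] := h i.
apply: (le_trans (le_Eint _ (r i) (rb i) (fun w _ => le i w))) => //.
rewrite EintD//; [|exact: prob_rint_cst|exact: rintZ].
by rewrite prob_Eint_cst EintZ// [leRHS]mulrDl lerD2l; lra.
Qed.

(** * Vanishing mean of the martingale defect *)

Section dynkin.
Context (u ut : R -> 'cV[R]_n -> R) (g : 'I_n -> R -> 'cV[R]_n -> R).
Context (H : 'I_n -> 'I_n -> R -> 'cV[R]_n -> R) (ssu : strip_smooth T u ut g H).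
Context (C : R) (uC : forall (s : R) y, 0 <= s <= T -> `|u s y| <= C).
Context (G : R -> Omega -> R) (mG : measurable_fun (D t T) (fun p => G p.1 p.2)).
Context (CG : R) (GC : forall s w, t <= s <= T -> `|G s w| <= CG).

Definition diff_coef i l s (y : 'cV[R]_n) := \sum_j sg s y i j * sg s y l j.

Context (pde : forall s w, t <= s < T ->
  ut s (X s w) + \sum_i beta i s w * g i s (X s w) + second_order H diff_coef s (X s w) = - G s w).

Lemma scont_diff_coef i l : scont T (diff_coef i l).
Proof. by apply: scont_sum => j; apply: scontM; exact: scont_diffusion. Qed.

Definition martingale_defect s0 s1 w :=
  u s1 (X s1 w) - u s0 (X s0 w) + \int[mu]_(s in `[s0, s1]) G s w.

(** The terms of order up to s1 - s0 that do not cancel pathwise: gradient against noise, and half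
    the Hessian against the product of Gaussian increments centred at its conditional mean. *)
Definition linear_part s0 s1 w :=
  \sum_i g i s0 (X s0 w) * noise_incr s0 s1 i w
  + 2^-1 * \sum_i \sum_l H l i s0 (X s0 w) *
      (gauss_incr s0 s1 i w * gauss_incr s0 s1 l w
       - (s1 - s0) * diff_coef i l s0 (X s0 w)).

Lemma G_section w a b : t <= a -> b <= T -> measurable_fun `[a, b] (fun s => G s w).
Proof.
move=> ta bT; apply: (measurable_section (f := fun p => G p.1 p.2)).
apply: (measurable_funS (measurable_strip t T)) mG.
move=> [s w'] [/= + _]; rewrite !in_itv/= => /andP[as_ sb]; split => //=.
by rewrite (le_trans ta as_) (le_trans sb bT).
Qed.

(** The terms multiplied by [e] are of order s1 - s0 in mean and those multiplied by [K] of order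
    (s1 - s0)^2, so the possibly huge [K] is harmless for a fine grid. *)
Lemma defect_pointwise N e : 0 < e -> exists2 r, 0 < r & exists2 K, 0 <= K &
  forall s0 s1 w, t <= s0 -> s0 <= s1 -> s1 <= T -> s1 - s0 < r ->
  (forall i, `|X s0 w i 0| <= N) ->
  `|martingale_defect s0 s1 w - linear_part s0 s1 w| <=
    e * (s1 - s0 + \sum_i path_incr s0 s1 i w ^+ 2 + \sum_i gauss_incr s0 s1 i w ^+ 2)
    + K * (\sum_i (path_incr s0 s1 i w - gauss_incr s0 s1 i w) ^+ 2
       + (\sum_i gauss_incr s0 s1 i w ^+ 2) ^+ 2
       + \int[mu]_(s in `[s0, s1]) \sum_i path_incr s0 s i w ^+ 2).
Proof.
move=> e0; have e3 : 0 < e / 3 by rewrite divr_gt0.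
have [Q Q0 QP] := box_bound ssu N.
have [r1 r10 [K1 K10 h1]] := taylor_step ssu N e3 uC.
have [K2 K20 h2] := @quadratic_step R n Q _ (ltW Q0) e3.
have [r3 r30 [K3 K30 h3]] := generator_step ssu scont_diff_coef N Kb CG e3.
exists (Num.min r1 r3); first by rewrite lt_min r10.
exists (K1 + K2 + K3); first by rewrite !addr_ge0.
move=> s0 s1 w ts0 s01 s1T; rewrite lt_min => /andP[sr1 sr3] XN.
have s00 : 0 <= s0 by exact: le_trans ts0.
have s0T : 0 <= s0 <= T by rewrite s00 (le_trans s01).
pose m i := gauss_incr s0 s1 i w; pose dl i := path_incr s0 s1 i w.
pose X0 := X s0 w; pose so := second_order H diff_coef s0 X0; pose Dl := s1 - s0.
pose Sg := \sum_i dl i * g i s0 X0; pose Sd := \sum_i drift_incr s0 s1 i w * g i s0 X0.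
pose S2 := 2^-1 * \sum_i dl i * \sum_j dl j * H j i s0 X0.
pose S3 := 2^-1 * \sum_i m i * \sum_j m j * H j i s0 X0.
pose IG := \int[mu]_(s in `[s0, s1]) G s w.
pose Isq := \int[mu]_(s in `[s0, s1]) \sum_i path_incr s0 s i w ^+ 2.
pose Q1 := \sum_i (dl i - m i) ^+ 2; pose Q2 := \sum_i m i ^+ 2; pose Q3 := \sum_i dl i ^+ 2.
have E1 : `|u s1 (X s1 w) - u s0 X0 - ut s0 X0 * Dl - Sg - S2| <= e / 3 * (Dl + Q3) + K1 * (Q1 + Q2 ^+ 2).
  exact: h1.
have [_ _ q3] := QP s0 X0 s0T XN.
have E2 : `|S2 - S3| <= e / 3 * (Q3 + Q2) + K2 * Q1.
  by apply: (h2 dl m (fun j i => H j i s0 X0)) => i j; exact: q3.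
have sub s : s0 <= s <= s1 -> t <= s <= T.
  by move=> /andP[s0s ss1]; rewrite (le_trans ts0 s0s) (le_trans ss1 s1T).
have E3 : `|ut s0 X0 * Dl + Sd + so * Dl + IG| <= e / 3 * Dl + K3 * Isq.
  apply: (h3 s0 s1 (X^~ w) (fun i s => beta i s w) (G^~ w) s00 s01 s1T sr3 XN).
  - move=> i; have [_ _ c _ _ _ _ _ _] := ip.
    by apply: continuous_subspaceW (c w i) => s; rewrite /= !in_itv/=; exact: sub.
  - by move=> i; have /measurable_int/measurable_EFinP := drift_section i w ts0 s1T.
  - by move=> i s /sub sT; have [_ _ _ _ _ c _ _ _] := ip; exact: c.
  - exact: G_section.
  - by move=> s /sub; exact: GC.
  - move=> s /andP[s0s ss1]; apply: pde.
    by rewrite (le_trans ts0 s0s) (lt_le_trans ss1 s1T).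
have L : linear_part s0 s1 w = (Sg - Sd) + (S3 - so * Dl).
  rewrite /linear_part -/X0; congr (_ + _).
    by rewrite -sumrB; apply: eq_bigr => i _; rewrite /noise_incr -/(dl i); ring.
  rewrite /so /second_order -mulrA -mulrBr; congr (_ * _).
  rewrite mulr_suml -sumrB; apply: eq_bigr => i _; rewrite [m i * _]mulr_sumr [X in _ = _ - X]mulr_suml -sumrB.
  by apply: eq_bigr => l _; rewrite -/(m i) -/(m l) -/Dl; ring.
rewrite L /martingale_defect -/X0 -/IG -/Isq.
rewrite -[X in e * (X + _ + _)]/Dl -[X in e * (_ + X + _)]/Q3 -[X in e * (_ + _ + X)]/Q2.
rewrite -[X in (K1 + K2 + K3) * (X + _ + _)]/Q1 -[X in _ * (_ + X ^+ 2 + _)]/Q2.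
(* The three groups are the errors of [taylor_step], of [quadratic_step] (path replaced by Gaussian
   increment) and of [generator_step], each taken with accuracy [e / 3]. *)
have -> : u s1 (X s1 w) - u s0 X0 + IG - (Sg - Sd + (S3 - so * Dl)) =
  (u s1 (X s1 w) - u s0 X0 - ut s0 X0 * Dl - Sg - S2) + (S2 - S3) + (ut s0 X0 * Dl + Sd + so * Dl + IG).
  by ring.
have Q10 : 0 <= Q1 by exact: sum_sqr_ge0.
have Q20 : 0 <= Q2 ^+ 2 by exact: sqr_ge0.
have Q30 : 0 <= Q3 by exact: sum_sqr_ge0.
have Q20' : 0 <= Q2 by exact: sum_sqr_ge0.
have I0 : 0 <= Isq by apply: Rintegral_ge0 => s _; exact: sum_sqr_ge0.
apply: le_trans (ler_normD _ _) _; apply: le_trans (lerD (ler_normD _ _) E3) _.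
apply: le_trans (lerD (lerD E1 E2) (lexx _)) _.
have := mulr_ge0 K10 I0; have := mulr_ge0 K20 I0; have := mulr_ge0 K20 Q20.
have := mulr_ge0 K30 Q10; have := mulr_ge0 K30 Q20.
have := mulr_ge0 (ltW e3) Q20'; have := mulr_ge0 (ltW e3) Q30.
have Dl0 : 0 <= Dl by rewrite subr_ge0.
have := mulr_ge0 (ltW e3) Dl0.
lra.
Qed.

Section step.
Context (s0 s1 : R) (ts0 : t <= s0) (s01 : s0 <= s1) (s1T : s1 <= T).

Let s00 : 0 <= s0. Proof. exact: le_trans ts0. Qed.
Let s0T : 0 <= s0 <= T. Proof. by rewrite s00 (le_trans s01). Qed.
Let ts0T : t <= s0 <= T. Proof. by rewrite ts0 (le_trans s01). Qed.

Lemma path_sqr_section w :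
  rintegrable mu `[s0, s1] (fun s => \sum_i path_incr s0 s i w ^+ 2).
Proof.
have [_ _ c _ _ _ _ _ _] := ip.
apply: rint_sum => // i _; apply: seg_rint_continuous.
rewrite (_ : (fun s => _) = (fun s => (X s w i 0 - X s0 w i 0) * (X s w i 0 - X s0 w i 0)))//.
have cX : {within `[s0, s1], continuous (fun s => X s w i 0)}.
  apply: continuous_subspaceW (c w i) => s; rewrite /= !in_itv/= => /andP[s0s ss1].
  by rewrite (le_trans ts0 s0s) (le_trans ss1 s1T).
move=> s.
by apply: cvgM; apply: cvgB; [exact: cX|exact: cvg_cst|exact: cX|exact: cvg_cst].
Qed.

Lemma path_time_integral :
  rint (fun w => \int[mu]_(s in `[s0, s1]) \sum_i path_incr s0 s i w ^+ 2) /\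
  \int[P]_w \int[mu]_(s in `[s0, s1]) (\sum_i path_incr s0 s i w ^+ 2) <=
    n%:R * path_const * (s1 - s0) ^+ 2.
Proof.
have [r1 r2] := path_time_moment ts0 s01 s1T.
have mI : measurable (`[s0, s1]%classic : set (measurableTypeR R)) by [].
have [|r3 E] := strip_fubini mI r1 _ path_sqr_section; last by split => //; rewrite E.
by move=> p _; exact: sum_sqr_ge0.
Qed.

(** The product expands over pairs of noise coordinates; their covariance is the identity times s1 -
    s0, which rebuilds [diff_coef]. *)
Lemma gauss_product_mean (Y : Omega -> R) K i l : Fmeas (F s0) Y -> (forall w, `|Y w| <= K) ->
  rint (fun w => Y w * (gauss_incr s0 s1 i w * gauss_incr s0 s1 l w
     - (s1 - s0) * diff_coef i l s0 (X s0 w))) /\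
  \int[P]_w (Y w * (gauss_incr s0 s1 i w * gauss_incr s0 s1 l w
     - (s1 - s0) * diff_coef i l s0 (X s0 w))) = 0.
Proof.
move=> FY YK; have s0T' := le_trans s01 s1T.
have Fsg a j : Fmeas (F s0) (fun w => sg s0 (X s0 w) a j).
  apply: (Fmeas_comp (s := s0) (phi := fun y => sg s0 y a j)) => //.
  exact: scont_section (scont_diffusion a j).
have sgK w a j : `|sg s0 (X s0 w) a j| <= Ks by have [_ _ _ _ _ _ h _ _] := ip; exact: h.
have K0 : 0 <= K by exact: le_trans (normr_ge0 _) (YK point).
pose V j k w := Y w * (sg s0 (X s0 w) i j * sg s0 (X s0 w) l k).
have FV j k : Fmeas (F s0) (V j k) by exact: (measurable_funM FY (measurable_funM (Fsg i j) (Fsg l k))).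
have VK j k w : `|V j k w| <= K * (Ks * Ks).
  by rewrite !normrM; do 2 (apply: ler_pM => //).
have rV j k : rint (V j k) by have [] := Fmeas_bounded_rint hF s0T (FV j k) (VK j k).
pose dB j w := B s1 w j 0 - B s0 w j 0.
have cov j k := Fmeas_incr_cov hF hB j k s00 s01 s1T (FV j k) (rV j k).
have E w : Y w * (gauss_incr s0 s1 i w * gauss_incr s0 s1 l w
     - (s1 - s0) * diff_coef i l s0 (X s0 w)) =
   \sum_j \sum_k (V j k w * (dB j w * dB k w) - (j == k)%:R * (s1 - s0) * V j k w).
  rewrite /gauss_incr /diff_coef mulr_suml mulr_sumr -sumrB mulr_sumr; apply: eq_bigr => j _.
  rewrite sumrB mulrBr; congr (_ - _).
    by rewrite mulr_sumr mulr_sumr; apply: eq_bigr => k _; rewrite /V /dB; ring.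
  rewrite (bigD1 j)//= eqxx big1 => [|k /negPf]; first by rewrite addr0 /V mulr1n; ring.
  by rewrite eq_sym => ->; rewrite !mul0r.
have r2 j k : rint (fun w => V j k w * (dB j w * dB k w) - (j == k)%:R * (s1 - s0) * V j k w).
  by apply: rintB => //; [have [] := cov j k|exact: rintZ].
under eq_fun do rewrite E; split; first by do 2 (apply: rint_sum => // ? _).
rewrite Eint_sum//; last by move=> j _; exact: rint_sum.
rewrite big1// => j _; rewrite Eint_sum// big1// => k _.
have [c1 c2] := cov j k.
by rewrite EintB ?EintZ// ?c2 ?subrr//; exact: rintZ.
Qed.

Lemma measurable_defect : measurable_fun setT (martingale_defect s0 s1) /\
  forall w, `|martingale_defect s0 s1 w| <= C + C + CG * (s1 - s0).
Proof.
have mI : measurable (`[s0, s1]%classic : set (measurableTypeR R)) by [].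
have sub : D s0 s1 `<=` D t T.
  move=> [s w] [/= + _]; rewrite !in_itv/= => /andP[as_ sb]; split => //=.
  by rewrite (le_trans ts0 as_) (le_trans sb s1T).
have inT s : s0 <= s <= s1 -> t <= s <= T.
  by move=> /andP[a b]; rewrite (le_trans ts0 a) (le_trans b s1T).
have rG w : rintegrable mu `[s0, s1] (G^~ w).
  by apply: (@seg_rint_bounded _ _ _ _ CG) => [|s /inT]; [exact: (G_section)|exact: GC].
have rGM : rintegrable M (D s0 s1) (fun p => G p.1 p.2).
  apply: (@rint_bounded _ _ _ _ _ _ _ CG); [|exact: strip_lty| |].
  - exact: measurable_strip.
  - exact: (measurable_funS (measurable_strip t T) sub).
  - by move=> [s w] [/= + _]; rewrite in_itv/= => /inT; exact: GC.
have [mIG _] := strip_measurable mI rGM rG.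
have mu_ s : t <= s <= T -> measurable_fun setT (fun w => u s (X s w)).
  move=> tsT; have sT : 0 <= s <= T by case/andP: tsT => ts ->; rewrite (le_trans t0).
  apply: (Fmeas_measurable hF sT); apply: (Fmeas_comp (phi := u s)) => //.
  exact: scont_section (ss_u ssu).
split.
  apply: measurable_funD => //; apply: measurable_funB; apply: mu_ => //.
  by rewrite (le_trans ts0).
move=> w; apply: le_trans (ler_normD _ _) (lerD _ _).
  by apply: le_trans (ler_normB _ _) (lerD _ _); apply: uC; rewrite // (le_trans s00).
rewrite -(seg_cst CG s01); apply: seg_le_norm => //; first exact: seg_rint_cst.
by move=> s /andP[a b]; apply/GC/inT; rewrite a ltW.
Qed.

End step.

(** Where [Z] is nonzero the path sits in the box at [s0], so [Z] times a derivative of [u] is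
    bounded and known at [s0]: an admissible weight for the two zero-mean results. *)
Lemma linear_part_mean N s0 s1 (Z : Omega -> R) : t <= s0 -> s0 <= s1 -> s1 <= T ->
  Fmeas (F s0) Z -> (forall w, 0 <= Z w <= 1) ->
  (forall w, Z w != 0 -> forall i, `|X s0 w i 0| <= N) ->
  rint (fun w => Z w * linear_part s0 s1 w) /\
  \int[P]_w (Z w * linear_part s0 s1 w) = 0.
Proof.
move=> ts0 s01 s1T FZ Z01 ZN; have s00 : 0 <= s0 by exact: le_trans ts0.
have s0T : 0 <= s0 <= T by rewrite s00 (le_trans s01).
have ts0T : t <= s0 <= T by rewrite ts0 (le_trans s01).
have [Q Q0 QP] := box_bound ssu N.
have Fm phi : scont T phi -> Fmeas (F s0) (fun w => Z w * phi s0 (X s0 w)).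
  move=> cphi; apply: (measurable_funM FZ).
  by apply: (Fmeas_comp (phi := phi s0)) => //; exact: scont_section cphi.
have bound (phi : R -> 'cV[R]_n -> R) :
    (forall y : 'cV[R]_n, (forall i, `|y i 0| <= N) -> `|phi s0 y| <= Q) ->
    forall w, `|Z w * phi s0 (X s0 w)| <= Q.
  move=> phiQ w; have [->|Zw] := eqVneq (Z w) 0; first by rewrite mul0r normr0 ltW.
  have /andP[Z0 Z1] := Z01 w; rewrite normrM (ger0_norm Z0).
  apply: le_trans (phiQ _ (ZN w Zw)); by rewrite ler_piMl.
have Fg i := Fm _ (ss_g ssu i).
have bg i : forall w, `|Z w * g i s0 (X s0 w)| <= Q.
  by apply: (bound (g i)) => y yN; have [_ q _] := QP s0 y s0T yN.
have FH i l := Fm _ (ss_H ssu l i).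
have bH i l : forall w, `|Z w * H l i s0 (X s0 w)| <= Q.
  by apply: (bound (H l i)) => y yN; have [_ _ q] := QP s0 y s0T yN.
have nm i := noise_moments i ts0 s01 s1T.
have gm i l := gauss_product_mean ts0 s01 s1T i l (FH i l) (bH i l).
have r1 i : rint (fun w => Z w * g i s0 (X s0 w) * noise_incr s0 s1 i w).
  apply: (rintMb _ _ (fun w _ => bg i w)) => //; last by have [] := nm i.
  exact: (Fmeas_measurable hF s0T (Fg i)).
have E w : Z w * linear_part s0 s1 w =
  \sum_i Z w * g i s0 (X s0 w) * noise_incr s0 s1 i w +
  2^-1 * \sum_i \sum_l Z w * H l i s0 (X s0 w) *
      (gauss_incr s0 s1 i w * gauss_incr s0 s1 l w
       - (s1 - s0) * diff_coef i l s0 (X s0 w)).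
  rewrite /linear_part mulrDr mulr_sumr mulrCA mulr_sumr; congr (_ + _ * _).
    by apply: eq_bigr => i _; rewrite mulrA.
  by apply: eq_bigr => i _; rewrite mulr_sumr; apply: eq_bigr => l _; rewrite mulrA.
have r2 : rint (fun w => \sum_i Z w * g i s0 (X s0 w) * noise_incr s0 s1 i w).
  exact: rint_sum.
have r3 i : rint (fun w => \sum_l Z w * H l i s0 (X s0 w) *
      (gauss_incr s0 s1 i w * gauss_incr s0 s1 l w
       - (s1 - s0) * diff_coef i l s0 (X s0 w))).
  by apply: rint_sum => // l _; have [] := gm i l.
have r4 : rint (fun w => 2^-1 * \sum_i \sum_l Z w * H l i s0 (X s0 w) *
      (gauss_incr s0 s1 i w * gauss_incr s0 s1 l w
       - (s1 - s0) * diff_coef i l s0 (X s0 w))).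
  by apply: rintZ => //; exact: rint_sum.
under eq_fun do rewrite E; split; first exact: rintD.
rewrite EintD// EintZ//; last exact: rint_sum.
rewrite !Eint_sum// !big1 ?mulr0 ?addr0// => i _.
  by rewrite Eint_sum ?big1// => l _; have [] := gm i l.
by have [_ m _ _] := nm i; exact: m (Fg i) (bg i).
Qed.

(** Subtracting the linear part costs nothing in mean, and what is left is bounded by
    [defect_pointwise] with expectations taken. The factor s1 - s0 makes these errors summable over
    a grid. *)
Lemma defect_step N e : 0 < e -> exists2 r, 0 < r & forall s0 s1 (Z : Omega -> R),
  t <= s0 -> s0 <= s1 -> s1 <= T -> s1 - s0 < r ->
  Fmeas (F s0) Z -> (forall w, 0 <= Z w <= 1) ->
  (forall w, Z w != 0 -> forall i, `|X s0 w i 0| <= N) ->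
  `|\int[P]_w (Z w * martingale_defect s0 s1 w)| <= e * (s1 - s0).
Proof.
move=> e0; pose a1 := n%:R * path_const.
pose a2 := n%:R * d0%:R ^+ 2 * Ks ^+ 2.
pose a3 := n%:R * (2 * Kb ^+ 2 + 12 * (d0%:R * `|Ls| * (1 + n%:R * path_const))).
pose a4 := 128 * n%:R ^+ 2 * d0%:R ^+ 4 * Ks ^+ 4.
have pc0 : 0 <= path_const := path_const_ge0.
have a10 : 0 <= a1 by rewrite mulr_ge0.
have a20 : 0 <= a2 by rewrite mulr_ge0 ?sqr_ge0// mulr_ge0 ?sqr_ge0.
have a30 : 0 <= a3.
  have k1 : 0 <= 1 + n%:R * path_const by rewrite addr_ge0// mulr_ge0.
  have k2 : 0 <= d0%:R * `|Ls| * (1 + n%:R * path_const).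
    by apply: mulr_ge0 => //; exact: mulr_ge0.
  by apply: mulr_ge0 => //; apply: addr_ge0; apply: mulr_ge0 => //; exact: sqr_ge0.
have a40 : 0 <= a4.
  by rewrite mulr_ge0 ?exprn_even_ge0// mulr_ge0 ?exprn_even_ge0// mulr_ge0 ?exprn_even_ge0.
(* Half of [e] pays for the terms of order s1 - s0; the other half pays for c (s1 - s0)^2, through
   the second entry of the minimum below. *)
pose e' := e / 2 / (1 + a1 + a2).
have b0 : 0 < 1 + a1 + a2 by rewrite -addrA ltr_pwDl// addr_ge0.
have e'0 : 0 < e' by rewrite !divr_gt0.
have [r1 r10 [K K0 h]] := defect_pointwise N e'0.
pose c := K * (a3 + a4 + a1).
have c0 : 0 <= c by rewrite mulr_ge0// !addr_ge0.
exists (Num.min r1 (e / 2 / (c + 1))).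
  by rewrite lt_min r10 !divr_gt0// ltr_pwDr.
move=> s0 s1 Z ts0 s01 s1T; rewrite lt_min => /andP[sr1 sr2] FZ Z01 ZN.
set Dl := s1 - s0 in sr1 sr2 *; have Dl0 : 0 <= Dl by rewrite subr_ge0.
have [rL EL] := linear_part_mean ts0 s01 s1T FZ Z01 ZN.
have [mdef bdef] := measurable_defect ts0 s01 s1T.
have [p1 E1] := path_sqr_moment ts0 s01 s1T.
have [_ mg2' E2 p4 E4] := gauss_moments ts0 s01 s1T.
have p2 : rint (fun w => \sum_i gauss_incr s0 s1 i w ^+ 2) by exact: rint_sum.
have [p3 E3] := remainder_moment ts0 s01 s1T.
have [p5 E5] := path_time_integral ts0 s01 s1T.
pose f1 w := \sum_i path_incr s0 s1 i w ^+ 2.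
pose f2 w := \sum_i gauss_incr s0 s1 i w ^+ 2.
pose f3 w := \sum_i (path_incr s0 s1 i w - gauss_incr s0 s1 i w) ^+ 2.
pose f5 w := \int[mu]_(s in `[s0, s1]) \sum_i path_incr s0 s i w ^+ 2.
pose W w := e' * (Dl + f1 w + f2 w) + K * (f3 w + f2 w ^+ 2 + f5 w).
have q1 : rint (fun w => Dl + f1 w + f2 w).
  by do 2 (apply: rintD => //); exact: prob_rint_cst.
have q2 : rint (fun w => f3 w + f2 w ^+ 2 + f5 w) by do 2 (apply: rintD => //).
have rW : rint W by apply: rintD => //; exact: rintZ.
have EW : \int[P]_w W w <= e * Dl.
  rewrite EintD//; [|exact: rintZ|exact: rintZ]; rewrite !EintZ//.
  rewrite EintD//; last by apply: rintD => //; exact: prob_rint_cst.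
  rewrite EintD//; last exact: prob_rint_cst.
  rewrite [X in K * X]EintD//; last by apply: rintD.
  rewrite [X in K * (X + _)]EintD// prob_Eint_cst.
  apply: (@le_trans _ _ (e' * ((1 + a1 + a2) * Dl) + K * ((a3 + a4 + a1) * Dl ^+ 2))).
    apply: lerD; [apply: ler_wpM2l; first exact: ltW|apply: ler_wpM2l => //].
      by rewrite !mulrDl mul1r; apply: lerD E2; apply: lerD E1.
    by rewrite !mulrDl; apply: lerD E5; apply: lerD E3 E4.
  rewrite mulrA /e' divfK ?gt_eqF// mulrA -/c expr2 mulrA -mulrDl ler_wpM2r//.
  have : c * Dl <= e / 2; last by lra.
  apply: le_trans (_ : (c + 1) * Dl <= _); first by rewrite ler_wpM2r// lerDl.
  by rewrite mulrC -ler_pdivlMr ?ltW// ltr_pwDr.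
have rZ : rint (fun w => Z w * martingale_defect s0 s1 w).
  have s0T : 0 <= s0 <= T by rewrite (le_trans t0 ts0) (le_trans s01).
  apply: (rintMb _ (Fmeas_measurable hF s0T FZ) (k := 1)) => // [w _|].
    by have /andP[z0 z1] := Z01 w; rewrite ger0_norm.
  exact: prob_rint_bounded mdef bdef.
rewrite -[X in `|X|]subr0 -EL -EintB//.
apply: le_trans (le_norm_Eint _ (rintB _ rZ rL)) _ => //.
apply: le_trans EW; apply: le_Eint => // [|w _].
  by apply: rint_norm; exact: rintB.
have /andP[z0 z1] := Z01 w; have W0 : 0 <= W w.
  have g1 : 0 <= f1 w by exact: sum_sqr_ge0.
  have g2 : 0 <= f2 w by exact: sum_sqr_ge0.
  have g3 : 0 <= f3 w by exact: sum_sqr_ge0.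
  have g5 : 0 <= f5 w by apply: Rintegral_ge0 => s _; exact: sum_sqr_ge0.
  apply: addr_ge0; apply: mulr_ge0 => //; first exact: ltW.
    by apply: addr_ge0 => //; exact: addr_ge0.
  by apply: addr_ge0 => //; apply: addr_ge0 => //; exact: sqr_ge0.
have [->|Zw] := eqVneq (Z w) 0; first by rewrite !mul0r subrr normr0.
rewrite -mulrBr normrM (ger0_norm z0).
apply: le_trans (h s0 s1 w ts0 s01 s1T sr1 (ZN w Zw)).
by rewrite ler_piMl.
Qed.

Let tT : t <= T. Proof. by have /andP[] := ip_start ip. Qed.

Lemma defect_add a b c w : t <= a -> a <= b -> b <= c -> c <= T ->
  martingale_defect a c w =
  martingale_defect a b w + martingale_defect b c w.
Proof.
move=> ta ab bc cT.
have rG : rintegrable mu `[a, c] (G^~ w).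
  apply: (@seg_rint_bounded _ _ _ _ CG) => [|s /andP[as_ sc]]; first exact: (G_section).
  by apply: GC; rewrite (le_trans ta as_) (le_trans sc cT).
have := @Rintegral_itvB R (G^~ w) (BLeft a) (BRight c) b rG.
rewrite !bnd_simp => /(_ ab bc).
rewrite Rintegral_itv_obnd_cbnd; last first.
  by apply: rintS rG => //; apply: subset_itvr; rewrite bnd_simp.
rewrite /martingale_defect => <-; ring.
Qed.

Definition grid m k := t + (T - t) / m.+1%:R * k%:R.

Lemma grid0 m : grid m 0 = t. Proof. by rewrite /grid mulr0 addr0. Qed.

Lemma grid_last m : grid m m.+1 = T.
Proof. by rewrite /grid divfK// addrC subrK. Qed.

Lemma grid_step m k : grid m k.+1 - grid m k = (T - t) / m.+1%:R.
Proof. by rewrite /grid -natr1; ring. Qed.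

Lemma grid_le m k l : (k <= l)%N -> grid m k <= grid m l.
Proof.
by move=> kl; rewrite lerD2l ler_wpM2l ?ler_nat// divr_ge0// subr_ge0.
Qed.

Lemma grid_in m k : (k <= m.+1)%N -> t <= grid m k <= T.
Proof.
move=> km; have := grid_le m km; have := grid_le m (leq0n k).
by rewrite grid0 grid_last => -> ->.
Qed.

Definition inside N s w := [forall i, `|X s w i 0| <= N].

(* Discrete stopping: [stopped N m k w] asks the path to stay in the box at the first grid
   times, which keeps it measurable at time [grid m k]. *)
Definition stopped N m k w := [forall j : 'I_k.+1, inside N (grid m j) w].

Lemma stopped_step N m k w : stopped N m k.+1 w -> stopped N m k w.
Proof.
move=> /forallP h; apply/forallP => j; exact: (h (widen_ord (leqnSn _) j)).
Qed.

Lemma Fmeas_stopped N m k : (k <= m.+1)%N ->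
  Fmeas (F (grid m k)) (fun w => (stopped N m k w)%:R : R).
Proof.
move=> km; have /andP[tk kT] := grid_in km.
have E w : (stopped N m k w)%:R = \prod_(j < k.+1) \prod_(i < n) \1_(`[- N, N]%classic) (X (grid m j) w i 0) :> R.
  have [/forallP h|] := boolP (stopped N m k w).
    rewrite big1// => j _; rewrite big1// => i _; rewrite indicE mem_set//= in_itv/= -ler_norml.
    exact: (forallP (h j) i).
  rewrite negb_forall => /existsP[j]; rewrite negb_forall => /existsP[i ji].
  rewrite (bigD1 j)//= (bigD1 i)//= indicE memNset ?mul0r//= in_itv/= -ler_norml.
  exact/negP.
under eq_fun do rewrite E.
have [_ ad _ _ _ _ _ _ _] := ip.
apply: measurable_prod => j _; apply: measurable_prod => i _.
apply: (measurableT_comp (measurable_indic (measurable_itv _))).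
have jk : (j <= k)%N by rewrite -ltnS.
apply: (Fmeas_le hF _ (grid_le m jk)) => //; last first.
  by apply: ad; apply: grid_in; exact: leq_trans km.
by rewrite (le_trans t0)//; have /andP[] := grid_in (leq_trans jk km).
Qed.

(** Since [z] never becomes true again, the sum telescopes from the first index [k] where it fails.
    If it holds at the last step there is nothing left, and then [k] is [m]. *)
Lemma stopped_sum (z : nat -> bool) (f : nat -> R) m : (forall k, z k.+1 -> z k) ->
  exists k, [/\ (k <= m)%N, (z m.-1 -> k = m) &
    \sum_(j < m) (~~ z j)%:R * (f j.+1 - f j) = f m - f k].
Proof.
move=> zS; elim: m => [|m [k [km zk E]]].
  by exists 0%N; split => //; rewrite big_ord0 subrr.
rewrite big_ord_recr/= E; have [zm|zm] := boolP (z m); last first.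
  by exists k; split => //; [exact: leqW|rewrite /= mul1r; ring].
exists m.+1; split => //; rewrite /= mul0r addr0 subrr.
case: m => [|m] in km zk E zm *; first by rewrite leqn0 in km; rewrite (eqP km) subrr.
by rewrite (zk (zS _ zm)) subrr.
Qed.

(** The union runs over the points of all grids at once, so [N] can be fixed before the mesh; being
    countable it stays measurable. *)
Definition excess (N : nat) : set Omega :=
  \bigcup_(mk : nat * nat)
    [set w | (mk.2 <= mk.1.+1)%N && ~~ inside N%:R (grid mk.1 mk.2) w].

Lemma measurable_excess N : measurable (excess N).
Proof.
apply: countable_bigcupT_measurable; first exact: countableP.
move=> [m k] /=; have [km|_] := boolP (k <= m.+1)%N; last first.
  by rewrite (_ : [set w | _] = set0)//; apply/seteqP; split.
rewrite (_ : [set w | _] = \bigcup_(i in [set: 'I_n]) ((fun w => X (grid m k) w i 0) @^-1` (~` `[- N%:R, N%:R]%classic))).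
  apply: fin_bigcup_measurable => // i _; rewrite -[X in measurable X]setTI.
  apply: (measurable_coord) => //; first exact: grid_in.
  exact: measurableC.
apply/seteqP; split => [w /=|w [i _ /= ]].
  rewrite negb_forall => /existsP[i iN]; exists i => //=; rewrite in_itv/= -ler_norml.
  exact/negP.
rewrite in_itv/= -ler_norml => iN; rewrite negb_forall; apply/existsP; exists i; exact/negP.
Qed.

(** A continuous path on [t, T] is bounded, so no outcome lies in all these decreasing sets;
    continuity from above concludes. *)
Lemma excess_cvg : P (excess N) @[N --> \oo] --> 0%E.
Proof.
have E : \bigcap_N excess N = set0.
  rewrite -subset0 => w wN.
  have [_ _ cX _ _ _ _ _ _] := ip.
  have [K K0 KP] : exists2 K, 0 < K & forall i s, t <= s <= T -> `|X s w i 0| <= K.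
    apply: fin_large => [i a b ab h s sT|i]; first exact: le_trans (h s sT) ab.
    have [c1 _ h1] := EVT_max tT (cX w i); have [c2 _ h2] := EVT_min tT (cX w i).
    exists (`|X c1 w i 0| + `|X c2 w i 0|) => s sT.
    have := h1 s; have := h2 s; rewrite in_itv/= sT => /(_ isT) a /(_ isT) b.
    have := ler_norm (X c1 w i 0); have := lerNnormlW (lexx `|X c2 w i 0|).
    rewrite ler_norml; have := normr_ge0 (X c1 w i 0); have := normr_ge0 (X c2 w i 0); lra.
  have [[m k] _ /= /andP[km]] := wN (Num.truncn K).+1 Logic.I.
  rewrite negb_forall => /existsP[i] /negP; apply.
  by apply: le_trans (KP i _ (grid_in km)) _; apply: ltW; exact: truncnS_gt.
rewrite -(measure0 P) -E; apply: nonincreasing_cvg_mu.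
- exact: le_lt_trans (probability_le1 _ (measurable_excess _)) (ltry 1).
- exact: measurable_excess.
- by rewrite E.
move=> N N' NN'; apply/subsetPset => w [mk _ /andP[km]]; rewrite negb_forall => /existsP[i iN].
exists mk => //=; rewrite km/= negb_forall; apply/existsP; exists i; apply: contra iN => iN.
by rewrite (le_trans iN)// ler_nat.
Qed.

(** Order of choices: the box [N] from the accuracy, the step size [r] from the box, the grid from
    [r]. The stopped steps contribute at most e (T - t), and the rest is bounded by [A] on a set of
    probability below [e]. *)
Lemma defect_mean : \int[P]_w martingale_defect t T w = 0.
Proof.
pose A := C + C + CG * (T - t).
have [_ dA] := measurable_defect (lexx t) tT (lexx T).
have A0 : 0 <= A by exact: le_trans (normr_ge0 _) (dA point).
apply/eqP; rewrite -normr_eq0 eq_le normr_ge0 andbT.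
apply/ler_addgt0Pr => eps eps0; rewrite add0r.
(* The total error is A e + e (T - t); the added 1 keeps the denominator positive. *)
pose e := eps / (T - t + A + 1).
have c0 : 0 < T - t + A + 1 by rewrite ltr_pwDr// addr_ge0// subr_ge0.
have e0 : 0 < e by rewrite divr_gt0.
have [N _ /(_ N (leqnn N)) PN] := cvge0_near excess_cvg e0.
have [r r0 step] := defect_step N%:R e0.
pose m := Num.truncn ((T - t) / r).
have mr : (T - t) / m.+1%:R < r.
  by rewrite ltr_pdivrMr// mulrC -ltr_pdivrMr// truncnS_gt.
pose z w k := stopped N%:R m k w; pose Z k w : R := (z w k)%:R.
pose phi k w := martingale_defect t (grid m k) w.
pose dfc k w := martingale_defect (grid m k) (grid m k.+1) w.
have gin k : (k < m.+1)%N -> [/\ t <= grid m k, grid m k <= grid m k.+1 & grid m k.+1 <= T].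
  move=> km; have /andP[h1 _] := grid_in (ltnW km); have /andP[_ h2] := grid_in km.
  by split => //; exact: grid_le.
have dphi k w : (k < m.+1)%N -> dfc k w = phi k.+1 w - phi k w.
  by move=> /gin[h1 h2 h3]; rewrite /phi (defect_add w (lexx t) h1 h2 h3) addrC addKr.
have rdef a b : t <= a -> a <= b -> b <= T -> rint (martingale_defect a b).
  move=> ta ab bT; have [md bd] := measurable_defect ta ab bT.
  exact: prob_rint_bounded md bd.
have rZ k : (k < m.+1)%N -> rint (fun w => Z k w * dfc k w).
  move=> km; have [h1 h2 h3] := gin k km.
  apply: (rintMb _ _ (k := 1)) => //; last exact: rdef.
    apply: (Fmeas_measurable hF _ (Fmeas_stopped N%:R (ltnW km))).
    by rewrite (le_trans t0 h1) (le_trans h2).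
  by move=> w _; rewrite /Z; case: (z w k); rewrite ?normr1// normr0.
have rS : rint (fun w => \sum_(k < m.+1) Z k w * dfc k w).
  by apply: rint_sum => // k _; exact: rZ.
(* The defect accumulated after the discrete exit from the box: at most [A], and zero unless the
   outcome lies in [excess N]. *)
pose Re w := martingale_defect t T w - \sum_(k < m.+1) Z k w * dfc k w.
have ReE w : exists k, [/\ (k <= m.+1)%N, (z w m -> k = m.+1) & Re w = phi m.+1 w - phi k w].
  have [k [km zk E]] := stopped_sum (phi^~ w) m.+1 (fun k => @stopped_step N%:R m k w).
  exists k; split => //; rewrite -E /Re.
  have phi0 : phi 0%N w = 0.
    have := defect_add w (lexx t) (lexx t) tT (lexx T); rewrite /phi grid0.
    by move=> /eqP; rewrite -subr_eq subrr eq_sym => /eqP.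
  have -> : martingale_defect t T w = \sum_(k < m.+1) dfc k w.
    rewrite (eq_bigr (fun k : 'I_m.+1 => phi k.+1 w - phi k w)) => [|j _]; last exact: dphi.
    rewrite -(big_mkord xpredT (fun k => phi k.+1 w - phi k w)) telescope_sumr// phi0 subr0.
    by rewrite /phi grid_last.
  rewrite -sumrB; apply: eq_bigr => j _; rewrite -dphi// /Z /z.
  by case: stopped; rewrite /= ?mul1r ?mul0r ?subrr ?subr0.
have CG0 : 0 <= CG by apply: le_trans (normr_ge0 _) (GC (s := t) point _); rewrite lexx.
have ReA w : `|Re w| <= A * \1_(excess N) w.
  have [k [km zk ->]] := ReE w.
  have /andP[h1 h2] := grid_in km.
  have dE : phi m.+1 w - phi k w = martingale_defect (grid m k) T w.
    by rewrite /phi grid_last (defect_add w (lexx t) h1 h2 (lexx T)) addrC addKr.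
  rewrite indicE; have [wN|wN] := boolP (w \in excess N).
    rewrite mulr1 dE; have [_ bd] := measurable_defect h1 h2 (lexx T).
    by apply: le_trans (bd w) _; rewrite /A lerD2l ler_wpM2l// lerB.
  rewrite zk ?subrr ?normr0 ?mulr0//; apply/forallP => j; apply: contraNT wN => jN.
  rewrite inE; exists (m, val j) => //=.
  by rewrite jN andbT (leq_trans (leq_ord j)).
have rRe : rint Re by apply: rintB => //; exact: rdef.
have rI : rint (\1_(excess N)) by apply: integrable_indic => //; exact: measurable_excess.
have -> : \int[P]_w martingale_defect t T w =
    \int[P]_w Re w + \sum_(k < m.+1) \int[P]_w (Z k w * dfc k w).
  rewrite -Eint_sum// => [|k _]; last exact: rZ.
  by rewrite -EintD//; apply: eq_Rintegral => w _; rewrite /Re subrK.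
apply: (@le_trans _ _ (A * e + e * (T - t))); last first.
  rewrite /e mulrC -mulrDr mulrAC ler_pdivrMr// ler_pM2l//; lra.
apply: le_trans (ler_normD _ _) (lerD _ _).
  apply: le_trans (le_norm_Eint _ rRe) _ => //.
  apply: (@le_trans _ _ (\int[P]_w (A * \1_(excess N) w))).
    by apply: le_Eint => //; [exact: rint_norm|exact: rintZ].
  rewrite EintZ// ler_wpM2l// -lee_fin -Eint_EFin// integral_indic ?setIT//; last exact: measurable_excess.
  exact: ltW.
apply: le_trans (ler_norm_sum _ _ _) _.
apply: (@le_trans _ _ (\sum_(k < m.+1) e * ((T - t) / m.+1%:R))); last first.
  by rewrite sumr_const card_ord -[X in X <= _]mulr_natr -mulrA divfK.
apply: ler_sum => k _; have [h1 h2 h3] := gin k (ltn_ord k).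
rewrite -(grid_step m k); apply: step => //; first by rewrite grid_step.
- exact: Fmeas_stopped (ltnW (ltn_ord k)).
- by move=> w; rewrite /Z; case: (z w k); rewrite /= ?ler01 ?lexx.
move=> w; rewrite /Z pnatr_eq0 eqb0 negbK => /forallP h i.
exact: (forallP (h ord_max) i).
Qed.

End dynkin.
End ito_process.

(** * Measurability of continuous functions of measurable data *)

Section factorization.
Context d (S : measurableType d) (R : realType) (I : finType) (D : set S).
Context (Y : I -> S -> R) (mY : forall i, measurable_fun D (Y i)).

(* The sublevel and superlevel sets of [f] are preimages under [Y] of open sets, namely of
   unions of balls. *)
Lemma measurable_factor (f : S -> R) :
  (forall x, D x -> forall e, 0 < e -> exists2 r, 0 < r & forall x', D x' ->
     (forall i, `|Y i x' - Y i x| < r) -> `|f x' - f x| < e) ->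
  measurable_fun D f.
Proof.
move=> cf mD; pose V x : 'cV[R]_#|I| := \col_k Y (enum_val k) x.
have mV : measurable_fun D (V : S -> borel 'cV[R]_#|I|).
  by apply: measurable_fun_borel => k j; under eq_fun do rewrite mxE; exact: mY.
move: (mD); apply: (measurability _ (RGenOpens.measurableE R)) => _ [_ [a [b ->] <-]].
pose U := [set v | exists2 x, D x & exists2 r, 0 < r & (ball (V x) r)^° v /\
  forall x', D x' -> (forall i, `|Y i x' - Y i x| < r) -> f x' \in `]a, b[].
have oU : open U.
  rewrite openE => v [x Dx [r r0 [vr h]]]; apply/nbhs_ballP.
  have := @open_interior _ (ball (V x) r); rewrite openE => /(_ v vr) /nbhs_ballP[q q0 qP].
  by exists q => // v' /qP v'r; exists x => //; exists r.
have -> : D `&` f @^-1` `]a, b[ = D `&` V @^-1` U.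
  apply/seteqP; split => [x [Dx fx]|x [Dx [x0 Dx0 [r r0 [/interior_subset[_ vr] h]]]]]; split => //; last first.
    apply: h => // i; have := vr (enum_rank i) 0.
    by rewrite !mxE enum_rankK distrC.
  move: fx; rewrite /preimage/= in_itv/= => /andP[afx fxb]; exists x => //.
  have [|r r0 rP] := cf x Dx (Num.min (f x - a) (b - f x)).
    by rewrite lt_min !subr_gt0 afx.
  exists r => //; split; first exact: nbhsx_ballx.
  move=> x' Dx' x'r; have := rP x' Dx' x'r; rewrite lt_min !ltr_norml in_itv/=; lra.
by apply: mV => //; exact: sub_sigma_algebra.
Qed.

End factorization.

Section matrix_entries.
Context (R : realType) (m n : nat).
Implicit Types (A : 'M[R]_(m, n)).

Lemma entry_le_norm A i j : `|A i j| <= `|A|.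
Proof.
rewrite /Num.norm/= mx_normrE; exact: (@le_bigmax _ _ _ _ (fun k => `|A k.1 k.2|) (i, j)).
Qed.

Lemma norm_sqr_le A : `|A| ^+ 2 <= \sum_i \sum_j A i j ^+ 2.
Proof.
have S0 : 0 <= \sum_i \sum_j A i j ^+ 2 by do 2 (apply: sumr_ge0 => ? _); exact: sqr_ge0.
have [->|/mx_norm_neq0[[i j]]] := eqVneq `|A| 0; first by rewrite expr0n.
rewrite /Num.norm/= => ->; rewrite real_normK ?num_real// (bigD1 i)//= (bigD1 j)//= -addrA.
rewrite lerDl addr_ge0//; first by apply: sumr_ge0 => ? _; exact: sqr_ge0.
by do 2 (apply: sumr_ge0 => ? _); exact: sqr_ge0.
Qed.

Lemma enorm_le_sum A : enorm A <= \sum_i \sum_j `|A i j|.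
Proof.
have S0 : 0 <= \sum_i \sum_j `|A i j| by do 2 (apply: sumr_ge0 => ? _).
rewrite -ler_sqr ?nnegrE ?sqrtr_ge0// enorm_sqr expr2 mulr_suml; apply: ler_sum => i _.
rewrite mulr_suml; apply: ler_sum => j _; rewrite -(real_normK (num_real (A i j))) expr2.
apply: ler_wpM2l => //; rewrite (bigD1 i)//= (bigD1 j)//= -addrA lerDl addr_ge0//.
  by apply: sumr_ge0.
by do 2 (apply: sumr_ge0 => ? _).
Qed.

End matrix_entries.

(** * Bounds and regularity of the coefficients *)

Section regular_coefficients.
Context (R : realType) (T : R) (p m n : nat) (c : R -> 'cV[R]_p -> 'M[R]_(m, n)).
Context (hc : C1_bounded_coef T c) (ht : half_holder T c).

Lemma coef_bounded : exists K, forall (s : R) y i j, 0 <= s <= T -> `|c s y i j| <= K.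
Proof.
have [K h] := hc; exists K => s y i j /h[_ _ b _]; exact: le_trans (entry_le_norm _ _ _) (b y).
Qed.

(** Time is changed first, by the Hölder hypothesis, and then space, by the mean value theorem on
    the segment from [y'] to [y] with the bound on directional derivatives. *)
Lemma coef_holder : exists K, forall (s s' : R) y y' i j, 0 <= s <= T -> 0 <= s' <= T ->
  (c s y i j - c s' y' i j) ^+ 2 <= K * (`|s - s'| + \sum_k (y k 0 - y' k 0) ^+ 2).
Proof.
have [K h] := hc; have [L hL] := ht.
exists (2 * (L ^+ 2 + K ^+ 2)) => s s' y y' i j sT s'T.
have b1 : (c s y i j - c s' y i j) ^+ 2 <= L ^+ 2 * `|s - s'|.
  have e0 : `|c s y i j - c s' y i j| <= L * Num.sqrt `|s - s'|.
    apply: le_trans (hL s s' y sT s'T); apply: le_trans (entry_le_enorm _ i j).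
    by rewrite !mxE.
  rewrite -(real_normK (num_real (_ - _))).
  rewrite -[X in _ <= _ * X](sqr_sqrtr (normr_ge0 _)) -exprMn ler_sqr ?nnegrE//.
  exact: le_trans e0.
have [df _ _ bD] := h s' s'T.
have b2 : (c s' y i j - c s' y' i j) ^+ 2 <= K ^+ 2 * \sum_k (y k 0 - y' k 0) ^+ 2.
  pose v := y - y'.
  have dv z : is_derive z v (fun y => c s' y i j) ('D_v (c s') z i j).
    have dz : derivable (c s') z v by exact: diff_derivable.
    apply: DeriveDef; first exact: ((derivable_mxP _ _ _).1 dz).
    by rewrite derive_mx// mxE.
  have [q _ E] := MVT0 1 (fun q => is_derive_line (dv (y' + q *: v))).
  have yE : y' + v = y by rewrite addrC subrK.
  rewrite scale1r scale0r addr0 mulr1 yE in E.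
  rewrite E; set dc := ('D_v (c s') _) i j; rewrite -(real_normK (num_real dc)).
  have : `|'D_v (c s') (y' + q *: v) i j| <= K * `|v|.
    exact: le_trans (entry_le_norm _ _ _) (bD _ _).
  move=> le; have Kv : 0 <= K * `|v| by exact: le_trans le.
  apply: le_trans (_ : (K * `|v|) ^+ 2 <= _); first by rewrite ler_sqr ?nnegrE.
  rewrite exprMn ler_wpM2l ?sqr_ge0//; apply: le_trans (norm_sqr_le v) _.
  by apply: ler_sum => k _; rewrite big_ord1 !mxE.
have S0 : 0 <= \sum_k (y k 0 - y' k 0) ^+ 2 by exact: sum_sqr_ge0.
have := mulr_ge0 (sqr_ge0 L) S0; have := mulr_ge0 (sqr_ge0 K) (normr_ge0 (s - s')).
have := sqr_ge0 (c s y i j - c s' y i j - (c s' y i j - c s' y' i j)).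
move: b1 b2; nra.
Qed.

Lemma coef_scont i j : scont T (fun s y => c s y i j).
Proof.
have [K hK] := coef_holder.
apply: (@holder_scont R T p (fun s y => c s y i j) K) => s s' y y' sT s'T.
exact: (hK s s' y y' i j sT s'T).
Qed.

End regular_coefficients.

(** * Modification of processes on a null set *)

Section modification.
Context d (Omega : measurableType d) (R : realType) (P : probability Omega R).
Context (T : R) (F : R -> set (set Omega)) (hF : filtration P T F).
Context (N : set Omega) (mN : measurable N) (N0 : P N = 0%E).
Local Notation D a b := (`[a, b]%classic `*` [set: Omega] : set (measurableTypeR R * Omega)).

Lemma null_adapted s : 0 <= s <= T -> F s N.
Proof.
have [_ inc _ null] := hF; move=> /andP[s0 sT]; exact: (inc 0 s (lexx 0) s0 sT _ (null N mN N0)).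
Qed.

Definition patch_null (V : Type) (Y Y' : Omega -> V) w := if w \in N then Y' w else Y w.

Lemma patch_nullE (Y Y' : Omega -> R) :
  patch_null Y Y' = (fun w => \1_(~` N) w * Y w + \1_N w * Y' w).
Proof.
apply/funext => w; rewrite /patch_null !indicE in_setC; case: (w \in N).
  by rewrite mul0r add0r mul1r.
by rewrite mul1r mul0r addr0.
Qed.

Lemma Fmeas_patch s (Y Y' : Omega -> R) : 0 <= s <= T -> Fmeas (F s) Y -> Fmeas (F s) Y' ->
  Fmeas (F s) (patch_null Y Y').
Proof.
move=> sT FY FY'; rewrite patch_nullE.
have mNs : measurable (N : set (g_sigma_algebraType (F s))).
  by apply: sub_sigma_algebra; exact: null_adapted.
have i1 : Fmeas (F s) (\1_(~` N) : Omega -> R) := measurable_indic (measurableC mNs).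
have i2 : Fmeas (F s) (\1_N : Omega -> R) := measurable_indic mNs.
exact: (measurable_funD (measurable_funM i1 FY) (measurable_funM i2 FY')).
Qed.

(** The same simple processes still approximate, since the distances ignore the null set.
    Adaptedness survives because null sets belong to the initial sigma-algebra. *)
Lemma ito_integral_patch (d0 m : nat) (B : R -> Omega -> 'cV[R]_d0) (a b : R)
    (H H' : R -> Omega -> 'M[R]_(m, d0)) (I : Omega -> 'cV[R]_m) : 0 <= a -> b <= T ->
  (forall i j, measurable_fun (D a b) (fun p => H' p.1 p.2 i j)) ->
  (forall s i j, a <= s <= b -> Fmeas (F s) (fun w => H' s w i j)) ->
  ito_integral P F B a b H I ->
  ito_integral P F B a b (fun s => patch_null (H s) (H' s)) I.
Proof.
move=> a0 bT mH' FH' [[mH aH sH] mI [S [S1 S2 S3]]].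
have sqE (G : R -> Omega -> 'M[R]_(m, d0)) :
    sq_norm P a b (fun s w => patch_null (H s) (H' s) w - G s w) =
    sq_norm P a b (fun s w => H s w - G s w).
  apply: (integral_off_null mN N0) => w _ wN; apply: eq_integral => s _.
  by rewrite /patch_null memNset.
split; [|exact: mI|]; last first.
  exists S; split; [exact: S1| |exact: S3]; apply: cvg_trans S2; apply: near_eq_cvg; apply: nearW => k.
  exact: (esym (sqE (sp_eval (S k)))).
split.
- move=> i j.
  have -> : (fun p : measurableTypeR R * Omega => patch_null (H p.1) (H' p.1) p.2 i j) =
      (fun p => \1_(~` N) p.2 * H p.1 p.2 i j + \1_N p.2 * H' p.1 p.2 i j).
    apply/funext => p; rewrite /patch_null !indicE in_setC; case: (p.2 \in N).
      by rewrite mul0r add0r mul1r.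
    by rewrite mul1r mul0r addr0.
  have i1 : measurable_fun (D a b) (fun p => \1_(~` N) p.2 : R).
    apply: measurable_funTS; apply: (measurableT_comp _ measurable_snd).
    by apply: measurable_indic; exact: measurableC.
  have i2 : measurable_fun (D a b) (fun p => \1_N p.2 : R).
    by apply: measurable_funTS; exact: (measurableT_comp (measurable_indic mN) measurable_snd).
  exact: (measurable_funD (measurable_funM i1 (mH i j)) (measurable_funM i2 (mH' i j))).
- move=> s sab i j; have sT : 0 <= s <= T.
    by case/andP: sab => as_ sb; rewrite (le_trans a0 as_) (le_trans sb).
  move=> U mU.
  rewrite (_ : [set w | _] = patch_null (fun w => H s w i j) (fun w => H' s w i j) @^-1` U); last first.
    by apply/seteqP; split => w /=; rewrite /preimage/= /patch_null; case: ifP.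
  have h : Fmeas (F s) (patch_null (fun w => H s w i j) (fun w => H' s w i j)).
    apply: Fmeas_patch => //; last exact: FH'.
    by apply/(FmeasP hF _ sT) => V mV; exact: (aH s sab i j V mV).
  exact: ((FmeasP hF _ sT).1 h U mU).
have -> : sq_norm P a b (fun s => patch_null (H s) (H' s)) = sq_norm P a b H; last exact: sH.
apply: (integral_off_null mN N0) => w _ wN; apply: eq_integral => s _.
by rewrite /patch_null memNset.
Qed.

End modification.

Lemma measurable_pair_on d1 d2 d3 (X : measurableType d1) (Y : measurableType d2)
    (Z : measurableType d3) (D : set X) (f : X -> Y) (g : X -> Z) :
  measurable_fun D f -> measurable_fun D g -> measurable_fun D (fun x => (f x, g x)).
Proof.
move=> mf mg mD; move: (mD).
apply: (measurability _ (measurable_prod_measurableType Y Z)) => _ [_ [A mA [B mB <-]] <-].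
rewrite (_ : D `&` _ = (D `&` f @^-1` A) `&` (D `&` g @^-1` B)).
  by apply: measurableI; [exact: mf|exact: mg].
by apply/seteqP; split => [x [Dx [/= Ax Bx]]|x [[Dx Ax] [_ Bx]]].
Qed.

(** * Integrals over the jump marks *)

Section jump_integrals.
Context d (S : measurableType d) (R : realType) (D : set S) (mD : measurable D) (dz : nat).
Context (nu : {measure set (borel 'cV[R]_dz) -> \bar R}) (nu1 : nu (@punctured R dz) = 1%E).
Local Notation pt := (@punctured R dz : set (borel 'cV[R]_dz)).

Lemma measurable_punctured : measurable pt.
Proof.
apply: sub_sigma_algebra; rewrite (_ : punctured = ~` [set 0]).
  by apply: closed_openC; apply: accessible_closed_set1; apply: hausdorff_accessible; exact: norm_hausdorff.
by apply/seteqP; split => z /=; [move/eqP|move=> /eqP].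
Qed.

Lemma jump_lty : (nu pt < +oo)%E. Proof. by rewrite nu1 ltry. Qed.

(** Measurability of an integral in its parameter is extracted from Fubini's theorem, which wants
    sigma-finite measures on both factors; the next choices supply them. *)
Lemma jump_integral_measurable (psi : S -> 'cV[R]_dz -> R) K :
  measurable_fun (D `*` pt) (fun q => psi q.1 q.2) ->
  (forall p z, D p -> punctured z -> `|psi p z| <= K) ->
  measurable_fun D (fun p => \int[nu]_(z in @punctured R dz) psi p z).
Proof.
move=> mpsi psiK.
(* Nothing is known of the mass of [nu] at the origin, so [nu] is cut down to a finite measure. *)
pose nu' := mfrestr measurable_punctured jump_lty.
have nuE (f : 'cV[R]_dz -> R) : \int[nu]_(z in @punctured R dz) f z = \int[nu']_(z in pt) f z.
  rewrite /Rintegral; congr fine; apply: eq_measure_integral => A mA Apt.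
  by rewrite /nu' /= /mfrestr /mrestr setIidl.
pose g := (fun q : S * borel 'cV[R]_dz => psi q.1 q.2) \_ (D `*` pt).
have mDp : measurable (D `*` pt) by apply: measurableX => //; exact: measurable_punctured.
have mg : measurable_fun setT g by apply/(measurable_restrictT _ mDp).
have gK q : `|g q| <= `|K|.
  rewrite /g patchE; case: ifPn => [/set_mem[Dq pq]|_]; last by rewrite normr0.
  by apply: le_trans (psiK _ _ Dq pq) (ler_norm K).
pose f (q : borel 'cV[R]_dz * S) := g (q.2, q.1).
have mf : measurable_fun setT f.
  by apply: (measurableT_comp mg); apply: measurable_pair_on => //.
have fK q : `|f q| <= `|K| by exact: gK.
have mp := measurable_punctured.
(* The parameter space has no measure of its own. Any finite one serves, since the measurability
   obtained does not refer to it; a Dirac mass is at hand. *)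
have fin : ((nu' \x @dirac _ S point R)%E (pt `*` [set: S]) < +oo)%E.
  rewrite product_measure1E//; apply: lte_mul_pinfty => //.
    by rewrite ge0_fin_numE// /nu' /= /mfrestr /mrestr setIid jump_lty.
  by rewrite -ge0_fin_numE//; exact: fin_num_measure.
have rf : rintegrable (nu' \x @dirac _ S point R)%E (pt `*` [set: S]) f.
  apply: (@rint_bounded _ _ _ _ _ _ _ `|K|) => //; [exact: measurableX|exact: measurable_funTS].
have rs y : rintegrable nu' pt (fun z => f (z, y)).
  apply: (@rint_bounded _ _ _ _ _ _ _ `|K|) => //.
    by rewrite /nu' /= /mfrestr /mrestr setIid jump_lty.
  by apply: measurable_funTS; apply: (measurableT_comp mf); exact: measurable_pair_on.
have [m _] := strip_measurable mp rf rs.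
apply: (eq_measurable_fun (fun p => \int[nu']_(z in pt) f (z, p))); last exact: measurable_funTS.
move=> p /set_mem Dp; rewrite nuE; apply: eq_Rintegral => z /set_mem pz.
by rewrite /f /g patchE mem_set.
Qed.

Lemma jump_integral_bound (psi : 'cV[R]_dz -> R) K : 0 <= K -> measurable_fun pt psi ->
  (forall z, punctured z -> `|psi z| <= K) -> `|\int[nu]_(z in @punctured R dz) psi z| <= K.
Proof.
move=> K0 mpsi psiK; have mp := measurable_punctured.
have rp : rintegrable nu pt psi by apply: (@rint_bounded _ _ _ _ _ _ _ K) => //; exact: jump_lty.
apply: le_trans (le_norm_Eint mp rp) _.
have -> : K = \int[nu]_(z in @punctured R dz) K by rewrite Eint_cst// nu1 mulr1.
by apply: le_Eint => //; [exact: rint_norm|apply: rint_cst => //; exact: jump_lty].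
Qed.

End jump_integrals.

(** * Paths continuous for every outcome *)

Section nice_paths.
Context d (Omega : measurableType d) (R : realType) (P : probability Omega R).
Context (T : R) (F : R -> set (set Omega)) (hF : filtration P T F).
Context (n : nat) (t : R) (tT : 0 <= t <= T).
Local Notation D a b := (`[a, b]%classic `*` [set: Omega] : set (measurableTypeR R * Omega)).

Definition nice_path (X : R -> Omega -> 'cV[R]_n) :=
  (forall s i, t <= s <= T -> Fmeas (F s) (fun w => X s w i 0)) /\
  (forall w i, {within `[t, T], continuous (fun s => X s w i 0)}).

(** One null set collects the discontinuous paths and those with the wrong start; there the path is
    replaced by the constant [x], which is continuous and adapted. *)
Lemma nice_modification (X : R -> Omega -> 'cV[R]_n) (x : 'cV[R]_n) :
  adapted F t T X -> continuous_paths P t T X -> {ae P, forall w, X t w = x} ->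
  exists N, [/\ measurable N, P N = 0%E,
    nice_path (fun s => patch_null N (X s) (fun=> x)) &
    forall w, patch_null N (X t) (fun=> x) w = x].
Proof.
move=> aX cX iX; have [N [mN N0 hN]] := filterI cX iX.
have good w : w \notin N -> {within `[t, T], continuous (fun s => X s w)} /\ X t w = x.
  by move=> /negP wN; apply: contrapT => h; apply: wN; apply/mem_set/hN.
exists N; split => //; last first.
  by move=> w; rewrite /patch_null; case: ifPn => // /good[].
split.
  move=> s i sT; have /andP[t0 _] := tT.
  have s0T : 0 <= s <= T by case/andP: sT => ts ->; rewrite (le_trans t0).
  have -> : (fun w => patch_null N (X s) (fun=> x) w i 0) =
      patch_null N (fun w => X s w i 0) (fun=> x i 0).
    by apply/funext => w; rewrite /patch_null; case: ifP.
  apply: (Fmeas_patch hF mN N0 s0T); last exact: measurable_cst.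
  by apply/(FmeasP hF _ s0T) => U mU; exact: aX.
move=> w i; rewrite /patch_null; have [wN|/good[cw _]] := boolP (w \in N).
  by apply: continuous_subspaceT => s; exact: cvg_cst.
apply/subspace_continuousP => s sT; have /subspace_continuousP/(_ s sT) h := cw.
exact: cvg_entry h.
Qed.

Context (X : R -> Omega -> 'cV[R]_n) (nX : nice_path X).

Lemma nice_coord_measurable i : measurable_fun (D t T) (fun p => X p.1 p.2 i 0).
Proof.
have [FX cX] := nX; have /andP[t0 _] := tT.
apply: (@caratheodory_measurable _ _ _ _ _ _ (fun s w => X s w i 0)) => // s sT.
apply: (Fmeas_measurable hF _ (FX s i sT)).
by case/andP: sT => ts ->; rewrite (le_trans t0).
Qed.

Lemma nice_along (c : R -> 'cV[R]_n -> R) : scont T c ->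
  measurable_fun (D t T) (fun p => c p.1 (X p.1 p.2)).
Proof.
move=> cc; have /andP[t0 _] := tT.
(* [None] stands for the time coordinate, so that [c] is a continuous function of the whole family
   [Y]. *)
pose Y (o : option 'I_n) (p : measurableTypeR R * Omega) : R :=
  if o is Some i then X p.1 p.2 i 0 else p.1.
have mY o : measurable_fun (D t T) (Y o).
  case: o => [i|]; first exact: nice_coord_measurable.
  by rewrite /Y; apply: measurable_funTS; exact: measurable_fst.
apply: (measurable_factor mY) => -[s w] [/= sT _] e e0.
have inT r : `[t, T]%classic r -> 0 <= r <= T.
  by rewrite /= in_itv/= => /andP[tr ->]; rewrite (le_trans t0).
have [r r0 rP] := cc s (X s w) (inT _ sT) e e0.
exists r => // -[s' w'] [/= s'T _] h; apply: rP => //; first exact: inT.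
  exact: (h None).
by move=> i; exact: (h (Some i)).
Qed.

Lemma nice_section (f : R * Omega -> R) K w : measurable_fun (D t T) f ->
  (forall s, t <= s <= T -> `|f (s, w)| <= K) ->
  rintegrable (@lebesgue_measure R) `[t, T] (fun s => f (s, w)).
Proof.
by move=> mf fK; apply: (@seg_rint_bounded _ _ _ _ K) => //; exact: measurable_section.
Qed.

End nice_paths.

(** * Jump terms along a path: measurability and bounds *)

Section jumps_along.
Context d (Omega : measurableType d) (R : realType) (P : probability Omega R).
Context (T : R) (F : R -> set (set Omega)) (hF : filtration P T F).
Context (n dz : nat) (t : R) (tT : 0 <= t <= T).
Context (X : R -> Omega -> 'cV[R]_n) (nX : nice_path T F t X).
Context (h : R -> 'cV[R]_n -> 'cV[R]_dz -> 'cV[R]_n) (lam : R -> 'cV[R]_n -> R) (eta : R).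
Context (nu : {measure set (borel 'cV[R]_dz) -> \bar R}) (nu1 : nu (@punctured R dz) = 1%E).
Context (hlam : intensity T lam eta) (hh : jump_bounds T h) (hhm : jump_measurable T h).
Local Notation D a b := (`[a, b]%classic `*` [set: Omega] : set (measurableTypeR R * Omega)).
Local Notation pt := (@punctured R dz : set (borel 'cV[R]_dz)).

Lemma intensity_bound s y : 0 <= s <= T -> 0 <= lam s y <= eta.
Proof.
move=> sT; have [_ l0 _ le] := hlam; rewrite l0//= -lee_fin -le.
by apply: ereal_sup_ubound; exists (s, y).
Qed.

Lemma jump_bounded : exists2 K, 0 <= K & forall s y z i, 0 <= s <= T -> punctured z ->
  `|h s y z i 0| <= K.
Proof.
have [K K0 hK] := hh; exists K; first exact: ltW.
move=> s y z i sT pz; have [h1 _] := hK s y y z sT pz.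
apply: le_trans (entry_le_enorm _ i 0) _; apply: le_trans h1 _.
by rewrite ler_piMr ?(ltW K0)// ge_min lexx.
Qed.

Lemma jump_section s y i : 0 <= s <= T -> measurable_fun pt (fun z => h s y z i 0).
Proof.
move=> sT; have mp := measurable_punctured (dz := dz) (R := R).
have mf : measurable_fun pt (fun z : borel 'cV[R]_dz => ((s : measurableTypeR R, y : borel 'cV[R]_n), z)).
  by apply: measurable_pair_on => //; exact: measurable_cst.
apply: (measurable_comp _ _ (hhm i) mf); last by move=> _ [z pz <-].
rewrite (_ : [set p | _] = (`[0, T]%classic `*` setT) `*` pt).
  by apply: measurableX => //; exact: measurableX.
by apply/seteqP; split => [[[r v] z] /= [rT pz]|[[r v] z] /= [[rT _] pz]]; split => //=;
  move: rT; rewrite in_itv.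
Qed.

Local Notation E := (D t T `*` pt).

Let in0T s : `[t, T]%classic s -> 0 <= s <= T.
Proof. by rewrite /= in_itv/= => /andP[ts ->]; have /andP[t0 _] := tT; rewrite (le_trans t0). Qed.

Let mE : measurable (E : set (measurableTypeR R * Omega * borel 'cV[R]_dz)).
Proof. by apply: measurableX; [exact: measurable_strip|exact: measurable_punctured]. Qed.

Lemma fst_along (f : measurableTypeR R * Omega -> R) : measurable_fun (D t T) f ->
  measurable_fun (E : set (measurableTypeR R * Omega * borel 'cV[R]_dz)) (fun q => f q.1).
Proof.
move=> mf; apply: (measurable_comp (measurable_strip t T) _ mf).
  by move=> _ [q [Dq _] <-].
exact: measurable_funTS measurable_fst.
Qed.

Lemma jump_along i : measurable_fun (E : set (measurableTypeR R * Omega * borel 'cV[R]_dz))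
  (fun q => h q.1.1 (X q.1.1 q.1.2) q.2 i 0).
Proof.
have mX : measurable_fun (E : set (measurableTypeR R * Omega * borel 'cV[R]_dz))
    (fun q => X q.1.1 q.1.2 : borel 'cV[R]_n).
  apply: measurable_fun_borel => k l; rewrite (ord1 l).
  exact: (fst_along (nice_coord_measurable hF tT nX k)).
have mf : measurable_fun (E : set (measurableTypeR R * Omega * borel 'cV[R]_dz))
    (fun q => ((q.1.1, X q.1.1 q.1.2 : borel 'cV[R]_n), q.2)).
  apply: measurable_pair_on; last exact: measurable_funTS measurable_snd.
  apply: measurable_pair_on => //; apply: measurable_funTS.
  exact: (measurableT_comp measurable_fst measurable_fst).
apply: (measurable_comp _ _ (hhm i) mf); last first.
  by move=> _ [q [[q1 _] q2] <-]; split => //=; exact: in0T.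
rewrite (_ : [set p | _] = (`[0, T]%classic `*` setT) `*` pt).
  by apply: measurableX => //; [exact: measurableX|exact: measurable_punctured].
by apply/seteqP; split => [[[r v] z] /= [rT pz]|[[r v] z] /= [[rT _] pz]]; split => //=;
  move: rT; rewrite in_itv.
Qed.

Lemma lam_along : measurable_fun (D t T) (fun p => lam p.1 (X p.1 p.2)).
Proof. by apply: (nice_along hF tT nX); apply: within_scont; have [] := hlam. Qed.

Lemma compensator_along i :
  measurable_fun (D t T) (fun p => compensator nu h lam p.1 (X p.1 p.2) i 0).
Proof.
have [K K0 hK] := jump_bounded.
rewrite (_ : (fun p => _) = (fun p : measurableTypeR R * Omega =>
  \int[nu]_(z in @punctured R dz) (h p.1 (X p.1 p.2) z i 0 * lam p.1 (X p.1 p.2)))); last first.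
  by apply/funext => p; rewrite mxE.
apply: (jump_integral_measurable (measurable_strip t T) nu1 (K := K * eta)
  (psi := fun p z => h p.1 (X p.1 p.2) z i 0 * lam p.1 (X p.1 p.2))).
  by apply: measurable_funM; [exact: jump_along|exact: fst_along lam_along].
move=> p z [p1 _] pz; have /andP[l0 l1] := intensity_bound (X p.1 p.2) (in0T p1).
by rewrite normrM (ger0_norm l0) ler_pM// hK//; exact: in0T.
Qed.

Lemma compensator_bounded : exists K, forall s y i, 0 <= s <= T ->
  `|compensator nu h lam s y i 0| <= K.
Proof.
have [K K0 hK] := jump_bounded; have [e0 _ _ _] := hlam.
exists (K * eta) => s y i sT; rewrite mxE; have /andP[l0 l1] := intensity_bound y sT.
apply: (jump_integral_bound nu1); first exact: mulr_ge0.
  by apply: measurable_funM => //; exact: jump_section.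
by move=> z pz; rewrite normrM (ger0_norm l0) ler_pM// hK.
Qed.

Context (dy : nat) (phi : R -> 'cV[R]_n -> 'cV[R]_dy) (C : R).
Context (phi_scont : forall k, scont T (fun s y => phi s y k 0)).
Context (phi_bounded : forall s y k, 0 <= s <= T -> `|phi s y k 0| <= C).

Lemma gamma_along k : measurable_fun (D t T) (fun p => gamma nu h lam phi p.1 (X p.1 p.2) k 0).
Proof.
rewrite (_ : (fun p => _) = (fun p : measurableTypeR R * Omega =>
  \int[nu]_(z in @punctured R dz) ((phi p.1 (X p.1 p.2 + h p.1 (X p.1 p.2) z) k 0
     - phi p.1 (X p.1 p.2) k 0) * lam p.1 (X p.1 p.2)))); last first.
  by apply/funext => p; rewrite mxE.
apply: (jump_integral_measurable (measurable_strip t T) nu1 (K := (C + C) * eta)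
  (psi := fun p z => (phi p.1 (X p.1 p.2 + h p.1 (X p.1 p.2) z) k 0
     - phi p.1 (X p.1 p.2) k 0) * lam p.1 (X p.1 p.2))).
  apply: measurable_funM; last exact: fst_along lam_along.
  apply: measurable_funB; last exact: (fst_along (nice_along hF tT nX (phi_scont k))).
  (* The coordinates are time and position after the jump. They are jointly measurable even though
     [h] is not assumed continuous in the mark, and [phi] is continuous in them. *)
  pose Y (o : option 'I_n) (q : measurableTypeR R * Omega * borel 'cV[R]_dz) : R :=
    if o is Some i then X q.1.1 q.1.2 i 0 + h q.1.1 (X q.1.1 q.1.2) q.2 i 0 else q.1.1.
  have mY o : measurable_fun (E : set (measurableTypeR R * Omega * borel 'cV[R]_dz)) (Y o).
    case: o => [i|]; last by apply: measurable_funTS; exact: (measurableT_comp measurable_fst measurable_fst).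
    apply: measurable_funD; last exact: jump_along.
    exact: (fst_along (nice_coord_measurable hF tT nX i)).
  apply: (measurable_factor mY) => -[[s w] z] [[/= sT _] pz] e e0.
  have [r r0 rP] := phi_scont k (X s w + h s (X s w) z) (in0T sT) e0.
  exists r => // -[[s' w'] z'] [[/= s'T _] pz'] hr; apply: rP => //; first exact: in0T.
    exact: (hr None).
  by move=> i; rewrite !mxE; exact: (hr (Some i)).
move=> p z [p1 _] pz; have /andP[l0 l1] := intensity_bound (X p.1 p.2) (in0T p1).
rewrite normrM (ger0_norm l0) ler_pM//.
by apply: le_trans (ler_normB _ _) _; apply: lerD; apply: phi_bounded; exact: in0T.
Qed.

Lemma gamma_bounded s y k : 0 <= s <= T -> `|gamma nu h lam phi s y k 0| <= (C + C) * eta.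
Proof.
move=> sT; rewrite mxE; have /andP[l0 l1] := intensity_bound y sT.
have [e0 _ _ _] := hlam.
have C0 : 0 <= C by apply: le_trans (normr_ge0 _) (phi_bounded y k sT).
apply: (jump_integral_bound nu1); first by rewrite mulr_ge0// addr_ge0.
  apply: measurable_funM => //; apply: measurable_funB => //.
  have cphi := scont_section sT (phi_scont k).
  have mh : measurable_fun pt (fun z => y + h s y z : borel 'cV[R]_n).
    apply: measurable_fun_borel => i l; rewrite (ord1 l).
    under eq_fun do rewrite mxE; apply: measurable_funD => //; exact: jump_section.
  exact: (measurableT_comp (borel_continuous_measurable cphi) mh).
move=> z pz; rewrite normrM (ger0_norm l0) ler_pM//.
by apply: le_trans (ler_normB _ _) _; apply: lerD; exact: phi_bounded.
Qed.

End jumps_along.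

(** * Feynman-Kac formula for one linear equation *)

Section feynman_kac.
Context (R : realType) (T : R) (dx dy dz d0 : nat).
Context (d : measure_display) (Omega : measurableType d) (P : probability Omega R).
Context (F : R -> set (set Omega)) (hF : filtration P T F).
Context (B : R -> Omega -> 'cV[R]_d0) (hB : brownian_motion P T F B).
Context (b : R -> 'cV[R]_dx -> 'cV[R]_dx) (sigma : R -> 'cV[R]_dx -> 'M[R]_(dx, d0)).
Context (h : R -> 'cV[R]_dx -> 'cV[R]_dz -> 'cV[R]_dx) (lam : R -> 'cV[R]_dx -> R).
Context (nu : {measure set (borel 'cV[R]_dz) -> \bar R}) (nu1 : nu (@punctured R dz) = 1%E).
Context (hb : C1_bounded_coef T b) (hsigma : C1_bounded_coef T sigma).
Context (hbt : half_holder T b) (hsigmat : half_holder T sigma).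
Context (eta : R) (hlam : intensity T lam eta).
Context (hh : jump_bounds T h) (hhm : jump_measurable T h).
Local Notation mu := (@lebesgue_measure R).
Local Notation D a b := (`[a, b]%classic `*` [set: Omega] : set (measurableTypeR R * Omega)).
Context (t : R) (tT : 0 <= t <= T).

(** Links the almost sure notion of solution to [ito_process]. The null set does not depend on time,
    so off it whole paths agree, as do integrals along them. *)
Lemma sde_ito_process (X : R -> Omega -> 'cV[R]_dx) (x : 'cV[R]_dx) :
  solves_sde P T F B b sigma h lam nu t x X ->
  exists N X' Kb Ks Ls, [/\ measurable N, P N = 0%E,
    forall w, ~ N w -> forall s, X' s w = X s w,
    nice_path T F t X' &
    ito_process P T F B t x X' sigma
      (fun i s w => b s (X' s w) i 0 - compensator nu h lam s (X' s w) i 0) Kb Ks Ls].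
Proof.
move=> [aX cX iX sde]; have /andP[t0 _] := tT.
have [N [mN N0 nX' iX']] := nice_modification hF tT aX cX iX.
set X' := (fun s => patch_null N (X s) _) in nX'.
have off w : ~ N w -> forall s, X' s w = X s w.
  by move=> wN s; rewrite /X' /patch_null memNset.
have [Ks hKs] := coef_bounded hsigma.
have [Ls hLs] := coef_holder hsigma hsigmat.
have [K1 hK1] := coef_bounded hb.
have [K2 hK2] := compensator_bounded nu1 hlam hh hhm.
have inT s : t <= s <= T -> 0 <= s <= T.
  by move=> /andP[ts ->]; rewrite (le_trans t0 ts).
have mb i : measurable_fun (D t T) (fun p => b p.1 (X' p.1 p.2) i 0).
  exact: (nice_along hF tT nX' (coef_scont hb hbt i 0)).
have mc i : measurable_fun (D t T) (fun p => compensator nu h lam p.1 (X' p.1 p.2) i 0).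
  exact: (compensator_along hF tT nX' nu1 hlam hh hhm).
exists N, X', (K1 + K2), Ks, Ls; split => //.
have [FX' cX'] := nX'.
split => //.
- by move=> i; exact: (measurable_funB (mb i) (mc i)).
- move=> i s w /inT sT; apply: le_trans (ler_normB _ _) (lerD _ _); first exact: hK1.
  exact: hK2.
move=> r /andP[tr rT]; have [|I hI aeI] := sde r; first by rewrite tr.
exists I.
  (* On the null set the new integrand is [sigma s x], which is deterministic, so
     [ito_integral_patch] applies. *)
  have -> : (fun s w => sigma s (X' s w)) =
      (fun s => patch_null N (fun w => sigma s (X s w)) (fun=> sigma s x)).
    by apply/funext => s; apply/funext => w; rewrite /X' /patch_null; case: ifP.
  apply: (ito_integral_patch hF mN N0 (H := fun s w => sigma s (X s w))) => //.
    (* A constant path lets [nice_along] give measurability of the deterministic integrand in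
       time. *)
    move=> i j; pose X0 (s : R) (w : Omega) := x.
    have nX0 : nice_path T F t X0.
      split; first by move=> *; exact: measurable_cst.
      by move=> w l; apply: continuous_subspaceT => s; exact: cvg_cst.
    have m := nice_along hF tT nX0 (coef_scont hsigma hsigmat i j).
    apply: (measurable_funS (measurable_strip t T)) m => -[s w] [/= + _].
    by rewrite !in_itv/= => /andP[ts sr]; split => //=; rewrite ts (le_trans sr).
  by move=> *; exact: measurable_cst.
have aeN : {ae P, forall w, ~ N w}.
  by exists N; split => // w /= h'; apply: contrapT.
apply: filterS2 aeN aeI => w wN e i; rewrite (off w wN) e !mxE.
have sec (f : R * Omega -> R) K : measurable_fun (D t T) f ->
    (forall s, t <= s <= T -> `|f (s, w)| <= K) -> rintegrable mu `[t, r] (fun s => f (s, w)).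
  move=> mf fK; have := nice_section mf fK; apply: rintS => //.
  by apply: subset_itvl; rewrite bnd_simp.
have r1 := sec (fun p => b p.1 (X' p.1 p.2) i 0) K1 (mb i) (fun s sT => hK1 s (X' s w) i 0 (inT s sT)).
have r2 := sec (fun p => compensator nu h lam p.1 (X' p.1 p.2) i 0) K2 (mc i)
  (fun s sT => hK2 s (X' s w) i (inT s sT)).
rewrite /= in r1 r2; rewrite EintB//.
have -> : (fun s => b s (X' s w) i 0) = (fun s => b s (X s w) i 0).
  by apply/funext => s; rewrite off.
have -> : (fun s => compensator nu h lam s (X' s w) i 0) = (fun s => compensator nu h lam s (X s w) i 0).
  by apply/funext => s; rewrite off.
by rewrite -!addrA; congr (_ + (_ + _)); exact: addrC.
Qed.

Context (v : R -> 'cV[R]_dx -> 'cV[R]_dy) (v12 : C12 T v) (C : R).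
Context (vC : forall (s : R) y, 0 <= s <= T -> enorm (v s y) <= C) (k : 'I_dy).
Context (q : R -> 'cV[R]_dx -> R) (Q : R) (qQ : forall (s : R) y, 0 <= s <= T -> `|q s y| <= Q).
Context (mq : forall X, nice_path T F t X ->
  measurable_fun (D t T) (fun p => q p.1 (X p.1 p.2))).
Context (pde : forall (s : R) y, 0 <= s -> s < T ->
  pde_linear_part nu h lam T b sigma v s y k 0 + q s y = 0).

(** [Y] is tied to the modified path only at outcomes where it agrees with [X]. A caller can thus
    write [Y] in terms of [X], without showing it measurable or controlling it on the null set. *)
Lemma feynman_kac (X : R -> Omega -> 'cV[R]_dx) x (Y : Omega -> R) :
  solves_sde P T F B b sigma h lam nu t x X ->
  (forall X', nice_path T F t X' -> forall w, (forall s, X' s w = X s w) ->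
    Y w = v T (X' T w) k 0 + \int[mu]_(s in `[t, T]) q s (X' s w)) ->
  (v t x k 0)%:E = (\int[P]_w (Y w)%:E)%E.
Proof.
move=> sol YE; have /andP[t0 tT'] := tT.
have [N [X' [Kb [Ks [Ls [mN N0 off nX' ip]]]]]] := sde_ito_process sol.
have inT s : t <= s <= T -> 0 <= s <= T.
  by move=> /andP[ts ->]; rewrite (le_trans t0 ts).
have uC (s : R) y : 0 <= s <= T -> `|v s y k 0| <= C.
  by move=> sT; apply: le_trans (entry_le_enorm _ k 0) (vC y sT).
pose G s w := q s (X' s w).
have GQ s w : t <= s <= T -> `|G s w| <= Q by move=> /inT; exact: qQ.
have ssu := C12_strip_smooth k v12.
have mG := mq nX'.
have pde' (s : R) w : t <= s < T ->
  dtime T v s (X' s w) k 0 + \sum_i (b s (X' s w) i 0 - compensator nu h lam s (X' s w) i 0) *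
    jac (v s) (X' s w) k i + second_order (fun i j s x => hess (fun y => v s y k 0) x i j)
      (diff_coef sigma) s (X' s w) = - G s w.
  move=> /andP[ts sT]; have := pde (X' s w) (le_trans t0 ts) sT.
  move/eqP; rewrite addr_eq0 => /eqP <-; rewrite !mxE; congr (_ + _ + _ * _).
    by apply: eq_bigr => i _; rewrite !mxE.
  rewrite /mxtrace; apply: eq_bigr => i _; rewrite !mxE; apply: eq_bigr => l _.
  by rewrite !mxE /diff_coef; congr (_ * _); apply: eq_bigr => j _; rewrite mxE.
have dm := defect_mean hF hB ip ssu uC mG GQ pde'.
have [md bd] := measurable_defect hF ip ssu uC mG GQ (lexx t) tT' (lexx T).
have rd := prob_rint_bounded P md bd.
have [_ _ _ iX' _ _ _ _ _] := ip.
(* Off the null set [Y] is the defect plus the constant initial value, and the defect has mean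
   zero. *)
transitivity (\int[P]_w (martingale_defect X' (fun s y => v s y k 0) G t T w + v t x k 0)%:E)%E.
  rewrite Eint_EFin//; last by apply: rintD => //; exact: prob_rint_cst.
  by rewrite EintD//; [rewrite dm add0r prob_Eint_cst|exact: prob_rint_cst].
apply: (integral_off_null mN N0) => w _ wN; congr EFin.
rewrite (YE X' nX' w (off w wN)) /martingale_defect iX' /G; ring.
Qed.

End feynman_kac.

(** * Measurability of the driver along processes *)

Section driver.
Context (R : realType) (T : R) (dx dy d0 : nat).
Context (f : R -> 'cV[R]_dx -> 'cV[R]_dy -> 'M[R]_(dy, d0) -> 'cV[R]_dy -> 'cV[R]_dy).
Context (fL : lipschitz_driver T f) (fH : half_holder_driver T f).

(** The Lipschitz and Hölder bounds make the driver a continuous function of time and of all scalar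
    entries of its arguments, so [measurable_factor] applies. *)
Lemma driver_measurable d (S : measurableType d) (D : set S) (s : S -> R) (x : S -> 'cV[R]_dx)
    (y : S -> 'cV[R]_dy) (z : S -> 'M[R]_(dy, d0)) (u : S -> 'cV[R]_dy) k :
  (forall p, D p -> 0 <= s p <= T) -> measurable_fun D s ->
  (forall i, measurable_fun D (fun p => x p i 0)) ->
  (forall i, measurable_fun D (fun p => y p i 0)) ->
  (forall i j, measurable_fun D (fun p => z p i j)) ->
  (forall i, measurable_fun D (fun p => u p i 0)) ->
  measurable_fun D (fun p => f (s p) (x p) (y p) (z p) (u p) k 0).
Proof.
move=> sT ms mx my mz mu_; have [L hL] := fL; have [K hK] := fH.
pose Y (o : unit + 'I_dx + 'I_dy + 'I_dy * 'I_d0 + 'I_dy) p : R :=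
  match o with
  | inl (inl (inl (inl _))) => s p
  | inl (inl (inl (inr i))) => x p i 0
  | inl (inl (inr i)) => y p i 0
  | inl (inr ij) => z p ij.1 ij.2
  | inr i => u p i 0
  end.
have mY o : measurable_fun D (Y o) by case: o => [[[[[]|i]|i]|[i j]]|i]; rewrite /Y/=; [exact: ms|exact: mx|exact: my|exact: mz|exact: mu_].
apply: (measurable_factor mY) => p Dp e e0.
pose c : R := dx%:R + dy%:R + (dy * d0)%:R + dy%:R.
have c0 : 0 <= c by rewrite !addr_ge0.
(* Half of [e] for the Lipschitz part, where [c] counts the scalar entries; half for time, squared
   to undo the square root in the Hölder bound. *)
pose r1 := e / 2 / (`|L| * c + 1); pose r2 := (e / 2 / (`|K| + 1)) ^+ 2.
have Lc : 0 < `|L| * c + 1 by rewrite ltr_pwDr// mulr_ge0.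
have K1 : 0 < `|K| + 1 by rewrite ltr_pwDr.
have e2 : 0 < e / 2 by rewrite divr_gt0.
exists (Num.min r1 r2); first by rewrite lt_min !divr_gt0//= exprn_gt0// divr_gt0.
set r := Num.min r1 r2 => p' Dp' hr.
have r0 : 0 < r by rewrite lt_min !divr_gt0//= exprn_gt0// divr_gt0.
have small m n (A A' : 'M[R]_(m, n)) : (forall i j, `|A i j - A' i j| < r) ->
    enorm (A - A') <= (m * n)%:R * r.
  move=> AA; apply: le_trans (enorm_le_sum _) _.
  apply: (@le_trans _ _ (\sum_(i < m) \sum_(j < n) r)); last first.
    by rewrite !sumr_const !card_ord -mulrnA mulr_natl mulnC.
  by apply: ler_sum => i _; apply: ler_sum => j _; rewrite !mxE ltW.
have small1 n (A A' : 'cV[R]_n) : (forall i, `|A i 0 - A' i 0| < r) -> enorm (A - A') <= n%:R * r.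
  by move=> AA; rewrite -[n in n%:R]muln1; apply: small => i j; rewrite (ord1 j).
set g' := f (s p') (x p') (y p') (z p') (u p'); set g := f (s p) (x p) (y p) (z p) (u p).
pose gm := f (s p') (x p) (y p) (z p) (u p).
have E1 : `|g' k 0 - gm k 0| <= `|L| * (c * r).
  have := hL (s p') (x p') (x p) (y p') (y p) (z p') (z p) (u p') (u p) (sT _ Dp').
  set S' := enorm _ + _ + _ + _ => le.
  have S0 : 0 <= S' by rewrite !addr_ge0// sqrtr_ge0.
  have := le_trans (entry_le_enorm _ k 0) le; rewrite !mxE => h1.
  apply: le_trans h1 (le_trans (ler_wpM2r S0 (ler_norm L)) _); rewrite ler_wpM2l// /c !mulrDl.
  apply: lerD; last by apply: small1 => i; exact: (hr (inr i)).
  apply: lerD; last by apply: small => i j; exact: (hr (inl (inr (i, j)))).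
  apply: lerD; last by apply: small1 => i; exact: (hr (inl (inl (inr i)))).
  by apply: small1 => i; exact: (hr (inl (inl (inl (inr i))))).
have E2 : `|gm k 0 - g k 0| <= `|K| * Num.sqrt r.
  have := hK (s p') (s p) (x p, y p, z p, u p) (sT _ Dp') (sT _ Dp) => /= le.
  have := le_trans (entry_le_enorm _ k 0) le; rewrite !mxE => h1.
  apply: le_trans h1 _; apply: le_trans (ler_wpM2r (sqrtr_ge0 _) (ler_norm K)) _.
  by rewrite ler_wpM2l// ler_sqrt ?ltW//; exact: (hr (inl (inl (inl (inl tt))))).
have F1 : `|L| * (c * r) < e / 2.
  have : r <= r1 by rewrite ge_min lexx.
  rewrite /r1 ler_pdivlMr// => h1; apply: lt_le_trans h1; rewrite mulrA mulrC ltr_pM2l//.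
  by rewrite ltrDl.
have F2 : `|K| * Num.sqrt r < e / 2.
  have h1 : Num.sqrt r <= e / 2 / (`|K| + 1).
    have q0 : 0 <= e / 2 / (`|K| + 1) by rewrite divr_ge0// ltW.
    by rewrite -(ger0_norm q0) -sqrtr_sqr; apply: ler_wsqrtr; rewrite ge_min lexx orbT.
  move: h1; rewrite ler_pdivlMr// => h1; apply: lt_le_trans h1; rewrite mulrC ltr_pM2l ?ltrDl//.
  by rewrite sqrtr_gt0.
rewrite (_ : g' k 0 - g k 0 = (g' k 0 - gm k 0) + (gm k 0 - g k 0)); last by ring.
by apply: le_lt_trans (ler_normD _ _) _; lra.
Qed.

End driver.

(** * The recursively defined sequence *)

Unset Implicit Arguments.

Theorem theorem3p2 (R : realType) (T : R) (hT : 0 < T)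
  (dx dy dz d0 : nat) (hdx : (0 < dx)%N) (hdy : (0 < dy)%N) (hdz : (0 < dz)%N)
  (hd0 : (0 < d0)%N)
  (d : measure_display) (Omega : measurableType d) (P : probability Omega R)
  (F : R -> set (set Omega)) (hF : filtration P T F)
  (B : R -> Omega -> 'cV[R]_d0) (hB : brownian_motion P T F B)
  (b : R -> 'cV[R]_dx -> 'cV[R]_dx)
  (sigma : R -> 'cV[R]_dx -> 'M[R]_(dx, d0))
  (h : R -> 'cV[R]_dx -> 'cV[R]_dz -> 'cV[R]_dx)
  (f : R -> 'cV[R]_dx -> 'cV[R]_dy -> 'M[R]_(dy, d0) -> 'cV[R]_dy -> 'cV[R]_dy)
  (Phi : 'cV[R]_dx -> 'cV[R]_dy)
  (lam : R -> 'cV[R]_dx -> R)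
  (nu : {measure set (borel 'cV[R]_dz) -> \bar R})
  (hb : C1_bounded_coef T b) (hsigma : C1_bounded_coef T sigma)
  (hfL : lipschitz_driver T f) (hPhiL : lipschitz_terminal Phi)
  (hfC : C1_bounded_driver T f) (hPhiC : exists C : R, C1_bounded C Phi)
  (hbt : half_holder T b) (hsigmat : half_holder T sigma)
  (hft : half_holder_driver T f)
  (eta : R) (hlam : intensity T lam eta)
  (hnu : levy_measure nu) (hnu1 : nu (@punctured R dz) = 1%E)
  (hh : jump_bounds T h) (hhm : jump_measurable T h)
  (hell : uniformly_elliptic T sigma)
  (w : nat -> R -> 'cV[R]_dx -> 'cV[R]_dy)
  (hw0 : forall (s : R) x, 0 <= s -> s < T ->
    pde_linear_part nu h lam T b sigma (w 0%N) s x = 0)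
  (hwS : forall m (s : R) x, 0 <= s -> s < T ->
    pde_linear_part nu h lam T b sigma (w m.+1) s x
      + f s x (w m s x) (jac (w m s) x *m sigma s x) (gamma nu h lam (w m) s x)
      + gamma nu h lam (w m) s x = 0)
  (hwT : forall m x, w m T x = Phi x)
  (hwC12 : forall m, C12 T (w m))
  (C : R) (hC : 0 < C)
  (hwb : forall m (s : R) x, 0 <= s <= T -> enorm (w m s x) <= C)
  (hwg : forall m (s : R) x, 0 <= s <= T -> enorm (jac (w m s) x) <= C) :
  forall (t : R) x (X : R -> Omega -> 'cV[R]_dx), 0 <= t <= T ->
    solves_sde P T F B b sigma h lam nu t x X ->
    (forall k, ((w 0%N t x k 0)%:E = 'E_P[fun o => (Phi (X T o) k 0)%R])%E) /\
    (forall m k, ((w m.+1 t x k 0)%:E =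
       'E_P[fun o => (Phi (X T o) k 0
         + \int[lebesgue_measure]_(s in `[t, T])
             (f s (X s o) (w m s (X s o)) (jac (w m s) (X s o) *m sigma s (X s o))
                (gamma nu h lam (w m) s (X s o)) k 0)
         + \int[lebesgue_measure]_(s in `[t, T])
             (gamma nu h lam (w m) s (X s o) k 0))%R])%E).
Proof.
move=> t x X tT sol.
have uC m (s : R) y k : 0 <= s <= T -> `|w m s y k 0| <= C.
  by move=> sT; apply: le_trans (entry_le_enorm _ k 0) (hwb m s y sT).
have fk m := feynman_kac hF hB hnu1 hb hsigma hbt hsigmat hlam hh hhm tT (hwC12 m) (hwb m).
have inT s : t <= s <= T -> 0 <= s <= T.
  by have /andP[t0 _] := tT => /andP[ts ->]; rewrite (le_trans t0 ts).
split => [k|m k]; rewrite unlock.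
  (* The equation for the first iterate has no source. *)
  apply: (fk 0%N k (fun _ _ => 0) 0 _ _ _ X) => //.
  - by move=> s y _; rewrite normr0.
  - by move=> s y s0 sT; rewrite hw0// mxE addr0.
  - move=> X' nX' o E; rewrite hwT E seg_cst ?mul0r ?addr0//.
    by case/andP: tT.
have wsc j := ss_u (C12_strip_smooth j (hwC12 m)).
have [Cf hCf] := hfC.
pose fw s y := f s y (w m s y) (jac (w m s) y *m sigma s y) (gamma nu h lam (w m) s y) k 0.
pose gw s y := gamma nu h lam (w m) s y k 0.
(* The bound is the zeroth-order one in the hypothesis on the driver, uniform in all its
   arguments. *)
have fwb (s : R) y : 0 <= s <= T -> `|fw s y| <= Cf.
  move=> sT; have [_ _ bf _] := hCf s (gamma nu h lam (w m) s y) sT.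
  exact: le_trans (entry_le_norm _ k 0) (bf (y, w m s y, jac (w m s) y *m sigma s y)).
have gwb (s : R) y : 0 <= s <= T -> `|gw s y| <= (C + C) * eta.
  by move=> sT; apply: (gamma_bounded hnu1 hlam hhm wsc (uC m)).
have mgw X' : nice_path T F t X' ->
    forall j, measurable_fun (`[t, T]%classic `*` [set: Omega] : set (measurableTypeR R * Omega))
      (fun p => gamma nu h lam (w m) p.1 (X' p.1 p.2) j 0).
  move=> nX' j; have g := gamma_along hF tT nX' hnu1 hlam hhm wsc (uC m).
  exact: g.
have mfw X' : nice_path T F t X' ->
    measurable_fun (`[t, T]%classic `*` [set: Omega] : set (measurableTypeR R * Omega))
      (fun p => fw p.1 (X' p.1 p.2)).
  move=> nX'; apply: (driver_measurable hfL hft (s := fun p => p.1) (x := fun p => X' p.1 p.2)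
    (y := fun p => w m p.1 (X' p.1 p.2))
    (z := fun p => jac (w m p.1) (X' p.1 p.2) *m sigma p.1 (X' p.1 p.2))
    (u := fun p => gamma nu h lam (w m) p.1 (X' p.1 p.2))) => [[s o] [/= + _]||i|i|i j|i].
  - by rewrite in_itv/=; exact: inT.
  - by apply: measurable_funTS; exact: measurable_fst.
  - exact: (nice_coord_measurable hF tT nX').
  - exact: (nice_along hF tT nX' (wsc i)).
  - rewrite (_ : (fun p => _) = (fun p : measurableTypeR R * Omega =>
       \sum_l jac (w m p.1) (X' p.1 p.2) i l * sigma p.1 (X' p.1 p.2) l j)); last first.
      by apply/funext => p; rewrite mxE.
    apply: measurable_sum => l; apply: measurable_funM.
      exact: (nice_along hF tT nX' (ss_g (C12_strip_smooth i (hwC12 m)) l)).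
    exact: (nice_along hF tT nX' (coef_scont hsigma hsigmat l j)).
  - exact: mgw.
(* The previous iterate is a known function, so the equation is linear with source driver plus jump
   term. A jump changes the iterate by at most C + C, and the intensity is at most [eta]. *)
apply: (fk m.+1 k (fun s y => fw s y + gw s y) (Cf + (C + C) * eta) _ _ _ X) => //.
- by move=> s y sT; apply: le_trans (ler_normD _ _) (lerD (fwb s y sT) (gwb s y sT)).
- by move=> X' nX'; exact: (measurable_funD (mfw X' nX') (mgw X' nX' k)).
- move=> s y s0 sT.
  have addE (A A' : 'cV[R]_dy) : (A + A') k 0 = A k 0 + A' k 0 by rewrite mxE.
  have := congr1 (fun A : 'cV[R]_dy => A k 0) (hwS m s y s0 sT).
  by rewrite /= !addE [(0 : 'cV[R]_dy) k 0]mxE addrA.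
move=> X' nX' o E; rewrite hwT E.
have r1 := nice_section (w := o) (mfw X' nX') (fun s sT => fwb s (X' s o) (inT s sT)).
have r2 := nice_section (w := o) (mgw X' nX' k) (fun s sT => gwb s (X' s o) (inT s sT)).
rewrite /= in r1 r2; rewrite EintD// addrA; congr (_ + _ + _).
  by apply: eq_Rintegral => s _; rewrite /fw E.
by apply: eq_Rintegral => s _; rewrite /gw E.
Qed.
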